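(* Let $D$ be the degree sequence of a tree. Among all trees with degree sequence $D$, the solvability is minimised by the $\mathcal M$-tree $\mathcal M(D)$: for every tree $T$ with degree sequence $D$, $s(T)\ge s(\mathcal M(D))$.
   Context: Solvability: for a graph $G$ with adjacency matrix $A$ (over the field $\mathbb F_2$), $s(G)$ is the number of pairs $(a,b)\in\mathbb F_2^{V(G)}\times\mathbb F_2^{V(G)}$ for which there exists $x\in\mathbb F_2^{V(G)}$ with $(A+\mathrm{diag}(a))x=b$, where $\mathrm{diag}(a)$ is the diagonal matrix with diagonal $a$. For rooted trees $T_1,\dots,T_k$, $[T_1,\dots,T_k]$ is the rooted tree whose root is adjacent to exactly the roots of $T_1,\dots,T_k$ (which are the components after deleting the root). Degree sequences are written in non-increasing order. $\mathcal M$-tree $\mathcal M(D)$: the reduced degree sequence of a tree is the sequence $(d_1,\dots,d_t)$, $d_1\ge\cdots\ge d_t\ge2$, of degrees of non-leaf vertices; it determines the degree sequence (when $t\ge1$), and one writes $\mathcal M(d_1,\dots,d_t)=\mathcal M(D)$. Write $[d]$ for the rooted star with $d$ vertices: a root with $d-1$ leaf children ($[1]$ is a single vertex). - If $t\le d_t+1$: $\mathcal M(d_1,\dots,d_t)$ is obtained from a star with centre of degree $d_t$ by identifying $t-1$ of its leaves with the roots of $[d_1],\dots,[d_{t-1}]$ respectively, i.e. $[[d_1],\dots,[d_{t-1}],[1],\dots,[1]]$ with root of degree $d_t$. Label the centre $v_1$ and the other non-leaf vertices $v_2,\dots,v_t$ such that $d(v_i)\le d(v_j)$ whenever $i<j$.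 - If $t\ge d_t+2$: construct first $\mathcal M(d_{d_t},d_{d_t+1},\dots,d_{t-1})$ with its labelling. Let $\ell$ be the largest integer such that $v_\ell$ is a label in it, and $s$ the smallest integer such that $v_s$ is adjacent to a leaf in it. Let $R_{d_t}=[[d_1],\dots,[d_{d_t-1}]]$, and label the roots of $[d_1],\dots,[d_{d_t-1}]$ as $v_{\ell+1},\dots,v_{\ell+d_t-1}$ so that still $d(v_i)\le d(v_j)$ for $i<j$ (the root of $R_{d_t}$ gets no label). $\mathcal M(d_1,\dots,d_t)$ is obtained by identifying the root of $R_{d_t}$ with a leaf adjacent to $v_s$. If $t=0$ (at most two vertices), $\mathcal M(D)$ is the unique tree with degree sequence $D$. *)

(* Defs.v *)
From mathcomp Require Import all_boot all_order all_algebra.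

Set Implicit Arguments.
Unset Strict Implicit.
Unset Printing Implicit Defensive.

Import GRing.Theory.

Section Graphs.

Variables (V : finType) (e : rel V).

Definition simple_graph : Prop := symmetric e /\ irreflexive e.

Definition connected : Prop := forall x y : V, connect e x y.

(* Cycles of length at least 3: in a symmetric relation, [:: x; y] is a
   ucycle for every edge xy. *)
Definition acyclic : Prop := forall c : seq V, 2 < size c -> ~~ ucycleb e c.

Definition is_tree : Prop := [/\ simple_graph, 0 < #|V|, connected & acyclic].

Definition degree (v : V) : nat := #|[set u | e v u]|.

Definition degree_seq : seq nat := sort geq [seq degree v | v : V].

Definition adjacency_mx : 'M['F_2]_#|V| :=
  \matrix_(i, j) (e (enum_val i) (enum_val j))%:R%R.

Definition solvability : nat :=
  #|[set ab : 'rV['F_2]_#|V| * 'cV['F_2]_#|V| |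
      [exists x : 'cV['F_2]_#|V|,
         ((adjacency_mx + diag_mx ab.1) *m x == ab.2)%R]]|.

End Graphs.

(* A sequence p encodes a rooted tree on the vertices 0, ..., size p:
   the root is 0 and the parent of i.+1 is the i-th entry of p. *)
Definition rooted := seq nat.

Implicit Types (p q : rooted) (u v : nat) (ds : seq nat).

Definition radj p : rel nat := fun u v =>
  ((0 < v) && (nth 0 p v.-1 == u)) || ((0 < u) && (nth 0 p u.-1 == v)).

Definition graph_of p : rel 'I_(size p).+1 := fun i j => radj p i j.
Arguments graph_of : clear implicits.

Definition nbrs p v : seq nat := [seq u <- iota 0 (size p).+1 | radj p v u].

Definition rdeg p v : nat := size (nbrs p v).

Definition leaf p v : bool := rdeg p v == 1.

(* The rooted star [d] has d vertices, not d leaves. *)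
Definition star d : rooted := nseq d.-1 0.

(* Identifies the root of q with the vertex u of p; every other vertex w of q
   becomes size p + w. *)
Definition graft p u q : rooted :=
  p ++ [seq if w == 0 then u else size p + w | w <- q].

(* [T_1, ..., T_k]: each step adds a new child (size p).+1 of the root 0 and
   identifies it with the root of the next tree. *)
Definition join (ts : seq rooted) : rooted :=
  foldl (fun p t => graft (rcons p 0) (size p).+1 t) [::] ts.

Definition sort_by_degree p (s : seq nat) : seq nat :=
  sort (fun u v => rdeg p u <= rdeg p v) s.

(* Returns the M-tree of ds = (d_1, ..., d_t), t >= 1, with the list
   (v_1, ..., v_l) of its labelled vertices.  Ties in the labelling, and the
   choice of a leaf at v_s, only affect the result up to isomorphism.  The
   recursive call is on t - d_t < t entries, so fuel t suffices. *)
Fixpoint mtree_rec (fuel : nat) ds : rooted * seq nat :=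
  let t := size ds in
  let dt := last 0 ds in
  if t <= dt.+1 then
    let p := join ([seq star d | d <- take t.-1 ds]
                     ++ nseq (dt - t.-1) (star 1)) in
    (p, 0 :: sort_by_degree p [seq v <- iota 1 (size p) | ~~ leaf p v])
  else if fuel is fuel'.+1 then
    let: (p, lab) := mtree_rec fuel' (drop dt.-1 (take t.-1 ds)) in
    let vs := head 0 [seq v <- lab | has (leaf p) (nbrs p v)] in
    let u := head 0 [seq w <- nbrs p vs | leaf p w] in
    let r := join [seq star d | d <- take dt.-1 ds] in
    let p' := graft p u r in
    (p', lab ++ sort_by_degree p' [seq size p + w | w <- nbrs r 0])
  else ([::], [::]).

Definition reduced (D : seq nat) : seq nat := [seq d <- D | 2 <= d].

(* If no degree is at least 2, the tree has at most two vertices and is a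
   star. *)
Definition mtree_code (D : seq nat) : rooted :=
  if reduced D is [::] then star (size D)
  else (mtree_rec (size (reduced D)) (reduced D)).1.

Definition mtree (D : seq nat) : rel 'I_(size (mtree_code D)).+1 :=
  graph_of (mtree_code D).
Arguments mtree : clear implicits.

(* Main.v *)
(* Eliminating a leaf v with neighbour u from the system (A + diag a) x = b
   gives s(G) = 2 s(G - v) + 8 s(G - v - u).  For a rooted tree this becomes a
   recursion with two numbers per branch: if x is the product of the ratios
   of the child branches, then a vertex contributes the factor 8 - 5 x to s
   and its branch has ratio (8 - 6 x) / (8 - 5 x), a decreasing function of x.
   So s is a product over the vertices that can be computed from any root, and
   a branch whose ratio is known can be contracted to a leaf with that ratio.

   Let A and B be the families of branches at two vertices of an optimal tree,
   away from each other.  The weight depends on the products a and b of their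
   ratios through c0 - c1 a - c2 b + c3 a b with c1, c2 > 0, and A and B may be
   redistributed as long as the two sizes survive, in either order.  Hence one
   of the two families is at least as large as the other and all its ratios
   are at most those of the other.

   This forces a Huffman-like greedy structure.  While fewer than dmin - 1
   stars have been built, some optimal tree has the leaves of smallest ratios
   at a vertex of maximal degree, and this star is contracted to a "big" leaf.
   Once there are dmin - 1 big leaves, some optimal tree has all of them at a
   vertex of minimal degree dmin, which is contracted to a "small" leaf whose
   ratio is the largest among the small leaves.  This is exactly the recursion
   that defines the M-tree. *)

Require Import Defs.
From HB Require Import structures.
From mathcomp Require Import all_boot all_order all_algebra.
From mathcomp Require Import ring lra zify.

Set Implicit Arguments.
Unset Strict Implicit.
Unset Printing Implicit Defensive.

Import Order.TTheory GRing.Theory Num.Theory.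

(** In the main case no isomorphism between an optimal tree and the M-tree is built. Both sides meet
    in the explicit number [mvalue]: [mvalue_le] bounds the weight of every tree of a class from
    below by it, and [minv] shows that the recursively constructed code attains it. Ties among
    optimal trees or labels are therefore harmless. A contracted branch is a leaf with an arbitrary
    ratio, so the induction runs over classes of trees with weighted leaves, and an order of ratios
    has to survive each contraction: small leaves lie below [lo], all other branches between [lo]
    and [hi], and big leaves above all internal branches. The numerical condition [low_leaves]
    recreates this order at the start of each round. On the M-tree side a later round replaces a
    leaf by a whole subtree. Hence the value must be known for arbitrary data at the leaf slots, and
    solvability is computed by eliminating two-component vectors along a parent list. Constants: a
    leaf vertex contributes 8 - 5 = 3 and has ratio 2/3, the value of [mobius] at 1. *)

Local Open Scope ring_scope.

(** * Trees with weighted leaves *)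

(* The boolean of a leaf tells big leaves from small ones; the rational is its
   ratio. *)
Inductive wtree := Leaf of bool & rat | Node of seq wtree.

(** The generated principle has no induction hypothesis for the trees inside a list; the inner
    induction under [fix] supplies it. *)
Lemma wtree_In_ind (P : wtree -> Prop) :
  (forall b w, P (Leaf b w)) ->
  (forall l, (forall t, List.In t l -> P t) -> P (Node l)) ->
  forall t, P t.
Proof.
move=> hl hn; fix IH 1.
case=> [b w|l]; first exact: hl.
apply: hn; elim: l => [|t l IHl] u; first by case.
case=> [<-|]; [exact: IH|exact: IHl].
Qed.

(** Only serves to give [wtree] decidable equality, on which [perm_eq] and membership depend. *)
Fixpoint wtree_enc (t : wtree) : GenTree.tree (bool * rat) :=
  match t with
  | Leaf b w => GenTree.Leaf (b, w)
  | Node l => GenTree.Node 0 (map wtree_enc l)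
  end.

Fixpoint wtree_dec (t : GenTree.tree (bool * rat)) : wtree :=
  match t with
  | GenTree.Leaf bw => Leaf bw.1 bw.2
  | GenTree.Node _ l => Node (map wtree_dec l)
  end.

Lemma wtree_encK : cancel wtree_enc wtree_dec.
Proof.
elim/wtree_In_ind => [b w //|l IH] /=; congr Node.
elim: l IH => //= t l IHl IH; rewrite IH ?IHl //; first by move=> u hu; apply: IH; right.
by left.
Qed.

HB.instance Definition _ := Equality.copy wtree (can_type wtree_encK).

Lemma In_wtreeP (t : wtree) l : List.In t l <-> t \in l.
Proof.
elim: l => //= u l IH; rewrite inE; split.
  by case=> [->|/IH ->]; rewrite ?eqxx ?orbT.
by case/predU1P => [->|/IH]; [left|right].
Qed.

Lemma wtree_mem_ind (P : wtree -> Prop) :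
  (forall b w, P (Leaf b w)) ->
  (forall l, (forall t, t \in l -> P t) -> P (Node l)) ->
  forall t, P t.
Proof.
move=> hl hn; elim/wtree_In_ind => [//|l IH]; apply: hn => t /In_wtreeP; exact: IH.
Qed.

(* Branch ratio of a vertex whose child branches have ratios with product x. *)
Definition mobius (x : rat) : rat := (8 - 6 * x) / (8 - 5 * x).

Fixpoint rho (t : wtree) : rat :=
  match t with
  | Leaf _ w => w
  | Node l => mobius (foldr *%R 1 (map rho l))
  end.

Definition prho (l : seq wtree) : rat := \prod_(t <- l) rho t.

(** Leaves count 1 here, although a genuine leaf vertex contributes 3; the missing power of 3 is
    restored in [tvec]. *)
Fixpoint wt (t : wtree) : rat :=
  match t with
  | Leaf _ _ => 1
  | Node l => foldr *%R 1 (map wt l) * (8 - 5 * prho l)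
  end.

Definition pwt (l : seq wtree) : rat := \prod_(t <- l) wt t.

Lemma rho_Node l : rho (Node l) = mobius (prho l).
Proof. by rewrite /= foldrE big_map. Qed.

Lemma wt_Node l : wt (Node l) = pwt l * (8 - 5 * prho l).
Proof. by rewrite /= foldrE big_map. Qed.

Lemma rho_Leaf b w : rho (Leaf b w) = w.
Proof. by []. Qed.
Lemma wt_Leaf b w : wt (Leaf b w) = 1.
Proof. by []. Qed.

Fixpoint leaves (t : wtree) : seq (bool * rat) :=
  match t with
  | Leaf b w => [:: (b, w)]
  | Node l => flatten (map leaves l)
  end.

Fixpoint bdegs (t : wtree) : seq nat :=
  match t with
  | Leaf _ _ => [::]
  | Node l => (size l).+1 :: flatten (map bdegs l)
  end.

Definition lleaves (l : seq wtree) := flatten (map leaves l).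
Definition ldegs (l : seq wtree) := flatten (map bdegs l).

Definition is_node (t : wtree) := if t is Node _ then true else false.

(* l is the list of branches at a vertex (the root) of degree size l; a branch
   vertex with m children has degree m + 1.  Leaves are not listed in D. *)
Definition in_class (D : seq nat) (L : seq (bool * rat)) (l : seq wtree) : bool :=
  perm_eq (size l :: ldegs l) D && perm_eq (lleaves l) L.

Lemma prho_cat A B : prho (A ++ B) = prho A * prho B.
Proof. exact: big_cat. Qed.
Lemma prho_cons t A : prho (t :: A) = rho t * prho A.
Proof. exact: big_cons. Qed.
Lemma prho_nil : prho [::] = 1.
Proof. exact: big_nil. Qed.
Lemma pwt_cat A B : pwt (A ++ B) = pwt A * pwt B.
Proof. exact: big_cat. Qed.
Lemma pwt_cons t A : pwt (t :: A) = wt t * pwt A.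
Proof. exact: big_cons. Qed.
Lemma pwt_nil : pwt [::] = 1.
Proof. exact: big_nil. Qed.
Lemma ldegs_cat A B : ldegs (A ++ B) = ldegs A ++ ldegs B.
Proof. by rewrite /ldegs map_cat flatten_cat. Qed.
Lemma lleaves_cat A B : lleaves (A ++ B) = lleaves A ++ lleaves B.
Proof. by rewrite /lleaves map_cat flatten_cat. Qed.

Lemma ldegs_cons t A : ldegs (t :: A) = ldegs [:: t] ++ ldegs A.
Proof. by rewrite -ldegs_cat. Qed.
Lemma lleaves_cons t A : lleaves (t :: A) = lleaves [:: t] ++ lleaves A.
Proof. by rewrite -lleaves_cat. Qed.

Lemma prho_perm A B : perm_eq A B -> prho A = prho B.
Proof. exact: perm_big. Qed.
Lemma pwt_perm A B : perm_eq A B -> pwt A = pwt B.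
Proof. exact: perm_big. Qed.
Lemma ldegs_perm A B : perm_eq A B -> perm_eq (ldegs A) (ldegs B).
Proof. by move=> h; apply/perm_flatten/perm_map. Qed.
Lemma lleaves_perm A B : perm_eq A B -> perm_eq (lleaves A) (lleaves B).
Proof. by move=> h; apply/perm_flatten/perm_map. Qed.

Lemma wt_perm A B : perm_eq A B -> wt (Node A) = wt (Node B).
Proof. by move=> h; rewrite !wt_Node (prho_perm h) (pwt_perm h). Qed.

Lemma in_class_perm D L A B : perm_eq A B -> in_class D L A -> in_class D L B.
Proof.
move=> h /andP[h1 h2]; apply/andP; split.
  by rewrite -(permPr h1) (perm_size h) perm_cons perm_sym ldegs_perm.
by rewrite -(permPr h2) perm_sym lleaves_perm.
Qed.

Definition pos1 (L : seq (bool * rat)) := all (fun bw => 0 < bw.2 < 1) L.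

Lemma pos1_cat L1 L2 : pos1 (L1 ++ L2) = pos1 L1 && pos1 L2.
Proof. exact: all_cat. Qed.

Lemma pos1_perm L1 L2 : perm_eq L1 L2 -> pos1 L1 = pos1 L2.
Proof. exact: perm_all. Qed.

Lemma mobius_bounds x : 0 < x <= 1 -> 0 < mobius x < 1.
Proof.
move=> /andP[h0 h1]; rewrite /mobius; apply/andP; split.
  by apply: divr_gt0; lra.
by rewrite ltr_pdivrMr; lra.
Qed.

Lemma pos1_mem l t : pos1 (lleaves l) -> t \in l -> pos1 (leaves t).
Proof.
move=> /allP h tl; apply/allP => bw hb; apply: h.
by apply/flattenP; exists (leaves t) => //; exact: map_f.
Qed.

Lemma prod_bounds (I : eqType) (F : I -> rat) (l : seq I) :
  (forall t, t \in l -> 0 < F t <= 1) -> 0 < \prod_(t <- l) F t <= 1.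
Proof.
elim: l => [|t l IH] h; first by rewrite big_nil; lra.
rewrite big_cons; have := h t (mem_head _ _).
have /andP[h1 h2] := IH (fun u hu => h u (mem_behead (s:=t::l) hu)).
move=> /andP[h3 h4]; apply/andP; split; first exact: mulr_gt0.
by rewrite mulr_ile1 // ltW.
Qed.

Lemma rho_bounds t : pos1 (leaves t) -> 0 < rho t < 1.
Proof.
elim/wtree_mem_ind: t => [b w|l IH]; first by rewrite /pos1 /= andbT.
rewrite rho_Node => h; apply/mobius_bounds/prod_bounds => t tl.
by case/andP: (IH t tl (pos1_mem h tl)) => -> /ltW ->.
Qed.

Lemma prho_bounds l : pos1 (lleaves l) -> 0 < prho l <= 1.
Proof.
move=> h; apply: prod_bounds => t tl.
by case/andP: (rho_bounds (pos1_mem h tl)) => -> /ltW ->.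
Qed.

Lemma prho_lt1 l : pos1 (lleaves l) -> (0 < size l)%N -> prho l < 1.
Proof.
case: l => // t l; rewrite /pos1 /lleaves /= all_cat => /andP[h1 h2] _.
rewrite prho_cons; case/andP: (rho_bounds h1) => h3 h4.
by case/andP: (prho_bounds h2) => h5 h6; nra.
Qed.

Lemma prod_gt0_seq (I : eqType) (F : I -> rat) (l : seq I) :
  (forall t, t \in l -> 0 < F t) -> 0 < \prod_(t <- l) F t.
Proof.
elim: l => [|t l IH] h; first by rewrite big_nil; lra.
rewrite big_cons mulr_gt0 ?h ?mem_head // IH // => u hu.
by rewrite h // inE hu orbT.
Qed.

Lemma wt_gt0 t : pos1 (leaves t) -> 0 < wt t.
Proof.
elim/wtree_mem_ind: t => [b w|l IH]; first by [].
rewrite wt_Node => h; apply: mulr_gt0.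
  by apply: prod_gt0_seq => t tl; apply: IH => //; exact: pos1_mem tl.
by case/andP: (prho_bounds h) => _ ?; lra.
Qed.

Lemma pwt_gt0 l : pos1 (lleaves l) -> 0 < pwt l.
Proof. by move=> h; apply: prod_gt0_seq => t tl; apply/wt_gt0/(pos1_mem h). Qed.

Lemma den_neq0 l : pos1 (lleaves l) -> 8 - 5 * prho l != 0.
Proof. by move=> /prho_bounds /andP[_ h]; apply: lt0r_neq0; lra. Qed.

(* ctree A Ys B is the tree with a path whose ends carry the branches A and B
   and whose inner vertices carry the members of Ys. *)
Definition chain (Ys : seq (seq wtree)) (t : wtree) : wtree :=
  foldr (fun Y t => Node (t :: Y)) t Ys.

Lemma chain_cons Y Ys t : chain (Y :: Ys) t = Node (chain Ys t :: Y).
Proof. by []. Qed.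

Lemma lleaves_chain Ys B : lleaves [:: chain Ys (Node B)] =
   lleaves B ++ flatten (map lleaves (rev Ys)).
Proof.
elim: Ys => [|Y Ys IH]; first by rewrite /= cats0 /lleaves /= !cats0.
rewrite /lleaves /= cats0.
rewrite /lleaves /= cats0 in IH.
by rewrite IH rev_cons map_rcons flatten_rcons catA.
Qed.

(** Up to the factor [pwt Y], an inner vertex with product y acts linearly on the pair (weight,
    weight times ratio), sending (p, q) to (8p - 5yq, 8p - 6yq). Affinity in [prho B] is thus
    preserved. The stated inequalities are strong enough to reproduce themselves for every y in (0,
    1]. *)
Lemma chain_affine (Ys : seq (seq wtree)) : pos1 (flatten (map lleaves Ys)) ->
  exists c1 c2 e1 e2 : rat,
  [/\ 0 < c2, c2 <= c1, 0 < e1, 0 < e2 & 6 * e2 < 8 * e1] /\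
  forall B, pos1 (lleaves B) ->
    wt (chain Ys (Node B)) =
      \prod_(Y <- Ys) pwt Y * pwt B * (c1 - e1 * prho B) /\
    wt (chain Ys (Node B)) * rho (chain Ys (Node B)) =
      \prod_(Y <- Ys) pwt Y * pwt B * (c2 - e2 * prho B).
Proof.
elim: Ys => [|Y Ys IH] h.
  exists 8, 8, 5, 6; split; first by split; lra.
  move=> B hB; rewrite big_nil mul1r -[chain [::] _]/(Node B) rho_Node wt_Node; split=> //.
  by rewrite /mobius; have := den_neq0 hB => hn; field.
have /andP[hY hYs] : pos1 (lleaves Y) && pos1 (flatten (map lleaves Ys)).
  by rewrite -pos1_cat.
have [c1 [c2 [e1 [e2 [[h1 h2 h3 h4 h5] H]]]]] := IH hYs.
have /andP[y0 y1] := prho_bounds hY.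
set y := prho Y in y0 y1 *.
exists (8 * c1 - 5 * y * c2), (8 * c1 - 6 * y * c2),
  (8 * e1 - 5 * y * e2), (8 * e1 - 6 * y * e2); split; first by split; nra.
move=> B hB; have [H1 H2] := H B hB.
have E1 : wt (chain (Y :: Ys) (Node B)) = \prod_(Y <- Y :: Ys) pwt Y * pwt B *
   (8 * c1 - 5 * y * c2 - (8 * e1 - 5 * y * e2) * prho B).
  rewrite chain_cons wt_Node pwt_cons prho_cons big_cons -/y.
  rewrite [X in _ = X](_ : _ = pwt Y * (8 * (wt (chain Ys (Node B))) - 5 * y * (wt (chain Ys (Node B)) * rho (chain Ys (Node B))))); first by ring.
  by rewrite H2 H1; ring.
split; first exact: E1.
have hl : pos1 (lleaves (chain Ys (Node B) :: Y)).
  rewrite lleaves_cons lleaves_chain !pos1_cat hB hY andbT /=.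
  by rewrite (pos1_perm (perm_flatten (perm_map _ (permEl (perm_rev Ys))))).
have hn := den_neq0 hl.
rewrite chain_cons wt_Node rho_Node /mobius.
rewrite [X in X = _](_ : _ = pwt (chain Ys (Node B) :: Y) * (8 - 6 * prho (chain Ys (Node B) :: Y))); last by field.
rewrite pwt_cons prho_cons big_cons -/y.
rewrite [X in _ = X](_ : _ = pwt Y * (8 * (wt (chain Ys (Node B))) - 6 * y * (wt (chain Ys (Node B)) * rho (chain Ys (Node B))))); first by ring.
by rewrite H2 H1; ring.
Qed.

Lemma ldegs_chain Ys B : perm_eq (ldegs [:: chain Ys (Node B)])
   ((size B).+1 :: ldegs B ++ flatten [seq (size Y).+2 :: ldegs Y | Y <- Ys]).
Proof.
elim: Ys => [|Y Ys]; first by rewrite /= cats0 /ldegs /= !cats0.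
rewrite /ldegs /= !cats0 /= -!/(ldegs _) => /permP IH.
apply/permP => a; move: (IH a) => /=; rewrite !count_cat /= !count_cat /=.
lia.
Qed.

Definition ctree A Ys B := chain Ys (Node B) :: A.

Lemma degs_ctree A Ys B : perm_eq (size (ctree A Ys B) :: ldegs (ctree A Ys B))
  ([:: (size A).+1; (size B).+1] ++ ldegs (A ++ B) ++
     flatten [seq (size Y).+2 :: ldegs Y | Y <- Ys]).
Proof.
rewrite /ctree ldegs_cons ldegs_cat; apply/permP => a.
have /permP/(_ a) := ldegs_chain Ys B; rewrite /= !count_cat /= ?count_cat.
lia.
Qed.

Lemma lleaves_ctree A Ys B : perm_eq (lleaves (ctree A Ys B))
  (lleaves (A ++ B) ++ flatten (map lleaves (rev Ys))).
Proof.
rewrite /ctree lleaves_cons !lleaves_cat lleaves_chain.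
by apply/permP => a; rewrite !count_cat; lia.
Qed.

(** The multiset of degrees does not record which end of the path has which degree, so the two sizes
    may be kept or interchanged; the second size follows from the first because the total is
    fixed. *)
Lemma in_class_redist D L Ys A B A' B' : perm_eq (A ++ B) (A' ++ B') ->
  (size A' == size A) || (size A' == size B) ->
  in_class D L (ctree A Ys B) -> in_class D L (ctree A' Ys B').
Proof.
rewrite /in_class => hp hs /andP[h1 h2]; apply/andP; split; last first.
  rewrite -(permPr h2) (permPl (lleaves_ctree _ _ _)) perm_sym.
  by rewrite (permPl (lleaves_ctree _ _ _)) perm_cat // lleaves_perm.
rewrite -(permPr h1) (permPl (degs_ctree _ _ _)) perm_sym.
rewrite (permPl (degs_ctree _ _ _)); apply: perm_cat.
  have f4 := perm_size hp; rewrite !size_cat in f4.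
  case/orP: hs => /eqP hs; rewrite hs.
    by have -> : size B' = size B by lia.
  have -> : size B' = size A by lia.
  by rewrite (perm_catC [:: _] [:: _]).
by apply: perm_cat => //; exact: ldegs_perm.
Qed.

(** * Optimal trees, exchange of branches and change of root *)

Definition opt D L (l : seq wtree) : Prop :=
  in_class D L l /\ forall l', in_class D L l' -> wt (Node l) <= wt (Node l').

Lemma in_class_pos1 D L l : pos1 L -> in_class D L l -> pos1 (lleaves l).
Proof. by move=> h /andP[_ h2]; rewrite (pos1_perm h2). Qed.

Lemma opt_in_class D L l : opt D L l -> in_class D L l.
Proof. by case. Qed.

Lemma pos1_ctree A Ys B : pos1 (lleaves (ctree A Ys B)) ->
  [/\ pos1 (lleaves A), pos1 (lleaves B) & pos1 (flatten (map lleaves Ys))].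
Proof.
rewrite /ctree lleaves_cons lleaves_chain.
rewrite !pos1_cat => /andP[/andP[-> h] ->]; split=> //.
by rewrite -(pos1_perm (perm_flatten (perm_map _ (permEl (perm_rev Ys))))).
Qed.

(** The coefficients come from the inner vertices alone, so one choice of them serves every
    redistribution of branches between the two ends. *)
Lemma wt_ctree Ys : pos1 (flatten (map lleaves Ys)) ->
  exists c k0 k1 k2 k3 : rat, [/\ 0 < c, 0 < k1, 0 < k2 &
    forall A B, pos1 (lleaves B) ->
    wt (Node (ctree A Ys B)) = c * pwt (A ++ B) *
      (k0 - k1 * prho A - k2 * prho B + k3 * (prho A * prho B))].
Proof.
move=> hY.
have [c1 [c2 [e1 [e2 [[h1 h2 h3 h4 h5] H]]]]] := chain_affine hY.
have hp : 0 < \prod_(Y <- Ys) pwt Y.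
  apply: prod_gt0_seq => Y hYY; apply: pwt_gt0.
  apply/allP => bw hbw; move/allP: hY; apply.
  by apply/flattenP; exists (lleaves Y) => //; exact: map_f.
exists (\prod_(Y <- Ys) pwt Y), (8 * c1), (5 * c2), (8 * e1), (5 * e2).
split=> //; [by apply: mulr_gt0 | by apply: mulr_gt0 |].
move=> A B hB; have [H1 H2] := H B hB.
rewrite wt_Node /ctree pwt_cons prho_cons pwt_cat.
rewrite [X in X = _](_ : _ = pwt A * (8 * (wt (chain Ys (Node B))) - 5 * prho A * (wt (chain Ys (Node B)) * rho (chain Ys (Node B))))); last by ring.
by rewrite H2 H1; ring.
Qed.

Lemma perm_swap_heads (T : eqType) (S1 A S2 B : seq T) :
  perm_eq ((S1 ++ A) ++ (S2 ++ B)) ((S2 ++ A) ++ (S1 ++ B)).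
Proof. by apply/permP => a; rewrite !count_cat; lia. Qed.

Lemma perm_swap_tails (T : eqType) (S1 A S2 B : seq T) :
  perm_eq ((S1 ++ A) ++ (S2 ++ B)) ((S1 ++ B) ++ (S2 ++ A)).
Proof. by apply/permP => a; rewrite !count_cat; lia. Qed.

(* If A, B are the branches at two vertices of an optimal tree, exchanging
   S1 with S2 and exchanging A with B afterwards are both admissible, and one
   of the two improves the tree unless S1 has the smaller product. *)
Lemma exchange D L Ys S1 A S2 B : pos1 L ->
  opt D L (ctree (S1 ++ A) Ys (S2 ++ B)) ->
  (size S1 == size S2) || (size A == size B) ->
  prho (S1 ++ A) <= prho (S2 ++ B) -> prho S1 <= prho S2.
Proof.
move=> hL [hK hO] hs hx; rewrite leNgt; apply/negP => hlt.
have [hA hB hY] := pos1_ctree (in_class_pos1 hL hK).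
have hS : [/\ pos1 (lleaves S1), pos1 (lleaves A), pos1 (lleaves S2) & pos1 (lleaves B)].
  by move: hA hB; rewrite !lleaves_cat !pos1_cat => /andP[-> ->] /andP[-> ->].
case: hS => p1 pA p2 pB.
have [c [k0 [k1 [k2 [k3 [hc hk1 hk2 H]]]]]] := wt_ctree hY.
have perm1 : perm_eq ((S1 ++ A) ++ (S2 ++ B)) ((S2 ++ A) ++ (S1 ++ B)).
  exact: perm_swap_heads.
have perm2 : perm_eq ((S1 ++ A) ++ (S2 ++ B)) ((S1 ++ B) ++ (S2 ++ A)).
  exact: perm_swap_tails.
have /hO o1 : in_class D L (ctree (S2 ++ A) Ys (S1 ++ B)).
  by apply: in_class_redist perm1 _ hK; rewrite !size_cat eqn_add2r eqn_add2l eq_sym.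
have /hO o2 : in_class D L (ctree (S1 ++ B) Ys (S2 ++ A)).
  by apply: in_class_redist perm2 _ hK; rewrite !size_cat eqn_add2l eqn_add2r eq_sym orbC.
move: o1 o2; rewrite !H ?lleaves_cat ?pos1_cat ?p1 ?p2 ?pA ?pB //.
rewrite -(pwt_perm perm1) -(pwt_perm perm2).
have hcp : 0 < c * pwt ((S1 ++ A) ++ S2 ++ B).
  by rewrite mulr_gt0 // pwt_gt0 // !lleaves_cat !pos1_cat p1 p2 pA pB.
rewrite !ler_pM2l // !prho_cat.
rewrite prho_cat in hx; rewrite prho_cat in hx.
have /andP[] := prho_bounds p1; have /andP[] := prho_bounds p2.
have /andP[] := prho_bounds pA; have /andP[] := prho_bounds pB.
set a := prho S1 in hlt hx *; set b := prho S2 in hlt hx *.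
set u := prho A in hx *; set v := prho B in hx *.
move=> v0 _ u0 _ b0 _ a0 _ o1 o2.
(* The product over both ends is [a * b * u * v] in all three trees, so the [k0] and [k3] terms
   cancel. With [b < a], the first exchange gives [k2 * v <= k1 * u]. As [a * u <= b * v] forces
   [u < v], the second gives [k1 * a <= k2 * b], hence [k1 < k2]. Together, k1 v < k2 v <= k1 u < k1
   v. *)
have q1 : (a - b) * (k2 * v - k1 * u) <= 0 by nra.
have q2 : k2 * v <= k1 * u by rewrite pmulr_rle0 ?subr_gt0 // subr_le0 in q1.
have uv : u < v.
  have : b * u < b * v by apply: lt_le_trans hx; rewrite ltr_pM2r.
  by rewrite ltr_pM2l.
have q3 : (v - u) * (k1 * a - k2 * b) <= 0 by nra.
have q4 : k1 * a <= k2 * b by rewrite pmulr_rle0 ?subr_gt0 // subr_le0 in q3.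
have q5 : k1 < k2.
  have : k1 * a < k2 * a by apply: le_lt_trans q4 _; rewrite ltr_pM2l.
  by rewrite ltr_pM2r.
have : k1 * v < k1 * v.
  apply: lt_trans (_ : k2 * v < _); first by rewrite ltr_pM2r.
  by apply: le_lt_trans q2 _; rewrite ltr_pM2l.
by rewrite ltxx.
Qed.

Definition dominated (A B : seq wtree) : Prop :=
  (size B <= size A)%N /\ {in A & B, forall a b, rho a <= rho b}.

Lemma opt_perm D L A B : perm_eq A B -> opt D L A -> opt D L B.
Proof.
move=> h [h1 h2]; split; first exact: in_class_perm h1.
by move=> l' /h2; rewrite (wt_perm h).
Qed.

Lemma opt_ctree_perm A A' Ys B B' : perm_eq A A' -> perm_eq B B' ->
  forall D L, opt D L (ctree A Ys B) -> opt D L (ctree A' Ys B').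
Proof.
move=> hA hB D L [hK hO].
have hp : perm_eq (A ++ B) (A' ++ B') by apply: perm_cat.
have e : wt (chain Ys (Node B)) = wt (chain Ys (Node B')) /\
         rho (chain Ys (Node B)) = rho (chain Ys (Node B')).
  elim: Ys {hK hO} => [|Y Ys [IH1 IH2]].
    by rewrite /chain /= -/(prho _) -!/(wt (Node _)) -!/(rho (Node _)) (wt_perm hB) !rho_Node (prho_perm hB).
  by rewrite !chain_cons !wt_Node !rho_Node !prho_cons !pwt_cons IH1 IH2.
split; first by apply: in_class_redist hp _ hK; rewrite (perm_size hA) eqxx.
move=> l' /hO; rewrite /ctree !wt_Node !pwt_cons !prho_cons.
by case: e => -> ->; rewrite (prho_perm hA) (pwt_perm hA).
Qed.

(** Exchanging one branch of each end gives the order of the ratios. For the sizes, the empty family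
    is exchanged with the surplus branches of [B]: its product 1 would have to be at most a product
    below 1. *)
Lemma opt_dominated D L A Ys B : pos1 L -> opt D L (ctree A Ys B) ->
  prho A <= prho B -> dominated A B.
Proof.
move=> hL hO hx.
have [hA hB _] := pos1_ctree (in_class_pos1 hL (opt_in_class hO)).
split; last first.
  move=> a b ha hb.
  have pA := perm_to_rem ha; have pB := perm_to_rem hb.
  have := opt_ctree_perm pA pB hO; rewrite -!(cat1s _ (rem _ _)) => hO'.
  have := exchange hL hO' isT; rewrite -(prho_perm pA) -(prho_perm pB) => /(_ hx).
  by rewrite !prho_cons !prho_nil !mulr1.
rewrite leqNgt; apply/negP => hlt.
set k := (size B - size A)%N.
have := @exchange D L Ys [::] A (take k B) (drop k B) hL.
rewrite cat_take_drop => /(_ hO); rewrite size_drop /= => h.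
have {}h : prho [::] <= prho (take k B) by apply: h; rewrite // /k; lia.
move: h; rewrite prho_nil leNgt; case/negP; apply: prho_lt1.
  by move: hB; rewrite -[in lleaves B](cat_take_drop k B) lleaves_cat pos1_cat => /andP[].
by rewrite size_take /k; case: ifP; lia.
Qed.

Lemma degs_ctree_rev A Ys B : perm_eq (size (ctree A Ys B) :: ldegs (ctree A Ys B))
  (size (ctree B (rev Ys) A) :: ldegs (ctree B (rev Ys) A)).
Proof.
rewrite (permPl (degs_ctree _ _ _)) perm_sym (permPl (degs_ctree _ _ _)).
apply: perm_cat.
  by apply/permP => a; rewrite /= !addn0 addnC.
apply: perm_cat; first by apply/ldegs_perm; rewrite perm_catC.
by apply/perm_flatten/perm_map; rewrite perm_rev.
Qed.

Lemma lleaves_ctree_rev A Ys B : perm_eq (lleaves (ctree A Ys B))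
  (lleaves (ctree B (rev Ys) A)).
Proof.
rewrite (permPl (lleaves_ctree _ _ _)) perm_sym (permPl (lleaves_ctree _ _ _)).
apply: perm_cat; first by apply/lleaves_perm; rewrite perm_catC.
by apply/perm_flatten/perm_map; rewrite perm_rev.
Qed.

Lemma in_class_ctree_rev D L A Ys B :
  in_class D L (ctree A Ys B) = in_class D L (ctree B (rev Ys) A).
Proof.
by rewrite /in_class (permPl (degs_ctree_rev _ _ _)) (permPl (lleaves_ctree_rev _ _ _)).
Qed.

(** With a, b the products of [A] and [B], both sides equal [pwt A * pwt B] times 64 - 40 a - 40 b +
    30 a b, which is symmetric. *)
Lemma wt_edge A B : pos1 (lleaves A) -> pos1 (lleaves B) ->
  wt (Node (Node A :: B)) = wt (Node (Node B :: A)).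
Proof.
move=> hA hB.
rewrite !wt_Node !prho_cons !pwt_cons !rho_Node !wt_Node /mobius.
by have := den_neq0 hA; have := den_neq0 hB => h1 h2; field; rewrite h1 h2.
Qed.

(** The root moves along the path one edge at a time, by [wt_edge]. *)
Lemma wt_ctree_rev A Ys B : pos1 (lleaves (ctree A Ys B)) ->
  wt (Node (ctree A Ys B)) = wt (Node (ctree B (rev Ys) A)).
Proof.
elim: Ys A => [|Y Ys IH] A h.
  by have [hA hB _] := pos1_ctree h; rewrite wt_edge.
have [hA hB hY] := pos1_ctree h.
have h1 : pos1 (lleaves (ctree (Node A :: Y) Ys B)).
  rewrite -(pos1_perm (lleaves_perm (_ : perm_eq (Node A :: ctree Y Ys B) _))).
    rewrite lleaves_cons /lleaves /= cats0 -/(lleaves _) pos1_cat hA /=.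
    move: h; rewrite /ctree lleaves_cons chain_cons /lleaves /= cats0 => h.
    by move: h; rewrite pos1_cat => /andP[].
  by rewrite /ctree; apply/permP => a /=; lia.
rewrite /ctree chain_cons wt_edge //; last first.
  have [_ _ ] := pos1_ctree h1; have [+ _ _] := pos1_ctree h1.
  move=> h2 _; move: h; rewrite /ctree lleaves_cons chain_cons.
  by rewrite {1}/lleaves /= cats0 -/(lleaves (chain _ _ :: _)) pos1_cat => /andP[].
rewrite (@wt_perm _ (ctree (Node A :: Y) Ys B)).
  rewrite IH // /ctree rev_cons; congr (wt (Node (_ :: _))).
  by rewrite /chain -cats1 foldr_cat.
by rewrite /ctree; apply/permP => a /=; lia.
Qed.

Section Opt.

Variables (D : seq nat) (L : seq (bool * rat)).
Hypothesis hL : pos1 L.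

Lemma opt_same_wt A B : opt D L A -> in_class D L B ->
  wt (Node B) = wt (Node A) -> opt D L B.
Proof. by move=> [h1 h2] hB e; split=> // l /h2; rewrite e. Qed.

Lemma opt_rev A Ys B : opt D L (ctree A Ys B) -> opt D L (ctree B (rev Ys) A).
Proof.
move=> h; apply: (opt_same_wt h); first by rewrite -in_class_ctree_rev; case: h.
by rewrite -wt_ctree_rev // (in_class_pos1 hL (opt_in_class h)).
Qed.

Lemma opt_edge A B : opt D L (Node A :: B) -> opt D L (Node B :: A).
Proof. exact: (@opt_rev B [::] A). Qed.

(** The tool for ties: the total product is fixed, so keeping the product at one end keeps the one
    at the other end, and with it the weight. *)
Lemma opt_swap A Ys B A' B' : opt D L (ctree A Ys B) ->
  perm_eq (A ++ B) (A' ++ B') -> (size A' == size A) || (size A' == size B) ->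
  prho A' = prho A -> opt D L (ctree A' Ys B').
Proof.
move=> h hp hs e; have hK := in_class_redist hp hs (opt_in_class h).
apply: (opt_same_wt h) => //.
have [hA hB hY] := pos1_ctree (in_class_pos1 hL (opt_in_class h)).
have [_ hB' _] := pos1_ctree (in_class_pos1 hL hK).
have [c [k0 [k1 [k2 [k3 [hc hk1 hk2 H]]]]]] := wt_ctree hY.
rewrite !H // (pwt_perm hp) e.
suff -> : prho B' = prho B by [].
have := prho_perm hp; rewrite !prho_cat e => /mulfI -> //.
by case/andP: (prho_bounds hA) => /lt0r_neq0.
Qed.

Lemma opt_step A Ys B C : opt D L (ctree A Ys B) -> Node C \in B ->
  opt D L (ctree A (rcons Ys (rem (Node C) B)) C).
Proof.
move=> h hC; have := opt_ctree_perm (perm_refl A) (perm_to_rem hC) h.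
by rewrite /ctree /chain -cats1 foldr_cat.
Qed.

(** The end [A] stays fixed while the far end descends towards the leaf, the vertices left behind
    joining the path. This and the next two lemmas bring any vertex of interest opposite to [A],
    where domination applies. *)
Lemma walk_leaf A Ys B b w : opt D L (ctree A Ys B) -> (b, w) \in lleaves B ->
  exists Zs C, opt D L (ctree A Zs C) /\ Leaf b w \in C.
Proof.
move: {2}(Node B) (erefl (Node B)) => t; elim/wtree_mem_ind: t Ys B => // l IH Ys B [e] h; subst l.
move=> /flattenP[_ /mapP[t tB ->]]; case: t tB => [b' w'|C] tB.
  by rewrite inE => /eqP[-> ->]; exists Ys, B.
move=> hw; have := opt_step h tB => h'.
exact: (IH _ tB _ _ (erefl _) h' hw).
Qed.

Lemma walk_deg A Ys B d : opt D L (ctree A Ys B) -> d \in bdegs (Node B) ->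
  exists Zs C, opt D L (ctree A Zs C) /\ d = (size C).+1.
Proof.
move: {2}(Node B) (erefl (Node B)) => t; elim/wtree_mem_ind: t Ys B => // l IH Ys B [e] h; subst l.
rewrite inE => /predU1P[->|]; first by exists Ys, B.
move=> /flattenP[_ /mapP[t tB ->]]; case: t tB => [b' w'|C] tB // hd.
exact: (IH _ tB _ _ (erefl _) (opt_step h tB) hd).
Qed.

Lemma walk_pendant A Ys B : opt D L (ctree A Ys B) ->
  exists Zs C, opt D L (ctree A Zs C) /\ ~~ has is_node C.
Proof.
move: {2}(Node B) (erefl (Node B)) => t; elim/wtree_mem_ind: t Ys B => // l IH Ys B [e] h; subst l.
have [/hasP[t tB]|hn] := boolP (has is_node B); last by exists Ys, B.
case: t tB => // C tB _.
exact: (IH _ tB _ _ (erefl _) (opt_step h tB)).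
Qed.

End Opt.

(** * Finiteness of a class and existence of minimisers *)

Fixpoint seqs_upto (T : Type) (X : seq T) (m : nat) : seq (seq T) :=
  if m is m'.+1 then [::] :: [seq x :: l | x <- X, l <- seqs_upto X m'] else [:: [::]].

Lemma mem_seqs_upto (T : eqType) (X : seq T) m l :
  (size l <= m)%N -> {subset l <= X} -> l \in seqs_upto X m.
Proof.
elim: m l => [|m IH] [|x l] //= hs hX; rewrite inE /=.
apply/allpairsP; exists (x, l); split=> //=; first exact/hX/mem_head.
by apply: IH => // y hy; apply: hX; rewrite inE hy orbT.
Qed.

Fixpoint trees_upto (L : seq (bool * rat)) (m n : nat) : seq wtree :=
  [seq Leaf bw.1 bw.2 | bw <- L] ++
  (if n is n'.+1 then map Node (seqs_upto (trees_upto L m n') m) else [::]).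

(** The number of internal vertices serves as a bound on the depth. *)
Lemma mem_trees_upto L m n t : (size (bdegs t) <= n)%N ->
  all (fun d => d <= m.+1)%N (bdegs t) -> {subset leaves t <= L} ->
  t \in trees_upto L m n.
Proof.
elim: n t => [|n IH] [b w|l] //= hs hd hl; rewrite mem_cat; apply/orP.
- by left; apply/mapP; exists (b, w) => //; apply: hl; rewrite mem_head.
- by left; apply/mapP; exists (b, w) => //; apply: hl; rewrite mem_head.
right; case/andP: hd => hd1 hd2; apply/map_f/mem_seqs_upto => // t tl.
apply: IH.
- have := perm_size (ldegs_perm (perm_to_rem tl)).
  rewrite ldegs_cons {2}/ldegs /= cats0 size_cat; rewrite /ldegs in hs *; lia.
- apply/allP => d hd; move/allP: hd2; apply; apply/flattenP.
  by exists (bdegs t) => //; exact: map_f.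
- by move=> x hx; apply: hl; apply/flattenP; exists (leaves t) => //; exact: map_f.
Qed.

Lemma in_class_finite D L : exists E : seq (seq wtree), forall l, in_class D L l -> l \in E.
Proof.
pose m := sumn D.
exists (seqs_upto (trees_upto L m (size D)) m) => l /andP[h1 h2].
have hle d : d \in D -> (d <= m)%N.
  by rewrite /m; elim: D {h1 m} => //= x s IH; rewrite inE => /predU1P[->|/IH]; lia.
have hd : all (fun d => d <= m)%N (size l :: ldegs l).
  by rewrite (perm_all _ h1); apply/allP.
case/andP: hd => hd1 hd2.
apply: mem_seqs_upto => // t tl; apply: mem_trees_upto.
- have := perm_size (ldegs_perm (perm_to_rem tl)).
  rewrite ldegs_cons {2}/ldegs /= cats0 size_cat -(perm_size h1) /=; lia.
- apply/allP => d hdt; apply/leqW/(allP hd2).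
  by apply/flattenP; exists (bdegs t) => //; exact: map_f.
- move=> x hx; rewrite -(perm_mem h2); apply/flattenP.
  by exists (leaves t) => //; exact: map_f.
Qed.

Lemma exists_min (T : eqType) (m : T -> rat) (P : pred T) (s : seq T) x0 :
  x0 \in s -> P x0 -> exists2 x, P x & forall y, y \in s -> P y -> m x <= m y.
Proof.
elim: s x0 => // a s IH x0; rewrite inE => h hP.
have [/hasP[y ys Py]|hn] := boolP (has P s).
  have [x Px hx] := IH y ys Py.
  have [ha|ha] := boolP (P a && (m a <= m x)).
    case/andP: ha => Pa ha; exists a => // z; rewrite inE => /predU1P[->|zs Pz] //.
    exact: le_trans ha (hx _ zs Pz).
  exists x => // z; rewrite inE => /predU1P[->|zs Pz] //; last exact: hx.
  by move=> Pa; move: ha; rewrite Pa /= -ltNge => /ltW.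
exists x0 => // y; rewrite inE => /predU1P[->|ys Py]; last first.
  by case/hasP: hn; exists y.
case/predU1P: h => [->//|h0]; by case/hasP: hn; exists x0.
Qed.

Lemma min_in_class D L (m : seq wtree -> rat) (P : pred (seq wtree)) l0 :
  in_class D L l0 -> P l0 -> exists l, [/\ in_class D L l, P l &
    forall l', in_class D L l' -> P l' -> m l <= m l'].
Proof.
move=> h0 p0; have [E hE] := in_class_finite D L.
have [|l /andP[h1 h2] h3] := @exists_min _ m (fun l => in_class D L l && P l) E l0 (hE _ h0).
  by rewrite h0.
by exists l; split=> // l' k p; apply: h3; rewrite ?k ?p //; exact: hE.
Qed.

(** * Small and big leaves, and bounds on branch ratios *)

Definition typed (S Bg : seq rat) : seq (bool * rat) :=
  map (pair false) S ++ map (pair true) Bg.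

Definition is_small (t : wtree) := if t is Leaf false _ then true else false.
Definition is_big (t : wtree) := if t is Leaf true _ then true else false.

Definition kids (t : wtree) := if t is Node l then l else [::].

Lemma mem_typed b w S Bg : ((b, w) \in typed S Bg) = (w \in if b then Bg else S).
Proof.
rewrite mem_cat; apply/orP/idP.
  by case=> /mapP[x hx [-> ->]].
by case: b => h; [right|left]; exact: map_f.
Qed.

Lemma leaf_in_typed D S Bg l t : in_class D (typed S Bg) l -> t \in l ->
  forall b w, (b, w) \in leaves t -> w \in if b then Bg else S.
Proof.
move=> /andP[_ h] tl b w hw; rewrite -mem_typed -(perm_mem h); apply/flattenP.
by exists (leaves t) => //; exact: map_f.
Qed.

Lemma in_class_has_node D L l : (1 < size D)%N -> in_class D L l ->
  exists2 C, Node C \in l & perm_eq l (Node C :: rem (Node C) l).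
Proof.
move=> hD /andP[h _]; have := perm_size h => /= hs.
suff /hasP[t tl] : has is_node l.
  by case: t tl => // C tl _; exists C => //; exact: perm_to_rem.
apply/negPn/negP => /hasPn hn; have : ldegs l = [::].
  rewrite /ldegs; elim: l hn {h hs} => //= t l IH hn.
  rewrite IH; last by move=> u hu; apply: hn; rewrite inE hu orbT.
  by have := hn t (mem_head _ _); case: t {hn}.
move=> e; rewrite e /= in hs; lia.
Qed.

(** Selects, among the optimal trees, one that is extremal for a secondary criterion; [P] only has
    to be reachable from each optimal tree, for instance by re-rooting. Rational values of [m]
    accommodate ratios and counts alike. *)
Lemma exists_opt D L l0 (P : pred (seq wtree)) (m : seq wtree -> rat) :
  in_class D L l0 -> (forall l, opt D L l -> exists2 l', opt D L l' & P l') ->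
  exists l, [/\ opt D L l, P l & forall l', opt D L l' -> P l' -> m l <= m l'].
Proof.
move=> h0 hP.
have [l1 [k1 _ o1]] := @min_in_class D L (fun l => wt (Node l)) predT _ h0 isT.
have op1 : opt D L l1 by split=> // l' /o1 ->.
have [l2 op2 P2] := hP _ op1.
have e2 l : opt D L l -> wt (Node l) = wt (Node l1).
  by move=> [a b]; apply/eqP; rewrite eq_le b // o1.
have [|l3 [k3 /andP[/eqP e3 P3] o3]] :=
  @min_in_class D L m (fun l => (wt (Node l) == wt (Node l1)) && P l) l2 (opt_in_class op2).
  by rewrite e2 ?eqxx.
exists l3; split=> //; first by split=> // l' /o1; rewrite e3 => ->.
by move=> l' h' p'; apply: o3; rewrite ?e2 ?eqxx ?p' //; case: h'.
Qed.

Lemma exists_opt_lex D L l0 (P : pred (seq wtree)) (m1 m2 : seq wtree -> rat) :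
  in_class D L l0 -> (forall l, opt D L l -> exists2 l', opt D L l' & P l') ->
  exists l, [/\ opt D L l, P l & forall l', opt D L l' -> P l' ->
     m1 l <= m1 l' /\ (m1 l' = m1 l -> m2 l <= m2 l')].
Proof.
move=> h0 hP.
have [l1 [op1 P1 min1]] := exists_opt m1 h0 hP.
have [|l2 [op2 /andP[/eqP e2 P2] min2]] := @exists_opt D L l0
  (fun l => (m1 l == m1 l1) && P l) m2 h0.
  by move=> _ _; exists l1; rewrite ?eqxx.
exists l2; split=> // l' o' p'; split; first by rewrite e2 min1.
by move=> e'; apply: min2; rewrite ?e' ?e2 ?eqxx.
Qed.

(** The least element of [S] is matched with itself when it occurs in [Xs], and otherwise with any
    available factor, all being at least as large. Missing factors count as 1, an upper bound for
    [S]. *)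
Lemma prod_smallest_le (S : seq rat) : sorted <=%R S -> (forall s, s \in S -> 0 < s <= 1) ->
  forall m Xs Xo, (size Xs + size Xo <= m)%N -> (m <= size S)%N ->
  (forall x, count_mem x Xs <= count_mem x S)%N ->
  (forall y s, y \in Xo -> s \in S -> s <= y) ->
  \prod_(s <- take m S) s <= \prod_(x <- Xs) x * \prod_(x <- Xo) x.
Proof.
elim: S => [|s S IH] hS h01 m Xs Xo h1 h2 h3 h4.
  case: m h1 h2 => //; case: Xs h3 => [|//] _; case: Xo h4 => [|//] _ _ _.
  by rewrite take0 !big_nil mulr1.
case: m h1 h2 => [|m] h1 h2.
  case: Xs h3 h1 => [|//] _; case: Xo h4 => [|//] _ _.
  by rewrite take0 !big_nil mulr1.
have hS' := path_sorted hS.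
have s1 : forall x, x \in S -> s <= x.
  by move/order_path_min: hS => /(_ le_trans)/allP.
have h01' : forall x, x \in S -> 0 < x <= 1 by move=> x hx; apply: h01; rewrite inE hx orbT.
have s0 : 0 < s <= 1 by apply: h01; exact: mem_head.
have tk : 0 < \prod_(s <- take m S) s <= 1.
  by apply: prod_bounds => t /mem_take; exact: h01'.
rewrite /= big_cons.
have [sX|sX] := boolP (s \in Xs).
  rewrite (perm_big _ (perm_to_rem sX)) big_cons -mulrA ler_pM2l; last by case/andP: s0.
  apply: IH => //; first by rewrite size_rem //; case: Xs sX h1 {h3} => //= *; lia.
    by move=> x; have := h3 x; have /permP/(_ (pred1 x)) := perm_to_rem sX => -> /=; lia.
  by move=> y z hy hz; apply: h4 => //; rewrite inE hz orbT.
have h3' x : (count_mem x Xs <= count_mem x S)%N.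
  have := h3 x; rewrite /=; case: eqP => [<-|] //=.
  by have /count_memPn -> := sX.
case: Xs h1 h3 h3' sX => [|y Xs] h1 h3 h3' sX.
  case: Xo h1 h4 => [|y Xo] h1 h4.
    by rewrite !big_nil mulr1; case/andP: s0; case/andP: tk => *; nra.
  rewrite big_nil mul1r big_cons; apply: ler_pM.
  - by case/andP: s0 => /ltW.
  - by case/andP: tk => /ltW.
  - by apply: h4; exact: mem_head.
  have := IH hS' h01' m [::] Xo; rewrite big_nil mul1r; apply=> //.
  by move=> z t hz ht; apply: h4; rewrite inE ?hz ?ht orbT.
have hy : y \in S.
  by rewrite -has_pred1 has_count; apply: leq_trans (h3' y); rewrite /= eqxx.
rewrite big_cons -mulrA; apply: ler_pM.
- by case/andP: s0 => /ltW.
- by case/andP: tk => /ltW.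
- exact: s1.
apply: IH => //.
  by move=> x; apply: leq_trans (h3' x); rewrite /= leq_addl.
by move=> z t hz ht; apply: h4 => //; rewrite inE ht orbT.
Qed.

Lemma mobius_le x y : 0 < x <= 1 -> 0 < y <= 1 -> x <= y -> mobius y <= mobius x.
Proof.
move=> /andP[x0 x1] /andP[y0 y1] h; rewrite /mobius.
rewrite ler_pdivrMr; last by lra.
rewrite mulrAC ler_pdivlMr; last by lra.
nra.
Qed.

Lemma prho_le_exp l (hi : rat) : 0 <= hi -> (forall t, t \in l -> 0 < rho t <= hi) ->
  prho l <= hi ^+ size l.
Proof.
move=> h0; elim: l => [|t l IH] h; first by rewrite prho_nil.
rewrite prho_cons exprS; have /andP[t0 t1] := h t (mem_head _ _).
have hl : forall u, u \in l -> 0 < rho u <= hi by move=> u hu; apply: h; rewrite inE hu orbT.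
apply: ler_pM => //; [exact: ltW | | exact: IH].
by apply/ltW/prod_gt0_seq => u /hl /andP[].
Qed.

Lemma count_leaves_child x t l : t \in l ->
  (count_mem x (leaves t) <= count_mem x (lleaves l))%N.
Proof.
move=> tl; have /permP -> := lleaves_perm (perm_to_rem tl).
by rewrite lleaves_cons {1}/lleaves /= cats0 count_cat leq_addr.
Qed.

Lemma prho_small_split l : prho l =
  \prod_(x <- [seq rho c | c <- l & is_small c]) x *
  \prod_(x <- [seq rho c | c <- l & ~~ is_small c]) x.
Proof.
rewrite /prho !big_map !big_filter (bigID is_small) /=.
by congr (_ * _).
Qed.

Lemma count_smalls x l :
  (count_mem x [seq rho c | c <- l & is_small c] <= count_mem (false, x) (lleaves l))%N.
Proof.
elim: l => //= t l IH; rewrite lleaves_cons count_cat.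
case: t => [[] w|m] /=; rewrite ?addn0 /=; try lia.
rewrite xpair_eqE /=; lia.
Qed.

Lemma count_typed_false x S Bg : count_mem (false, x) (typed S Bg) = count_mem x S.
Proof.
rewrite /typed count_cat !count_map [X in (_ + X)%N](eq_count (a2 := pred0)) ?count_pred0 ?addn0.
  by apply: eq_count => y /=; rewrite xpair_eqE.
by move=> y /=; rewrite xpair_eqE.
Qed.

Lemma expr_le1_anti (x : rat) m n : 0 < x <= 1 -> (m <= n)%N -> x ^+ n <= x ^+ m.
Proof.
by move=> /andP[x0 x1] h; apply: ler_wiXn2l => //; exact: ltW.
Qed.

Lemma branch_bounds (S Bg : seq rat) (lo hi : rat) (dmin d1 : nat) :
  sorted <=%R S -> (forall s, s \in S -> 0 < s <= lo) ->
  (forall s, s \in Bg -> lo <= s <= hi) ->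
  0 < lo <= hi -> hi <= 1 ->
  (d1.-1 <= size S)%N -> lo <= mobius (hi ^+ dmin.-1) ->
  mobius (\prod_(s <- take d1.-1 S) s) <= hi ->
  forall t, (forall x, count_mem x (leaves t) <= count_mem x (typed S Bg))%N ->
   all (fun d => dmin <= d <= d1)%N (bdegs t) -> is_node t ->
   lo <= rho t <= mobius (\prod_(s <- take d1.-1 S) s).
Proof.
move=> sS hS hB /andP[lo0 lohi] hi1 hs hlo hhi.
elim/wtree_mem_ind => // l IH hc /= /andP[/andP[hd1 hd2] hd] _.
have hmem : forall b w, (b, w) \in lleaves l -> w \in if b then Bg else S.
  move=> b w; rewrite -mem_typed -has_pred1 has_count => h.
  by rewrite -has_pred1 has_count; apply: leq_trans h (hc _).
have hch t : t \in l -> is_small t = false -> lo <= rho t <= hi.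
  move=> tl; case: t tl => [[] w|m] tl // _; first apply: hB.
    by apply: (hmem true); apply/flattenP; exists (leaves (Leaf true w)); rewrite ?mem_head //; exact: map_f.
  suff /andP[-> h] : lo <= rho (Node m) <= mobius (\prod_(s <- take d1.-1 S) s) by exact: le_trans h hhi.
  apply: IH => //.
    by move=> x; apply: leq_trans (hc x); exact: count_leaves_child.
  apply/allP => d hdm; apply: (allP hd); apply/flattenP.
  by exists (bdegs (Node m)) => //; exact: map_f.
have hsm t : t \in l -> is_small t -> 0 < rho t <= lo.
  case: t => [[] w|m] // tl _; apply: hS.
  by apply: (hmem false); apply/flattenP; exists (leaves (Leaf false w)); rewrite ?mem_head //; exact: map_f.
have hall t : t \in l -> 0 < rho t <= hi.
  move=> tl; have [/(hsm _ tl)/andP[h1 h2]|/negbTE/(hch _ tl)/andP[h1 h2]] := boolP (is_small t).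
    by rewrite h1 (le_trans h2).
  by rewrite h2 (lt_le_trans lo0).
have hS1 s : s \in S -> 0 < s <= 1.
  by move=> /hS /andP[-> h]; rewrite (le_trans h) // (le_trans lohi).
have hi0 : 0 < hi by exact: lt_le_trans lohi.
have px : 0 < prho l <= 1.
  by apply: prod_bounds => t /hall /andP[-> h]; exact: le_trans hi1.
have ptk : 0 < \prod_(s <- take d1.-1 S) s <= 1.
  by apply: prod_bounds => t /mem_take; exact: hS1.
rewrite foldrE big_map -/(prho l); apply/andP; split.
  apply: (le_trans hlo); apply: mobius_le => //.
    by rewrite exprn_gt0 //= exprn_ile1 // ltW.
  apply: le_trans (prho_le_exp _ hall) _; first exact: ltW.
  by apply: expr_le1_anti; [rewrite hi0 | case: (dmin) hd1].
apply: mobius_le => //; rewrite prho_small_split.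
apply: prod_smallest_le => //.
- rewrite !size_map !size_filter count_predC; by case: (d1) hd2.
- move=> x; apply: leq_trans (count_smalls x l) _.
  by rewrite -(count_typed_false x S Bg); exact: (hc (false, x)).
- move=> y s /mapP[t]; rewrite mem_filter => /andP[/negbTE ns tl] -> sS'.
  have /andP[_ h1] := hS s sS'; have /andP[h2 _] := hch t tl ns.
  exact: le_trans h1 h2.
Qed.

Lemma count_lleaves_bigs l : (count is_big l <= count fst (lleaves l))%N.
Proof.
by elim: l => //= t l IH; rewrite lleaves_cons count_cat; case: t => [[] w|m] /=; lia.
Qed.

Lemma count_typed_fst S Bg : count fst (typed S Bg) = size Bg.
Proof.
rewrite /typed count_cat !count_map (eq_count (a2 := pred0)) // count_pred0.
by rewrite (eq_count (a2 := predT)) // count_predT.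
Qed.

Lemma nth_head_sorted_geq (D : seq nat) d : sorted geq D -> d \in D -> (d <= head 0%N D)%N.
Proof.
case: D => //= a D h; rewrite inE => /predU1P[->//|hd].
have /allP := order_path_min (rev_trans leq_trans) h; exact.
Qed.

Definition weight (t : wtree) := if t is Leaf _ w then w else 0.

Lemma all_small_leaves A : all is_small A ->
  [/\ ldegs A = [::], lleaves A = map (pair false) (map weight A), pwt A = 1 &
      prho A = \prod_(w <- map weight A) w].
Proof.
elim: A => [|t A IH] /=; first by rewrite /pwt /prho !big_nil.
case: t => [[] w|] //= /IH[h1 h2 h3 h4]; rewrite ldegs_cons lleaves_cons h1 h2 /=.
by rewrite pwt_cons prho_cons big_cons h3 h4 /= mulr1.
Qed.

Lemma all_big_leaves A : all is_big A ->
  [/\ ldegs A = [::], lleaves A = map (pair true) (map weight A), pwt A = 1 &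
      prho A = \prod_(w <- map weight A) w].
Proof.
elim: A => [|t A IH] /=; first by rewrite /pwt /prho !big_nil.
case: t => [[] w|] //= /IH[h1 h2 h3 h4]; rewrite ldegs_cons lleaves_cons h1 h2 /=.
by rewrite pwt_cons prho_cons big_cons h3 h4 /= mulr1.
Qed.

Definition smalls (M : seq (bool * rat)) := [seq x.2 | x <- M & ~~ x.1].
Definition bigs (M : seq (bool * rat)) := [seq x.2 | x <- M & x.1].

Lemma smalls_cat M N : smalls (M ++ N) = smalls M ++ smalls N.
Proof. by rewrite /smalls filter_cat map_cat. Qed.
Lemma bigs_cat M N : bigs (M ++ N) = bigs M ++ bigs N.
Proof. by rewrite /bigs filter_cat map_cat. Qed.
Lemma smalls_perm M N : perm_eq M N -> perm_eq (smalls M) (smalls N).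
Proof. by move=> h; apply/perm_map/perm_filter. Qed.
Lemma bigs_perm M N : perm_eq M N -> perm_eq (bigs M) (bigs N).
Proof. by move=> h; apply/perm_map/perm_filter. Qed.

Lemma smalls_pair b S : smalls (map (pair b) S) = if b then [::] else S.
Proof. by rewrite /smalls; case: b; elim: S => //= x S ->. Qed.
Lemma bigs_pair b S : bigs (map (pair b) S) = if b then S else [::].
Proof. by rewrite /bigs; case: b; elim: S => //= x S ->. Qed.

Lemma typed_split M : perm_eq M (typed (smalls M) (bigs M)).
Proof.
elim: M => // -[b x] M /permP IH; apply/permP => a; have := IH a.
rewrite /typed /smalls /bigs !count_cat; case: b => /= ->; first by rewrite addnCA.
by rewrite addnA.
Qed.

Lemma perm_typed M S Bg : perm_eq M (typed S Bg) =
  perm_eq (smalls M) S && perm_eq (bigs M) Bg.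
Proof.
apply/idP/andP => [h|[h1 h2]].
  have := smalls_perm h; have := bigs_perm h.
  by rewrite /typed smalls_cat bigs_cat !smalls_pair !bigs_pair cats0.
rewrite (permPl (typed_split M)) /typed.
by apply: perm_cat; exact: perm_map.
Qed.

(** Turns domination among small leaves into the prefix form in which [mvalue] consumes the sorted
    list of ratios. *)
Lemma sorted_take_perm (S X Y : seq rat) : sorted <=%R S -> perm_eq S (X ++ Y) ->
  {in X & Y, forall x y, x <= y} ->
  perm_eq (take (size X) S) X /\ perm_eq (drop (size X) S) Y.
Proof.
move=> sS hp hxy.
have -> : S = sort <=%R X ++ sort <=%R Y.
  apply: (sorted_eq le_trans le_anti) => //.
    rewrite sorted_pairwise; last exact: le_trans.
    rewrite pairwise_cat -!sorted_pairwise; try exact: le_trans.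
    rewrite !sort_sorted; try exact: le_total.
    rewrite !andbT; apply/allrelP => x y; rewrite !mem_sort; exact: hxy.
  by rewrite (permPl hp); apply: perm_cat; rewrite perm_sym perm_sort.
rewrite -(size_sort <=%R X) take_size_cat // drop_size_cat //.
by rewrite !perm_sort.
Qed.

Lemma chain_node Ys B : exists Q, chain Ys (Node B) = Node Q.
Proof. by case: Ys => [|Y Ys]; [exists B | exists (chain Ys (Node B) :: Y)]. Qed.

Lemma count_bigs_le D S Bg l : in_class D (typed S Bg) l -> (count is_big l <= size Bg)%N.
Proof.
move=> /andP[_ /permP/(_ fst)]; rewrite count_typed_fst => <-.
exact: count_lleaves_bigs.
Qed.

Lemma ctree_degree D L A Ys B : in_class D L (ctree A Ys B) -> (size B).+1 \in D.
Proof.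
move=> /andP[h _]; rewrite -(perm_mem h) (perm_mem (degs_ctree _ _ _)).
by rewrite !inE eqxx orbT.
Qed.

Lemma in_class_edge D L A P : in_class D L (Node A :: P) =
  perm_eq [:: (size P).+1, (size A).+1 & ldegs A ++ ldegs P] D &&
  perm_eq (lleaves A ++ lleaves P) L.
Proof. by []. Qed.

(** * The greedy contractions *)

Section StarStep.

Variables (D : seq nat) (S Bg : seq rat) (lo : rat) (dmin : nat).
Let L := typed S Bg.
Hypothesis hL : pos1 L.
Hypothesis hD : (1 < size D)%N.
Hypothesis hdmin : all (leq dmin) D.
Hypothesis hBg : (size Bg < dmin.-1)%N.
Hypothesis hS : forall s, s \in S -> s <= lo.
Hypothesis hB : forall s, s \in Bg -> lo <= s.
Hypothesis hnode : forall l, in_class D L l -> forall t, t \in l -> is_node t -> lo <= rho t.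

Lemma nonsmall_ge l t : in_class D L l -> t \in l -> ~~ is_small t -> lo <= rho t.
Proof.
move=> hl tl; case: t tl => [[] w|m] tl ns; last exact: (hnode hl tl).
  by apply: hB; apply: (leaf_in_typed hl tl (b := true)); rewrite mem_head.
by case/negP: ns.
Qed.

(* Lexicographic minimality of (product, number of non-small branches) breaks
   the ties that the exchange argument leaves. *)
Lemma exists_star l0 : in_class D L l0 -> exists A P,
  [/\ opt D L (Node A :: P), all is_small A &
    forall Ys B, opt D L (ctree A Ys B) -> dominated A B].
Proof.
move=> h0.
pose hd (l : seq wtree) := head (Leaf false 0) l.
have [|l1 [op pl min]] := @exists_opt_lex D L l0 (fun l => is_node (hd l))
  (fun l => prho (kids (hd l))) (fun l => (count (predC is_small) (kids (hd l)))%:R) h0.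
  move=> l ol; have [C _ hp] := in_class_has_node hD (opt_in_class ol).
  by exists (Node C :: rem (Node C) l) => //; exact: opt_perm ol.
case: l1 op pl min => [|[//|A] P] // op _ min; rewrite /hd /= in min.
have {}min A' P' : opt D L (Node A' :: P') -> prho A <= prho A' /\
    (prho A' = prho A -> (count (predC is_small) A <= count (predC is_small) A')%N).
  by move=> o; have [h1 h2] := min _ o isT; split=> // /h2; rewrite ler_nat.
have dom Ys B : opt D L (ctree A Ys B) -> dominated A B.
  move=> o; apply: (opt_dominated hL o).
  (* After the reversal [B] is at the root and the rest of the tree is a single node branch;
     crossing that edge makes [B] the head branch, so minimality of [prho A] applies to it. *)
  have := opt_rev hL o; rewrite /ctree; have [Q ->] := chain_node (rev Ys) A.
  by move=> /(opt_edge hL)/min[].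
exists A, P; split=> //; apply/allP => t tA; apply/negPn/negP => nt.
have o1 : opt D L (ctree A [::] P) by exact: opt_edge.
have [Zs [C [oC hC]]] := walk_pendant o1.
have szC : (dmin <= (size C).+1)%N.
  exact: (allP hdmin _ (ctree_degree (opt_in_class oC))).
have bC : (count is_big C <= size Bg)%N.
  have := opt_in_class (opt_rev hL oC); rewrite /ctree => /count_bigs_le /=; exact: leq_trans (leq_addl _ _).
(* The pendant vertex has at least [dmin - 1] children, all of them leaves, and fewer than
   [dmin - 1] big leaves exist. *)
have /hasP[s sC ss] : has is_small C.
  rewrite has_count -(ltn_add2l (count is_big C)) addn0.
  have -> : (count is_big C + count is_small C = size C)%N.
    rewrite -(count_predC is_big) ; congr (_ + _)%N; apply: eq_in_count => u uC.
    by move/hasPn: hC => /(_ u uC); case: u {uC} => [[]|].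
  apply: leq_ltn_trans bC _; apply: leq_trans hBg _.
  by move: szC; case: (dmin).
case: s sC ss => [[] w|] // sC _.
have tw : rho t <= w by have [_ /(_ t _ tA sC)] := dom _ _ oC.
have wS : w <= lo.
  apply: hS; have := opt_in_class (opt_rev hL oC) => hk.
  apply: (leaf_in_typed hk (_ : Leaf false w \in _) (b := false)); last by rewrite mem_head.
  by rewrite /ctree inE sC orbT.
have lt : lo <= rho t.
  by apply: nonsmall_ge (opt_in_class oC) _ nt; rewrite /ctree inE tA orbT.
(* The chain w <= [lo] <= [rho t] <= w leaves only a tie. Exchanging the two branches then keeps the
   product at [A] but lowers its number of non-small branches, against the second criterion. *)
have e : rho t = w by apply/eqP; rewrite eq_le tw (le_trans wS).
have o2 : opt D L (ctree (Leaf false w :: rem t A) Zs (t :: rem (Leaf false w) C)).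
  apply: (opt_swap hL oC).
  - rewrite (permPl (perm_cat (perm_to_rem tA) (perm_to_rem sC))).
    by rewrite -!(cat1s _ (rem _ _)) perm_swap_heads.
  - by rewrite (perm_size (perm_to_rem tA)) eqxx.
  - by rewrite (prho_perm (perm_to_rem tA)) !prho_cons e.
move: o2; rewrite /ctree; have [Q ->] := chain_node Zs (t :: rem (Leaf false w) C).
move=> /(opt_edge hL)/min[_]; rewrite (prho_perm (perm_to_rem tA)) !prho_cons e /= => /(_ erefl).
by have /permP -> := perm_to_rem tA; rewrite /= nt ltnn.
Qed.

Hypothesis sD : sorted geq D.
Hypothesis sS : sorted <=%R S.

(** Every other vertex can be walked to and is dominated by the star [A]. The size part of
    domination makes its degree maximal, the ratio part makes its leaves the smallest small ones. *)
Lemma star_step l : in_class D L l ->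
  let k := (head 0%N D).-1 in let x := \prod_(s <- take k S) s in
  exists l', in_class (behead D) (typed (drop k S) (mobius x :: Bg)) l' /\
    (8 - 5 * x) * wt (Node l') <= wt (Node l).
Proof.
move=> hl k x; have [A [P [op sweight dom]]] := exists_star hl.
have [lA1 lA2 lA3 lA4] := all_small_leaves sweight.
have hK := opt_in_class op; move: hK; rewrite in_class_edge lA1 lA2 cat0s => /andP[hK1 hK2].
have o1 : opt D L (ctree A [::] P) by exact: opt_edge.
have hdD : head 0%N D = (size A).+1.
  apply/eqP; rewrite eqn_leq; apply/andP; split; last first.
    by apply: nth_head_sorted_geq => //; rewrite -(perm_mem hK1) !inE eqxx orbT.
  have : head 0%N D \in D by case: (D) hD => //= *; exact: mem_head.
  rewrite -(perm_mem hK1) inE => /predU1P[->|]; first by have [] := dom _ _ o1.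
  rewrite inE => /predU1P[->//|h].
  have [|Zs [C [oC ->]]] := walk_deg o1 (d := head 0%N D); first by rewrite inE h orbT.
  by have [] := dom _ _ oC.
have kA : k = size A by rewrite /k hdD.
have [hp1 hp2] : perm_eq (smalls (map (pair false) (map weight A) ++ lleaves P)) S /\
    perm_eq (bigs (map (pair false) (map weight A) ++ lleaves P)) Bg.
  by apply/andP; rewrite -perm_typed.
rewrite smalls_cat smalls_pair in hp1; rewrite bigs_cat bigs_pair cat0s in hp2.
have [||ht hd] := @sorted_take_perm S (map weight A) (smalls (lleaves P)) sS.
- by rewrite perm_sym.
- move=> u v /mapP[t tA ->] /mapP[[b w]]; rewrite mem_filter /= => /andP[nb hw] ->.
  case: b nb hw => // _ hw.
  have [Zs [C [oC hC]]] := walk_leaf o1 hw.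
  have [_ /(_ t _ tA hC)] := dom _ _ oC.
  by have := allP sweight t tA; case: (t) => [[]|].
rewrite size_map -kA in ht hd.
have ex : x = prho A by rewrite /x lA4; exact: perm_big.
exists (Leaf true (mobius x) :: P); split.
  apply/andP; split.
    case: (D) hdD hK1 => //= d D' -> h; rewrite -(perm_cons (size A).+1).
    by apply: perm_trans h; apply/permP => a /=; rewrite addnCA.
  rewrite lleaves_cons perm_typed smalls_cat bigs_cat /smalls /bigs /= -/(smalls _) -/(bigs _).
  by rewrite perm_sym hd perm_cons.
have -> : (8 - 5 * x) * wt (Node (Leaf true (mobius x) :: P)) = wt (Node (Node A :: P)).
    rewrite !wt_Node !prho_cons !pwt_cons rho_Node wt_Node lA3 ex wt_Leaf rho_Leaf.
  by move: (prho A) (prho P) (pwt P) (mobius (prho A)) => a b c d; ring.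
by case: op => _; apply.
Qed.

End StarStep.

Lemma prho_eq_const X Y : size X = size Y ->
  {in X & Y, forall x y, rho x = rho y} -> prho X = prho Y.
Proof.
elim: X Y => [|x X IH] [|y Y] //= [hs] h.
rewrite !prho_cons (h x y (mem_head _ _) (mem_head _ _)) (IH Y) //.
by move=> u v hu hv; apply: h; rewrite inE ?hu ?hv orbT.
Qed.

Lemma count_ctree (a : pred wtree) A Ys B : (forall l, ~~ a (Node l)) ->
  count a (ctree A Ys B) = count a A.
Proof.
by move=> h; rewrite /ctree; have [Q ->] := chain_node Ys B; rewrite /= (negbTE (h Q)).
Qed.

Lemma count_big_ctree D S Bg A Ys B : in_class D (typed S Bg) (ctree A Ys B) ->
  (count is_big A + count is_big B <= size Bg)%N.
Proof.
move=> /andP[_ /permP/(_ fst)]; rewrite count_typed_fst => <-.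
have /permP -> := lleaves_ctree A Ys B.
rewrite lleaves_cat !count_cat; apply: leq_trans (leq_addr _ _).
by apply: leq_add; exact: count_lleaves_bigs.
Qed.

Lemma perm_is_big A : perm_eq A (filter is_big A ++ filter (predC is_big) A).
Proof. by rewrite perm_sym; apply/permPl; exact: perm_filterC. Qed.

Section RootStep.

Variables (D : seq nat) (S Bg : seq rat) (dmin : nat).
Let L := typed S Bg.
Hypothesis hL : pos1 L.
Hypothesis hD : (1 < size D)%N.
Hypothesis hdmin : all (leq dmin) D.
Hypothesis dminD : dmin \in D.
Hypothesis hd1 : (1 < dmin)%N.
Hypothesis hBg : size Bg = dmin.-1.
Hypothesis hbig : forall l, in_class D L l -> forall t b, t \in l -> b \in Bg ->
  ~~ is_big t -> rho t <= b.

Lemma big_weight l t : in_class D L l -> t \in l -> is_big t -> rho t \in Bg.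
Proof.
by case: t => [[] w|] // hl tl _; apply: (leaf_in_typed hl tl (b := true)); rewrite mem_head.
Qed.

Lemma bigs_ge A Ys B t s : in_class D L (ctree A Ys B) ->
  t \in A ++ B -> s \in A ++ B -> is_big s -> ~~ is_big t -> rho t <= rho s.
Proof.
move=> hk ht hs bs nt.
have hk' := hk; rewrite in_class_ctree_rev in hk'.
have sB : rho s \in Bg.
  move: hs; rewrite mem_cat => /orP[sweight|sB].
    by apply: (big_weight hk) => //; rewrite /ctree inE sweight orbT.
  by apply: (big_weight hk') => //; rewrite /ctree inE sB orbT.
move: ht; rewrite mem_cat => /orP[tA|tB].
  by apply: (hbig hk) => //; rewrite /ctree inE tA orbT.
by apply: (hbig hk') => //; rewrite /ctree inE tB orbT.
Qed.

(* Ties: branches of B that dominate the big leaves of A have the same ratio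
   as these, so exchanging them does not change the weight. *)
Lemma move_bigs A Ys B : opt D L (ctree A Ys B) -> dominated A B ->
  (count is_big A + count is_big B <= size B)%N ->
  exists A' B', [/\ opt D L (ctree A' Ys B'), size B' = size B &
    count is_big B' = (count is_big A + count is_big B)%N].
Proof.
move=> o [_ dom] hs.
set k := count is_big A.
pose Bn := filter (predC is_big) B.
have sBn : (size Bn + count is_big B = size B)%N.
  by rewrite size_filter addnC count_predC.
have kBn : (k <= size Bn)%N by rewrite -(leq_add2r (count is_big B)) sBn.
pose A' := take k Bn ++ filter (predC is_big) A.
pose B' := filter is_big A ++ (filter is_big B ++ drop k Bn).
have cB' : count is_big B' = (k + count is_big B)%N.
  rewrite !count_cat !count_filter (eq_count (a2 := is_big)); last by move=> u /=; rewrite andbb.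
  rewrite (@eq_count _ (predI is_big is_big) is_big); last by move=> u /=; rewrite andbb.
  congr (_ + _)%N; rewrite -[RHS]addn0; congr (_ + _)%N.
  apply/eqP; rewrite -leqn0 leqNgt -has_count; apply/hasPn => u /mem_drop.
  by rewrite mem_filter => /andP[].
have sz : size (take k Bn) = size (filter is_big A).
  by rewrite size_takel // size_filter.
exists A', B'; split=> //; last first.
  rewrite !size_cat size_drop (size_filter is_big A) (size_filter is_big B) -/k.
  rewrite -sBn (addnC (size Bn)) addnCA; congr (_ + _)%N.
  by rewrite subnKC.
apply: (opt_swap hL o).
- rewrite (permPl (perm_cat (perm_is_big A) (perm_is_big B))) -/Bn.
  rewrite -{1}(cat_take_drop k Bn).
  rewrite /A' /B'; apply/permP => a; rewrite !count_cat.
  move: (count a _) (count a _) (count a _) (count a _) (count a _) => x y z t u; lia.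
- rewrite size_cat sz -size_cat.
  by rewrite (perm_size (perm_is_big A)) eqxx.
rewrite (prho_perm (perm_is_big A)) !prho_cat; congr (_ * _).
apply: prho_eq_const => // x y /mem_take; rewrite !mem_filter => /andP[nx xB] /andP[by_ yA].
apply/eqP; rewrite eq_le (dom _ _ yA xB) andbT.
by apply: (bigs_ge (opt_in_class o)) by_ nx; rewrite mem_cat ?xB ?yA ?orbT.
Qed.

(** The extremal choice has the most big leaves at the root and then the least root degree. A big
    leaf elsewhere would allow [move_bigs] to gather more of them at one vertex; a root degree above
    [dmin] would allow moving all of them to a vertex of degree [dmin]. *)
Lemma exists_root l0 : in_class D L l0 -> exists A P,
  [/\ opt D L (Node A :: P), all is_big A & size A = size Bg].
Proof.
move=> h0.
have [|l [op _ min]] := @exists_opt_lex D L l0 predT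
  (fun l => - (count is_big l)%:R) (fun l => (size l)%:R) h0.
  by move=> l ol; exists l.
have {}min l' : opt D L l' -> (count is_big l' <= count is_big l)%N /\
    (count is_big l' = count is_big l -> (size l <= size l')%N).
  move=> o; have [h1 h2] := min _ o isT; split; first by rewrite lerN2 ler_nat in h1.
  by move=> e; have := h2; rewrite e ler_nat; exact.
have node_nb Q : ~~ is_big (Node Q) by [].
have dB A Ys B : opt D L (ctree A Ys B) -> (size Bg <= size B)%N.
  move=> /opt_in_class/ctree_degree/(allP hdmin).
  by rewrite hBg; case: (dmin).
have full : count is_big l = size Bg.
  apply/eqP; rewrite eqn_leq (count_bigs_le (opt_in_class op)) leqNgt; apply/negP => hlt.
  have : has (fun t => is_node t && has fst (leaves t)) l.
    apply/negPn/negP => /hasPn hn; move: hlt.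
    have := opt_in_class op => /andP[_ /permP/(_ fst)]; rewrite count_typed_fst => <-.
    rewrite ltnNge; case/negP; elim: (l) hn => //= t m IH hn.
    rewrite lleaves_cons count_cat; apply: leq_add; last first.
      by apply: IH => u hu; apply: hn; rewrite inE hu orbT.
    rewrite /lleaves /= cats0; have := hn t (mem_head _ _).
    by case: t {hn} => [[] w|q] //=; rewrite has_count -leqNgt leqn0 => /eqP ->.
  case/hasP => t; case: t => // C Cl /andP[_ /hasP[[b w] hw /= hb]]; case: b hw hb => // hw _.
  have o1 : opt D L (ctree (rem (Node C) l) [::] C) by apply: opt_perm op; exact: perm_to_rem.
  have cA : count is_big (rem (Node C) l) = count is_big l.
    by have /permP -> := perm_to_rem Cl.
  move: o1 cA; set A := rem _ _ => o1 cA.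
  have [Ys [B [o2 wB]]] := walk_leaf o1 hw.
  have cAB := count_big_ctree (opt_in_class o2).
  have cB : (0 < count is_big B)%N by rewrite -has_count; apply/hasP; exists (Leaf true w).
  have contra A' B' Zs : opt D L (ctree A' Zs B') ->
      count is_big B' = (count is_big A + count is_big B)%N -> False.
    move=> /(opt_rev hL)/min[+ _]; rewrite count_ctree // => + e.
    by rewrite e cA -{2}[count is_big l]addn0 leq_add2l leqNgt cB.
  have hA : (size Bg <= size A)%N by exact: dB (opt_rev hL o2).
  (* The end with the larger product is dominated and takes the big leaves of both ends; it has at
     least [size Bg] branches, hence room for all of them. *)
  have [hx|/ltW hx] := leP (prho A) (prho B).
    have [|A' [B' [o3 _ e3]]] := move_bigs o2 (opt_dominated hL o2 hx).
      exact: leq_trans cAB (dB _ _ _ o2).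
    exact: contra o3 e3.
  have o2' := opt_rev hL o2.
  have [|B' [A' [o3 _ e3]]] := move_bigs o2' (opt_dominated hL o2' hx).
    by rewrite addnC; exact: leq_trans cAB hA.
  by apply: contra o3 _; rewrite e3 addnC.
have szl : size l = dmin.
  apply/eqP/negPn/negP => hne.
  have hkl := opt_in_class op; case/andP: (hkl) => hk1 _.
  have lt : (dmin < size l)%N.
    rewrite ltn_neqAle eq_sym hne; apply: (allP hdmin).
    by rewrite -(perm_mem hk1) mem_head.
  have : dmin \in size l :: ldegs l by rewrite (perm_mem hk1).
  rewrite inE eq_sym (negbTE hne) => /flattenP[_ /mapP[t Cl ->]].
  case: t Cl => // C Cl hd.
  have o1 : opt D L (ctree (rem (Node C) l) [::] C) by apply: opt_perm op; exact: perm_to_rem.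
  have cA : count is_big (rem (Node C) l) = count is_big l.
    by have /permP -> := perm_to_rem Cl.
  have sweight : (size (rem (Node C) l)).+1 = size l by rewrite (perm_size (perm_to_rem Cl)).
  move: o1 cA sweight; set A := rem _ _ => o1 cA sweight.
  have [Ys [B [o2 eB]]] := walk_deg o1 hd.
  have cAB := count_big_ctree (opt_in_class o2).
  have lAB : (size B < size A)%N by rewrite -ltnS sweight -eB.
  (* The root end has more branches than [B], so it cannot be the dominated one. *)
  have [hx|/ltW hx] := leP (prho A) (prho B); last first.
    by have [] := opt_dominated hL (opt_rev hL o2) hx; rewrite leqNgt lAB.
  have [|A' [B' [o3 s3 e3]]] := move_bigs o2 (opt_dominated hL o2 hx).
    exact: leq_trans cAB (dB _ _ _ o2).
  have c3 : count is_big B' = count is_big l.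
    apply/eqP; rewrite eqn_leq; apply/andP; split; last by rewrite e3 cA leq_addr.
    by rewrite full; apply: leq_trans cAB; rewrite e3.
  have [_] := min _ (opt_rev hL o3); rewrite count_ctree // c3 => /(_ erefl).
  by rewrite /ctree /= s3 -eB leqNgt lt.
have [C Cl hp] := in_class_has_node hD (opt_in_class op).
have o1 : opt D L (ctree (rem (Node C) l) [::] C) by apply: opt_perm op; exact: perm_to_rem.
have sweight : size (rem (Node C) l) = size Bg by rewrite size_rem // szl hBg.
exists (rem (Node C) l), C; split=> //; first exact: (opt_rev hL o1).
rewrite all_count sweight -full; apply/eqP.
by have /permP -> := hp.
Qed.

Lemma root_step l : in_class D L l -> let x := \prod_(s <- Bg) s in
  exists l', in_class (rem dmin D) (typed (mobius x :: S) [::]) l' /\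
    (8 - 5 * x) * wt (Node l') <= wt (Node l).
Proof.
move=> hl x; have [A [P [op bA sweight]]] := exists_root hl.
have [lA1 lA2 lA3 lA4] := all_big_leaves bA.
have hK := opt_in_class op; move: hK; rewrite in_class_edge lA1 lA2 cat0s => /andP[hK1 hK2].
have [hp1 hp2] : perm_eq (smalls (map (pair true) (map weight A) ++ lleaves P)) S /\
    perm_eq (bigs (map (pair true) (map weight A) ++ lleaves P)) Bg.
  by apply/andP; rewrite -perm_typed.
rewrite smalls_cat smalls_pair cat0s in hp1; rewrite bigs_cat bigs_pair in hp2.
have nP : bigs (lleaves P) = [::].
  apply/nilP; rewrite /nilp -leqn0 -(leq_add2l (size A)) addn0 -{1}(size_map weight A).
  by rewrite -size_cat (perm_size hp2) sweight.
rewrite nP cats0 in hp2.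
have ex : x = prho A by rewrite /x lA4; apply: perm_big; rewrite perm_sym.
exists (Leaf false (mobius x) :: P); split.
  apply/andP; split.
    rewrite -(perm_cons dmin) -(permPr (perm_to_rem dminD)) -(permPr hK1).
    have -> : dmin = (size A).+1 by rewrite sweight hBg prednK // ltnW.
    by apply/permP => a /=; rewrite addnCA.
  rewrite perm_typed; apply/andP; split; last by rewrite -nP.
  suff : perm_eq (mobius x :: smalls (lleaves P)) (mobius x :: S) by [].
  by rewrite perm_cons.
have -> : (8 - 5 * x) * wt (Node (Leaf false (mobius x) :: P)) = wt (Node (Node A :: P)).
  rewrite !wt_Node !prho_cons !pwt_cons rho_Node wt_Node lA3 ex wt_Leaf rho_Leaf.
  by move: (prho A) (prho P) (pwt P) (mobius (prho A)) => a b c d; ring.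
by case: op => _; apply.
Qed.

End RootStep.

(** * Iterating the contractions: the lower bound for all trees *)

Definition prodq (s : seq rat) : rat := \prod_(x <- s) x.

Lemma prodq_cons x s : prodq (x :: s) = x * prodq s.
Proof. exact: big_cons. Qed.
Lemma prodq_cat s t : prodq (s ++ t) = prodq s * prodq t.
Proof. exact: big_cat. Qed.
Lemma prodq_perm s t : perm_eq s t -> prodq s = prodq t.
Proof. exact: perm_big. Qed.

Lemma prodq_le c s : 0 <= c -> (forall x, x \in s -> 0 < x <= c) -> prodq s <= c ^+ size s.
Proof.
move=> c0; elim: s => [|x s IH] h; first by rewrite /prodq big_nil.
rewrite prodq_cons exprS; have /andP[x0 x1] := h x (mem_head _ _).
have hs : forall u, u \in s -> 0 < u <= c by move=> u hu; apply: h; rewrite inE hu orbT.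
apply: ler_pM => //; [exact: ltW | | exact: IH].
by apply/ltW/prod_gt0_seq => u /hs /andP[].
Qed.

Lemma prodq_ge c s : 0 <= c -> (forall x, x \in s -> c <= x) -> c ^+ size s <= prodq s.
Proof.
move=> c0; elim: s => [|x s IH] h; first by rewrite /prodq big_nil.
rewrite prodq_cons exprS; apply: ler_pM => //; first exact: exprn_ge0.
  by apply: h; exact: mem_head.
by apply: IH => u hu; apply: h; rewrite inE hu orbT.
Qed.

Lemma sumn_leaves t : (size (leaves t) + 2 * size (bdegs t) = sumn (bdegs t) + 1)%N.
Proof.
elim/wtree_mem_ind: t => [//|l IH] /=.
suff : (size (flatten (map leaves l)) + 2 * size (flatten (map bdegs l)) =
  sumn (flatten (map bdegs l)) + size l)%N.
  by move=> e; rewrite mulnS addnCA e; move: (sumn _) (size l) => a b; lia.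
elim: l IH => //= t l IHl IH.
rewrite !size_cat sumn_cat; have := IH t (mem_head _ _).
by have := IHl (fun u hu => IH u (mem_behead (s := t :: l) hu)); lia.
Qed.

(** With n leaves the degree sum is [sumn D] + n, and the number of edges is n + [size D] - 1. The
    number of leaves is thereby fixed, which yields the size conditions on leaf lists below. *)
Lemma handshake D L l : in_class D L l -> (size L + 2 * size D = sumn D + 2)%N.
Proof.
move=> /andP[h1 h2]; rewrite -(perm_size h1) -(perm_size h2) -(perm_sumn h1) /=.
have : (size (lleaves l) + 2 * size (ldegs l) = sumn (ldegs l) + size l)%N.
  elim: l {h1 h2} => //= t l IH; have := sumn_leaves t.
  rewrite lleaves_cons ldegs_cons {1}/lleaves {1 3}/ldegs /= !cats0 !size_cat sumn_cat; lia.
lia.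
Qed.

Lemma sumn_ge dmin (D : seq nat) : all (leq dmin) D -> (dmin * size D <= sumn D)%N.
Proof. by elim: D => [|d D IH] /=; [rewrite muln0|move=> /andP[h /IH]; rewrite mulnS; exact: leq_add]. Qed.

Section State.

Variables (dmin : nat) (lo hi : rat).

(* State reached after some stars, whose ratios are listed in Bg, have been
   contracted to big leaves. *)
Record state (D : seq nat) (S Bg : seq rat) : Prop := State {
  st_sorted : sorted geq D;
  st_dmin : all (leq dmin) D;
  st_ssorted : sorted <=%R S;
  st_small : forall s, s \in S -> 0 < s <= lo;
  st_big : forall b, b \in Bg -> lo <= b <= hi;
  st_next : forall b, b \in Bg -> mobius (prodq (take (head 0%N D).-1 S)) <= b;
  st_hi : mobius (prodq (take (head 0%N D).-1 S)) <= hi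
}.

Hypothesis d2 : (2 <= dmin)%N.
Hypothesis lohi : 0 < lo <= hi.
Hypothesis hi1 : hi < 1.
Hypothesis lof : lo <= mobius (hi ^+ dmin.-1).

Lemma lo1 : lo < 1.
Proof. by case/andP: lohi => _ h; exact: le_lt_trans h hi1. Qed.

Lemma state_S01 D S Bg : state D S Bg -> forall s, s \in S -> 0 < s <= 1.
Proof.
by move=> st s /(st_small st)/andP[-> h]; rewrite (le_trans h) // ltW // lo1.
Qed.

Lemma state_pos1 D S Bg : state D S Bg -> pos1 (typed S Bg).
Proof.
move=> st; apply/allP => -[b w]; rewrite mem_typed /=; case: b => h.
  have /andP[h1 h2] := st_big st h; case/andP: lohi => h3 h4.
  by rewrite (lt_le_trans h3 h1) (le_lt_trans h2 hi1).
by have /andP[-> h2] := st_small st h; exact: le_lt_trans h2 lo1.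
Qed.

(** By [handshake], the two first degrees d and e already force d + e - 2 leaves, and at most
    [dmin - 1] <= e - 1 of them are big. *)
Lemma size_smalls D S Bg l : in_class D (typed S Bg) l -> all (leq dmin) D ->
  (1 < size D)%N -> (size Bg <= dmin.-1)%N -> ((head 0%N D).-1 <= size S)%N.
Proof.
move=> /handshake; rewrite size_cat !size_map.
case: D => [|d [|e D]] //= + /and3P[h1 h2 /sumn_ge h3] _ hB.
have : (2 * size D <= sumn D)%N by apply: leq_trans h3; rewrite leq_mul2r d2 orbT.
move: d2 h1 h2 hB; clear; lia.
Qed.

Lemma state_node D S Bg l t : state D S Bg -> ((head 0%N D).-1 <= size S)%N ->
  in_class D (typed S Bg) l -> t \in l -> is_node t ->
  lo <= rho t <= mobius (prodq (take (head 0%N D).-1 S)).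
Proof.
move=> st hs hk tl nt; case/andP: (hk) => hk1 hk2.
have [h0 h1] := andP lohi.
apply: (@branch_bounds S Bg lo hi dmin (head 0%N D)); last exact: nt.
- exact: st_ssorted st.
- exact: st_small st.
- exact: st_big st.
- exact: lohi.
- exact: ltW.
- exact: hs.
- exact: lof.
- exact: st_hi st.
- move=> x; have /permP <- := hk2; exact: count_leaves_child.
apply/allP => d hd.
have dD : d \in D.
  rewrite -(perm_mem hk1) inE; apply/orP; right; apply/flattenP.
  by exists (bdegs t) => //; exact: map_f.
by rewrite (allP (st_dmin st)) //= nth_head_sorted_geq // (st_sorted st).
Qed.

(** The star made of the smallest leaves is fed to [branch_bounds] as a tree of its own, so no
    member of the class containing it is required. *)
Lemma state_star e D S Bg : state (e :: D) S Bg -> (e.-1 <= size S)%N ->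
  lo <= mobius (prodq (take e.-1 S)).
Proof.
move=> st hs; have [h0 h1] := andP lohi.
have he : (dmin <= e)%N by have /andP[] := st_dmin st.
have e0 : e.-1.+1 = e by rewrite prednK //; apply: leq_trans he; exact: ltnW.
pose t := Node (map (Leaf false) (take e.-1 S)).
have -> : mobius (prodq (take e.-1 S)) = rho t.
  by rewrite rho_Node /prho big_map.
have el : lleaves (map (Leaf false) (take e.-1 S)) = map (pair false) (take e.-1 S).
  by rewrite /lleaves -map_comp; elim: (take _ _) => //= x s ->.
have ed : ldegs (map (Leaf false) (take e.-1 S)) = [::].
  by rewrite /ldegs -map_comp; elim: (take _ _) => //= x s ->.
suff /andP[] : lo <= rho t <= mobius (prodq (take e.-1 S)) by [].
apply: (@branch_bounds S Bg lo hi dmin e); last by [].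
- exact: st_ssorted st.
- exact: st_small st.
- exact: st_big st.
- exact: lohi.
- exact: ltW.
- exact: hs.
- exact: lof.
- exact: st_hi st.
- move=> x; rewrite /= -/(lleaves _) el /typed count_cat; apply: leq_trans (leq_addr _ _).
  by rewrite -{2}(cat_take_drop e.-1 S) map_cat count_cat leq_addr.
by rewrite /= -/(ldegs _) ed size_map size_takel //= e0 he leqnn.
Qed.

(** The next star has no more leaves and no smaller ones, so its product is at least as large and
    its ratio at most that of the present star. This keeps all big leaves above the branches still
    to come. *)
Lemma state_next e D S Bg : state (e :: D) S Bg -> (e.-1 <= size S)%N ->
  D != [::] -> state D (drop e.-1 S) (mobius (prodq (take e.-1 S)) :: Bg).
Proof.
move=> st hs D0; have [h0 h1] := andP lohi.
have S01 := state_S01 st.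
have nx : mobius (prodq (take (head 0%N D).-1 (drop e.-1 S))) <= mobius (prodq (take e.-1 S)).
  have p1 : 0 < prodq (take e.-1 S) <= 1.
    by apply: prod_bounds => t /mem_take; exact: S01.
  have p2 : 0 < prodq (take (head 0%N D).-1 (drop e.-1 S)) <= 1.
    by apply: prod_bounds => t /mem_take/mem_drop; exact: S01.
  apply: mobius_le => //.
  have := @prod_smallest_le S (st_ssorted st) S01 e.-1 (take (head 0%N D).-1 (drop e.-1 S)) [::].
  rewrite big_nil mulr1; apply=> //.
    rewrite addn0 size_take_min; apply: leq_trans (geq_minl _ _) _.
    rewrite -!subn1; apply: leq_sub2r; apply: (nth_head_sorted_geq (st_sorted st)).
    by case: (D) D0 => // d D' _; rewrite inE mem_head orbT.
  move=> x; rewrite -[X in (_ <= count_mem x X)%N](cat_take_drop e.-1 S) count_cat.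
  apply: leq_trans (leq_addl _ _).
  by rewrite -[X in (_ <= count_mem x X)%N](cat_take_drop (head 0%N D).-1) count_cat leq_addr.
have hd := st_dmin st; rewrite /= in hd.
split.
- exact: path_sorted (st_sorted st).
- by case/andP: hd.
- exact: drop_sorted (st_ssorted st).
- by move=> s /mem_drop sS; exact: (st_small st sS).
- move=> b; rewrite inE => /predU1P[->|bB]; last exact: (st_big st bB).
  by rewrite (state_star st hs) (st_hi st).
- move=> b; rewrite inE => /predU1P[->//|bB].
  exact: le_trans nx (st_next st bB).
exact: le_trans nx (st_hi st).
Qed.

Definition star_prods (es : seq nat) (W : seq rat) : seq rat :=
  [seq prodq g | g <- reshape (map predn es) W].

Definition star_leaves (es : seq nat) : nat := sumn (map predn es).

Definition hprod (xs : seq rat) : rat := \prod_(x <- xs) (8 - 5 * x).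

(** [catrev] appears because each new big leaf is pushed to the front. *)
Lemma stars_run es D S Bg l : state (es ++ D) S Bg -> in_class (es ++ D) (typed S Bg) l ->
  D != [::] -> (size Bg + size es <= dmin.-1)%N ->
  let Bg' := catrev (map mobius (star_prods es S)) Bg in let S' := drop (star_leaves es) S in
  exists l', [/\ state D S' Bg', in_class D (typed S' Bg') l' &
    hprod (star_prods es S) * wt (Node l') <= wt (Node l)].
Proof.
elim: es S Bg l => [|e es IH] S Bg l st hk D0 hs.
  exists l; rewrite /= /star_leaves /= drop0 /hprod big_nil mul1r; split=> //.
have sD : (1 < size ((e :: es) ++ D))%N.
  by rewrite /= ltnS size_cat; case: (D) D0 => // d D' _; rewrite /= addnS.
have hsB : (size Bg < dmin.-1)%N by apply: leq_trans hs; rewrite /= addnS ltnS leq_addr.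
have hsz := size_smalls hk (st_dmin st) sD (ltnW hsB).
have [l1 [k1 w1]] := @star_step ((e :: es) ++ D) S Bg lo dmin (state_pos1 st) sD
  (st_dmin st) hsB (fun s h => proj2 (andP (st_small st h)))
  (fun b h => proj1 (andP (st_big st h)))
  (fun l h t tl nt => proj1 (andP (state_node st hsz h tl nt)))
  (st_sorted st) (st_ssorted st) l hk.
have esD : es ++ D != [::] by case: (es) => //=.
have st1 := state_next st hsz esD.
have [|l2 [st2 k2 w2]] := IH _ _ _ st1 k1 D0.
  by rewrite /= addSnnS.
exists l2; rewrite /= /star_leaves /= addnC -drop_drop; split=> //.
have pos : 0 < 8 - 5 * prodq (take e.-1 S).
  have /andP[_ h] : 0 < prodq (take e.-1 S) <= 1.
    by apply: prod_bounds => t /mem_take tS; exact: (state_S01 st tS).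
  by rewrite subr_gt0; apply: le_lt_trans (_ : 5 * 1 < _); first by rewrite ler_pM2l.
apply: le_trans w1; rewrite /hprod /star_prods /= big_cons -mulrA ler_pM2l; first exact: w2.
exact: pos.
Qed.

Lemma root_run D S Bg l : state D S Bg -> in_class D (typed S Bg) l -> (1 < size D)%N ->
  dmin \in D -> size Bg = dmin.-1 ->
  exists l', in_class (rem dmin D) (typed (mobius (prodq Bg) :: S) [::]) l' /\
    (8 - 5 * prodq Bg) * wt (Node l') <= wt (Node l).
Proof.
move=> st hk hD dD hB.
have hsz : ((head 0%N D).-1 <= size S)%N.
  by apply: (size_smalls hk) => //; [exact: st_dmin st | rewrite hB].
apply: (@root_step D S Bg dmin (state_pos1 st)) => //; first exact: st_dmin st.
move=> m km t b tm bB; case: t tm => [[] w|q] tm nb.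
- by case/negP: nb.
- have /andP[_ h1] : 0 < w <= lo.
    by apply: (st_small st); apply: (leaf_in_typed km tm (b := false)); rewrite mem_head.
  by have /andP[h2 _] := st_big st bB; exact: le_trans h1 h2.
have /andP[_ h1] := state_node st hsz km tm isT.
exact: le_trans h1 (st_next st bB).
Qed.

End State.

Lemma wt_single d L l : in_class [:: d] L l -> wt (Node l) = 8 - 5 * prodq (map snd L).
Proof.
move=> /andP[h1 h2]; have e : ldegs l = [::].
  by have := perm_size h1 => /= -[/size0nil].
have : all (fun t => ~~ is_node t) l.
  by elim: l e {h1 h2} => //= -[b w|m] l IH //; rewrite ldegs_cons /ldegs /=; exact: IH.
move=> hl; have [e1 e2] : pwt l = 1 /\ prho l = prodq (map snd (lleaves l)).
  elim: l hl {h1 h2 e} => [|t l IH]; first by rewrite pwt_nil prho_nil /prodq big_nil.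
  case: t => [b w|m] // hl; have [h1 h2] := IH hl.
  by rewrite pwt_cons prho_cons lleaves_cons h1 h2 wt_Leaf rho_Leaf mulr1 prodq_cons.
by rewrite wt_Node e1 e2 mul1r (prodq_perm (perm_map _ h2)).
Qed.

(* Weight of the M-tree with reduced degree sequence ds whose leaf ratios W,
   in increasing order, fill the leaf slots from the last label to the first. *)
Fixpoint mvalue (fuel : nat) (ds : seq nat) (W : seq rat) : rat :=
  let d := last 0%N ds in
  let ds0 := take (size ds).-1 ds in
  if (size ds <= d.+1)%N then
    let xs := star_prods ds0 W in
    hprod xs * (8 - 5 * (prodq (map mobius xs) * prodq (drop (star_leaves ds0) W)))
  else if fuel is fuel'.+1 then
    let es := take d.-1 ds0 in
    let xs := star_prods es W in
    let X := prodq (map mobius xs) in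
    hprod xs * (8 - 5 * X) *
      mvalue fuel' (drop d.-1 ds0) (rcons (drop (star_leaves es) W) (mobius X))
  else 0.

Lemma mvalueE fuel ds d W : mvalue fuel.+1 (rcons ds d) W =
  if (size ds <= d)%N then
    let xs := star_prods ds W in
    hprod xs * (8 - 5 * (prodq (map mobius xs) * prodq (drop (star_leaves ds) W)))
  else
    let es := take d.-1 ds in
    let xs := star_prods es W in
    let X := prodq (map mobius xs) in
    hprod xs * (8 - 5 * X) *
      mvalue fuel (drop d.-1 ds) (rcons (drop (star_leaves es) W) (mobius X)).
Proof.
rewrite [mvalue _ _ _]/mvalue -/mvalue last_rcons size_rcons ltnS.
by rewrite [_.+1.-1]/= -[in take (size ds) _]cats1 take_size_cat.
Qed.

Lemma star_prods_rcons es e W : star_prods (rcons es e) W =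
  rcons (star_prods es W) (prodq (take e.-1 (drop (star_leaves es) W))).
Proof.
elim: es W => [|a es IH] W; first by rewrite /star_leaves /= drop0.
by rewrite /star_prods /= -/(star_prods _ _) IH drop_drop addnC.
Qed.

Lemma star_leaves_rcons es e : star_leaves (rcons es e) = (star_leaves es + e.-1)%N.
Proof. by rewrite /star_leaves map_rcons sumn_rcons. Qed.

(* Implies that in every tree of the class the ratios of the leaves are at most
   those of all other branches. *)
Definition low_leaves (ds : seq nat) (W : seq rat) : Prop :=
  let hi := mobius (prodq (take (head 0%N ds).-1 W)) in
  forall w, w \in W -> [/\ 0 < w < 1, w <= hi & w <= mobius (hi ^+ (last 0%N ds).-1)].

Lemma in_class_perm_deg D D' L l : perm_eq D D' -> in_class D L l = in_class D' L l.
Proof. by move=> h; rewrite /in_class (permPr h). Qed.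

Lemma in_class_perm_leaves D L L' l : perm_eq L L' -> in_class D L l = in_class D L' l.
Proof. by move=> h; rewrite /in_class (permPr h). Qed.

Lemma prodq_typed S Bg : prodq (map snd (typed S Bg)) = prodq S * prodq Bg.
Proof.
by rewrite /typed map_cat prodq_cat -!map_comp !map_id_in.
Qed.

Lemma prodq01 s : (forall x, x \in s -> 0 < x <= 1) -> 0 < prodq s <= 1.
Proof. exact: prod_bounds. Qed.

Lemma hprod_gt0 xs : (forall x, x \in xs -> x <= 1) -> 0 < hprod xs.
Proof. by move=> h; apply: prod_gt0_seq => x /h; lra. Qed.

Lemma star_prods01 es W : (forall w, w \in W -> 0 < w <= 1) ->
  forall x, x \in star_prods es W -> 0 < x <= 1.
Proof.
elim: es W => //= e es IH W h x; rewrite inE => /predU1P[->|].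
  by apply: prodq01 => w /mem_take; exact: h.
by apply: IH => w /mem_drop; exact: h.
Qed.

Lemma sorted_last_le ds d : sorted geq (rcons ds d) -> all (leq d) (rcons ds d).
Proof.
move=> h; have := h; rewrite -rev_sorted rev_rcons => h'.
rewrite -all_rev rev_rcons /= leqnn /=.
have := order_path_min _ h'; apply.
by move=> a b c; exact: leq_trans.
Qed.

(** [hi] is the ratio of the first star, and [lo] the ratio of a vertex with d - 1 children of ratio
    [hi]. All leaves being at most [hi], the product of the first star is at most a power of [hi]
    with exponent at least d - 1, whence [lo <= hi]. *)
Lemma inv_state ds d W : sorted geq (rcons ds d) -> (2 <= d)%N -> sorted <=%R W ->
  ((head 0%N (rcons ds d)).-1 <= size W)%N ->
  low_leaves (rcons ds d) W ->
  let hi := mobius (prodq (take (head 0%N (rcons ds d)).-1 W)) in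
  let lo := mobius (hi ^+ d.-1) in
  [/\ 0 < lo <= hi, hi < 1 & state d lo hi (rcons ds d) W [::]].
Proof.
set D := rcons ds d => sD d2 sW hs hinv hi lo.
have W1 w : w \in W -> 0 < w <= 1 by move=> /hinv[/andP[-> /ltW ->]].
have p1 : 0 < prodq (take (head 0%N D).-1 W) <= 1.
  by apply: prodq01 => w /mem_take; exact: W1.
have /andP[h0 h1] : 0 < hi < 1 by exact: mobius_bounds.
have e1 : 0 < hi ^+ d.-1 <= 1.
  by rewrite exprn_gt0 //=; apply: exprn_ile1; exact: ltW.
have /andP[l0 l1] : 0 < lo < 1 by exact: mobius_bounds.
have ad := sorted_last_le sD.
split; [|exact: h1|].
  rewrite l0 /=; apply: mobius_le; [exact: p1|exact: e1|].
  apply: (@le_trans _ _ (hi ^+ (head 0%N D).-1)).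
    rewrite -{2}(size_takel hs); apply: prodq_le; first exact: ltW.
    by move=> w /mem_take/hinv[/andP[-> _] -> _].
  apply: expr_le1_anti; first by rewrite h0 ltW.
  rewrite -!subn1; apply: leq_sub2r; apply: (allP ad).
  by rewrite /D; case: (ds) => [|a s]; rewrite /= mem_head.
split.
- exact: sD.
- exact: ad.
- exact: sW.
- by move=> w /hinv[/andP[-> _] _]; rewrite /lo /hi /D last_rcons.
- by move=> b bB; exfalso; move: bB; rewrite in_nil; discriminate.
- by move=> b bB; exfalso; move: bB; rewrite in_nil; discriminate.
- exact: lexx.
Qed.

Lemma sorted_cat_le (s : seq rat) x : sorted <=%R s ->
  (forall y, y \in s -> y <= x) -> sorted <=%R (s ++ [:: x]).
Proof.
move=> h hx; rewrite sorted_pairwise; last exact: le_trans.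
rewrite pairwise_cat -sorted_pairwise; last exact: le_trans.
rewrite h /= andbT; apply/allrelP => y z hy; rewrite inE => /eqP ->; exact: hx.
Qed.

Lemma mvalue_le fuel ds W l : (size ds <= fuel)%N -> ds != [::] -> sorted geq ds ->
  all (leq 2) ds -> sorted <=%R W -> low_leaves ds W -> in_class ds (typed W [::]) l ->
  mvalue fuel ds W <= wt (Node l).
Proof.
elim: fuel ds W l => [|fuel IH] ds W l; first by case: ds.
case/lastP: ds => // ds d hf _ sD ge2 sW hinv hk.
have d2 : (2 <= d)%N by move: ge2; rewrite all_rcons => /andP[].
have ad := sorted_last_le sD.
have hs : ((head 0%N (rcons ds d)).-1 <= size W)%N.
  have := handshake hk; rewrite size_cat !size_map addn0.
  case: (ds) ge2 => [|a s] /=; first by move=> _; clear; lia.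
  case/andP=> _ /sumn_ge; move: (sumn _) (size _) (size _) => x y z; clear; lia.
have H := inv_state sD d2 sW hs hinv; cbv zeta in H; move: H.
move ehi : (mobius (prodq _)) => hi; move elo : (mobius (hi ^+ _)) => lo [lohi hi1 st].
have lof : lo <= mobius (hi ^+ d.-1) by rewrite elo lexx.
have W1 w : w \in W -> 0 < w <= 1 by move=> /hinv[/andP[-> /ltW ->]].
rewrite mvalueE; case: ifP => [hdt|/negbT hdt].
  have [hlt|hge] := ltnP (size ds) d.
    have := hk; have := st; rewrite -cats1 => st' hk'.
    have [|l' [st2 k2 w2]] := stars_run d2 lohi hi1 lof st' hk' isT.
      by rewrite /= add0n; case: (d) hlt.
    apply: le_trans w2; rewrite (wt_single k2) prodq_typed.
    rewrite (@prodq_perm (catrev _ _) (map mobius (star_prods ds W))); last first.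
      by rewrite catrevE cats0 perm_rev.
    by rewrite [X in 5 * X]mulrC.
  (* Boundary case of d stars around a centre of degree d: only d - 1 of them may be contracted
     before the big leaves are gathered. The centre is then contracted, and the last star remains as
     the single vertex. *)
  have {hge hdt} hds : size ds = d by apply/eqP; rewrite eqn_leq hdt hge.
  have [ds1 [e eds]] : exists ds1 e, ds = rcons ds1 e.
    case/lastP: (ds) hds => [h|ds1 e _]; last by exists ds1, e.
    by rewrite -h in d2.
  subst ds; rename ds1 into ds; move: hds.
  rewrite size_rcons => hds.
  have st' : state d lo hi (ds ++ [:: e; d]) W [::] by move: st; rewrite -!cats1 -catA.
  have hk' : in_class (ds ++ [:: e; d]) (typed W [::]) l by move: hk; rewrite -!cats1 -catA.
  have [|l' [st2 k2 w2]] := stars_run d2 lohi hi1 lof st' hk' isT.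
    by rewrite /= add0n -hds.
  have szg : size (star_prods ds W) = size ds by rewrite size_map size_reshape size_map.
  set Bg := catrev _ _ in st2 k2; set rest := drop _ _ in st2 k2.
  have eB : prodq Bg = prodq (map mobius (star_prods ds W)).
    by apply: prodq_perm; rewrite /Bg catrevE cats0 perm_rev.
  have [||l2 [k3 w3]] := root_run d2 lohi hi1 lof st2 k2 isT.
  - by rewrite !inE eqxx orbT.
  - by rewrite /Bg catrevE cats0 size_rev size_map szg -hds.
  have hrem : perm_eq (rem d [:: e; d]) [:: e].
    rewrite -(perm_cons d); rewrite perm_sym.
    apply: perm_trans (perm_to_rem _); last by rewrite !inE eqxx orbT.
    by apply/permP => a /=; rewrite !addn0 addnC.
  rewrite (in_class_perm_deg _ _ hrem) in k3.
  have sr : size rest = e.-1.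
    have := handshake k3; rewrite size_cat !size_map /= => h.
    have e2 : (2 <= e)%N by move: ge2; rewrite !all_rcons => /and3P[].
    move: h e2; clear; lia.
  have er : rest = take e.-1 (drop (star_leaves ds) W) by rewrite -sr take_size.
  have dg : drop (star_leaves (rcons ds e)) W = [::].
    by apply/nilP; rewrite /nilp star_leaves_rcons addnC -drop_drop -/rest size_drop sr subnn.
  rewrite star_prods_rcons -er dg.
  apply: le_trans w2; rewrite /hprod -cats1 big_cat big_seq1 /= -mulrA.
  rewrite ler_pM2l; last by apply: hprod_gt0 => x /(star_prods01 W1)/andP[].
  apply: le_trans w3; rewrite (wt_single k3) prodq_typed eB.
  rewrite map_cat prodq_cat.
  have nil1 : prodq [::] = 1 by exact: big_nil.
  rewrite !prodq_cons !nil1 !mulr1.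
  have r1 : 0 < prodq rest <= 1.
    by apply: prodq01 => w /mem_drop wW; exact: (W1 _ wW).
  have X1 : 0 < prodq (map mobius (star_prods ds W)) <= 1.
    apply: prodq01 => x /mapP[g /(star_prods01 W1) hg ->].
    by case/andP: (mobius_bounds hg) => -> /ltW ->.
  move: (prodq (map mobius (star_prods ds W))) (prodq rest) r1 X1 => X r /andP[_ r1] /andP[_ X1].
  (* Reading the value at the last star or at the centre is the same, by the symmetric expression
     behind [wt_edge]. *)
  rewrite le_eqVlt; apply/orP; left; apply/eqP; rewrite /mobius.
  have n1 : 8 - 5 * X != 0 by apply: lt0r_neq0; move: X1; clear; lra.
  have n2 : 8 - 5 * r != 0 by apply: lt0r_neq0; move: r1; clear; lra.
  by field; rewrite n1 n2.
rewrite -ltnNge in hdt.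
set m := d.-1; set es := take m ds; set D := drop m ds.
have eds : ds = es ++ D by rewrite cat_take_drop.
have st' : state d lo hi (es ++ rcons D d) W [::] by rewrite -rcons_cat -eds.
have hk' : in_class (es ++ rcons D d) (typed W [::]) l by rewrite -rcons_cat -eds.
have mds : (m < size ds)%N by rewrite /m; case: (d) hdt => //= d' /ltnW.
have ses : size es = m by rewrite size_takel // ltnW.
have D0 : D != [::] by rewrite -size_eq0 size_drop subn_eq0 -ltnNge.
have D1 : rcons D d != [::] by rewrite -size_eq0 size_rcons.
have [|l' [st2 k2 w2]] := stars_run d2 lohi hi1 lof st' hk' D1.
  by rewrite add0n ses.
have szg : size (star_prods es W) = size es by rewrite size_map size_reshape size_map.
set Bg := catrev _ _ in st2 k2; set rest := drop _ _ in st2 k2.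
have eB : prodq Bg = prodq (map mobius (star_prods es W)).
  by apply: prodq_perm; rewrite /Bg catrevE cats0 perm_rev.
have sB : size Bg = m by rewrite /Bg catrevE cats0 size_rev size_map szg ses.
have sD2 : (1 < size (rcons D d))%N by rewrite size_rcons ltnS lt0n size_eq0.
have dD : d \in rcons D d by rewrite mem_rcons mem_head.
have [l2 [k3 w3]] := root_run d2 lohi hi1 lof st2 k2 sD2 dD sB.
have hrem : perm_eq (rem d (rcons D d)) D.
  rewrite -(perm_cons d) -(permPl (perm_to_rem dD)).
  by rewrite perm_rcons.
rewrite (in_class_perm_deg _ _ hrem) in k3.
have hlv : perm_eq (typed (mobius (prodq Bg) :: rest) [::]) (typed (rcons rest (mobius (prodq Bg))) [::]).
  by rewrite /typed !cats0; apply: perm_map; rewrite perm_sym perm_rcons.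
rewrite (in_class_perm_leaves _ _ hlv) in k3.
rewrite /= -/es -/D -/m -/rest -eB.
rewrite -mulrA; apply: le_trans w2; rewrite ler_pM2l; last first.
  by apply: hprod_gt0 => x /(star_prods01 W1)/andP[].
apply: le_trans w3.
have [l0 lh] := andP lohi.
have B01 b : b \in Bg -> 0 < b <= 1.
  by move=> /(st_big st2)/andP[h1 h2]; rewrite (lt_le_trans l0 h1) (le_trans h2 (ltW hi1)).
have /andP[X0 X1] : 0 < prodq Bg <= 1 by exact: prodq01.
have h01 : 0 < 8 - 5 * prodq Bg by move: X1; clear; lra.
rewrite ler_pM2l; last exact: h01.
have X01 : 0 < prodq Bg <= 1 by rewrite X0.
(* Ensures that the first star of the next round is filled by old leaves alone; the new leaf is last
   in the list. *)
have sr : ((head 0%N D).-1 <= size rest)%N.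
  have := handshake k3; rewrite size_cat !size_map size_rcons.
  have : all (leq d) D by have := st_dmin st2; rewrite all_rcons => /andP[].
  case: (D) D0 => //= e D' _ /andP[he /sumn_ge].
  have : (2 * size D' <= d * size D')%N by rewrite leq_mul2r d2 orbT.
  move: (size D') (size rest) (sumn D') (d * _)%N => a b c z; clear; lia.
have hdD : head 0%N (rcons D d) = head 0%N D by case: (D) D0.
have nx := st_next st2; rewrite hdD in nx.
have lst : (d <= last 0 D)%N.
  apply: (allP (st_dmin st2)); rewrite mem_rcons inE.
  by case: (D) D0 => // a D' _; rewrite /= mem_last orbT.
have d1m : (m <= (head 0%N D).-1)%N.
  rewrite /m -!subn1; apply: leq_sub2r; apply: (allP (st_dmin st2)).
  by rewrite mem_rcons inE; case: (D) D0 => // a D' _; rewrite mem_head orbT.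
(* The [m] big leaves are at most [hi], so the new small leaf is at least [lo] and the list stays
   sorted with it at the end. *)
have loX : lo <= mobius (prodq Bg).
  rewrite -elo; apply: mobius_le => //.
    by rewrite exprn_gt0 ?(lt_le_trans l0 lh) //=; apply: exprn_ile1; [exact: ltW (lt_le_trans l0 lh)|exact: ltW].
  rewrite -/m -sB; apply: prodq_le; first exact: ltW (lt_le_trans l0 lh).
  by move=> b bB; have /andP[h1 ->] := st_big st2 bB; rewrite (lt_le_trans l0 h1).
apply: IH => //.
- apply: leq_trans (_ : size ds <= _)%N; last by move: hf; rewrite size_rcons.
  by rewrite size_drop leq_subr.
- by have := st_sorted st2; rewrite -cats1 => /cat_sorted2[].
- by move: ge2; rewrite all_rcons eds all_cat => /and3P[].
- rewrite -cats1; apply: (sorted_cat_le (st_ssorted st2)).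
  by move=> s /(st_small st2)/andP[_ h]; exact: le_trans h loX.
have tk : take (head 0%N D).-1 (rcons rest (mobius (prodq Bg))) = take (head 0%N D).-1 rest.
  by rewrite -cats1 takel_cat.
rewrite /low_leaves tk; set hi' := mobius _ in nx *.
have r01 : 0 < prodq (take (head 0%N D).-1 rest) <= 1.
  by apply: prodq01 => w /mem_take/mem_drop/W1.
have /andP[hi'0 hi'1] : 0 < hi' < 1 by exact: mobius_bounds.
(* Remaining leaves are at most [lo], big ones at least [lo], and the next star has at least [m]
   leaves, so its product is at most that of [Bg]. *)
have Xhi : mobius (prodq Bg) <= hi'.
  apply: mobius_le => //.
  apply: (@le_trans _ _ (lo ^+ m)); last by rewrite -sB; apply: prodq_ge; [exact: ltW | move=> b /(st_big st2)/andP[]].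
  apply: (@le_trans _ _ (lo ^+ (head 0%N D).-1)).
    rewrite -{2}(size_takel sr); apply: prodq_le; first exact: ltW.
    by move=> w /mem_take; exact: st_small st2 _.
  by apply: expr_le1_anti => //; rewrite l0 (le_trans lh) // ltW.
(* By [st_next], every big leaf is at least [hi'], and the next minimal degree is at least d. *)
have Xlast : mobius (prodq Bg) <= mobius (hi' ^+ (last 0 D).-1).
  apply: mobius_le => //.
    by rewrite exprn_gt0 //=; apply: exprn_ile1; exact: ltW.
  apply: (@le_trans _ _ (hi' ^+ m)).
    apply: expr_le1_anti; first by rewrite hi'0 ltW.
    by rewrite /m -!subn1; apply: leq_sub2r.
  by rewrite -sB; apply: prodq_ge; [exact: ltW | exact: nx].
move=> w; rewrite mem_rcons inE => /predU1P[->|wr].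
  by split=> //; exact: mobius_bounds.
have /andP[w0 wlo] := st_small st2 wr.
have wX := le_trans wlo loX.
split; [|exact: le_trans wX Xhi|exact: le_trans wX Xlast].
by rewrite w0; apply: le_lt_trans (le_trans wX Xhi) hi'1.
Qed.

(** * Solvability and leaf elimination *)

Section Solv.

Variables (V : finType) (e : rel V).
Hypothesis esym : symmetric e.
Hypothesis eirr : irreflexive e.

Notation F2V := {ffun V -> 'F_2}.

Definition nsum (A : {set V}) (w : V) (x : F2V) : 'F_2 :=
  \sum_(u in A) (e w u)%:R * x u.

Definition solvable_on (A : {set V}) (ab : F2V * F2V) : bool :=
  [exists x : F2V, [forall w in A, nsum A w x + ab.1 w * x w == ab.2 w]].

(** Coordinates outside [A] are free, so this is the solvability of the induced subgraph times 4 for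
    each vertex outside [A]. Deleting vertices thus never changes the type. *)
Definition solv_on (A : {set V}) : nat := #|[set ab : F2V * F2V | solvable_on A ab]|.

Lemma F2_addxx (x : 'F_2) : x + x = 0.
Proof. by apply: addrr_pchar2; rewrite inE /=; apply/eqP/val_inj. Qed.

Lemma F2_01 (x : 'F_2) : x = 0 \/ x = 1.
Proof. by case: x => [[|[|n]] h] //; [left|right]; exact: val_inj. Qed.

Lemma solvable_onP (A : {set V}) (ab : F2V * F2V) : reflect
  (exists x : F2V, forall w, w \in A -> nsum A w x + ab.1 w * x w = ab.2 w)
  (solvable_on A ab).
Proof.
apply: (iffP existsP) => -[x h]; exists x.
  by move=> w wA; have /forall_inP/(_ w wA)/eqP := h.
by apply/forall_inP => w wA; apply/eqP/h.
Qed.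

Lemma card_invol (P Q : pred (F2V * F2V)) f : involutive f ->
  (forall ab, P ab = Q (f ab)) -> #|[set ab : F2V * F2V | P ab]| = #|[set ab : F2V * F2V | Q ab]|.
Proof.
move=> hf h; rewrite -(on_card_preimset (f := f) (R := [set ab : F2V * F2V | Q ab])).
  by apply: eq_card => ab; rewrite !inE h.
by exists f => x _; exact: hf.
Qed.

Lemma nsumD1 (A : {set V}) v w x : v \in A ->
  nsum A w x = (e w v)%:R * x v + nsum (A :\ v) w x.
Proof. by move=> h; rewrite /nsum (big_setD1 v). Qed.

Lemma nsum_ext (A : {set V}) w (x y : F2V) : {in A, x =1 y} -> nsum A w x = nsum A w y.
Proof. by move=> h; apply: eq_bigr => u uA; rewrite h. Qed.

Lemma solvable_ext (A : {set V}) (ab cd : F2V * F2V) : {in A, ab.1 =1 cd.1} -> {in A, ab.2 =1 cd.2} ->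
  solvable_on A ab = solvable_on A cd.
Proof.
move=> h1 h2; apply/solvable_onP/solvable_onP => -[x hx]; exists x => w wA.
  by rewrite -h1 // -h2 // hx.
by rewrite h1 // h2 // hx.
Qed.

Definition upd (f : F2V) v c : F2V := [ffun w => if w == v then c else f w].

Lemma updE f v c w : upd f v c w = if w == v then c else f w.
Proof. by rewrite ffunE. Qed.

Lemma upd_same f v c : upd f v c v = c.
Proof. by rewrite updE eqxx. Qed.

Section Isolated.

Variables (A : {set V}) (v : V).
Hypothesis vA : v \in A.
Hypothesis iso : forall w, w \in A -> e v w = false.

Lemma solvable_isolated (ab : F2V * F2V) : solvable_on A ab =
  ((ab.1 v == 1) || (ab.2 v == 0)) && solvable_on (A :\ v) ab.
Proof.
have nv x w : w \in A -> nsum A w x = nsum (A :\ v) w x.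
  by move=> wA; rewrite (nsumD1 _ _ vA) esym iso // mul0r add0r.
have n0 x : nsum A v x = 0.
  by apply: big1 => u uA; rewrite iso // mul0r.
apply/solvable_onP/andP => [[x hx]|[h /solvable_onP[x hx]]].
  split; last first.
    apply/solvable_onP; exists x => w; rewrite !inE => /andP[_ wA].
    by rewrite -nv // hx.
  have := hx v vA; rewrite n0 add0r => <-.
  by case: (F2_01 (ab.1 v)) => ->; rewrite ?eqxx // mul0r eqxx orbT.
exists (upd x v (ab.2 v)) => w wA; have [->|ne] := eqVneq w v.
  rewrite n0 add0r upd_same; case/orP: h => /eqP h; first by rewrite h mul1r.
  by rewrite h mulr0.
rewrite nv // updE (negbTE ne) (@nsum_ext _ _ _ x) ?hx // ?inE ?ne //.
by move=> u; rewrite !inE updE => /andP[/negbTE->].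
Qed.

End Isolated.

Definition flipa (u : V) (ab : F2V * F2V) := (upd ab.1 u (ab.1 u + 1), ab.2).
Definition flipb (u : V) (ab : F2V * F2V) := (ab.1, upd ab.2 u (ab.2 u + 1)).

Lemma flipaK u : involutive (flipa u).
Proof.
move=> [a b]; congr (_, _); apply/ffunP => w; rewrite !updE.
by case: eqP => [->|//]; rewrite eqxx -addrA F2_addxx addr0.
Qed.

Lemma flipbK u : involutive (flipb u).
Proof.
move=> [a b]; congr (_, _); apply/ffunP => w; rewrite !updE.
by case: eqP => [->|//]; rewrite eqxx -addrA F2_addxx addr0.
Qed.

Lemma card_split (P Q : pred (F2V * F2V)) : (#|[set ab : F2V * F2V | P ab]| =
  #|[set ab : F2V * F2V | P ab && Q ab]| + #|[set ab : F2V * F2V | P ab && ~~ Q ab]|)%N.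
Proof.
rewrite -(cardsID [set ab : F2V * F2V | Q ab] [set ab : F2V * F2V | P ab]); congr (_ + _)%N.
  by apply: eq_card => ab; rewrite !inE.
by apply: eq_card => ab; rewrite !inE andbC.
Qed.

Lemma card_halfa (P : pred (F2V * F2V)) v : (forall ab, P (flipa v ab) = P ab) ->
  #|[set ab : F2V * F2V | P ab && (ab.1 v == 1)]| = #|[set ab : F2V * F2V | P ab && ~~ (ab.1 v == 1)]|.
Proof.
move=> h; apply: (card_invol (@flipaK v)) => ab.
rewrite h /= upd_same; congr (_ && _).
by case: (F2_01 (ab.1 v)) => ->.
Qed.

Lemma card_halfb (P : pred (F2V * F2V)) v : (forall ab, P (flipb v ab) = P ab) ->
  #|[set ab : F2V * F2V | P ab && (ab.2 v == 0)]| = #|[set ab : F2V * F2V | P ab && ~~ (ab.2 v == 0)]|.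
Proof.
move=> h; apply: (card_invol (@flipbK v)) => ab.
rewrite h /= upd_same; congr (_ && _).
by case: (F2_01 (ab.2 v)) => ->.
Qed.

Lemma solvable_flipa (A : {set V}) v ab : v \notin A -> solvable_on A (flipa v ab) = solvable_on A ab.
Proof.
move=> vA; apply: solvable_ext => w wA //=; rewrite updE.
by case: eqP wA vA => [-> -> //|].
Qed.

Lemma solvable_flipb (A : {set V}) v ab : v \notin A -> solvable_on A (flipb v ab) = solvable_on A ab.
Proof.
move=> vA; apply: solvable_ext => w wA //=; rewrite updE.
by case: eqP wA vA => [-> -> //|].
Qed.

(** Of the four values of (a_v, b_v) only (0, 1) has no solution; on the right both coordinates are
    free, hence the 4. *)
Lemma solv_isolated (A : {set V}) v : v \in A -> (forall w, w \in A -> e v w = false) ->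
  (4 * solv_on A = 3 * solv_on (A :\ v))%N.
Proof.
move=> vA iso; rewrite /solv_on.
have nv : v \notin A :\ v by rewrite !inE eqxx.
pose P := solvable_on (A :\ v).
rewrite (eq_card (B := [set ab : F2V * F2V | ((ab.1 v == 1) || (ab.2 v == 0)) && P ab])); last first.
  by move=> ab; rewrite !inE (solvable_isolated vA iso).
rewrite (card_split P (fun ab => ab.1 v == 1)).
rewrite -(card_halfa (v := v)); last first.
  by move=> ab; rewrite /P solvable_flipa.
rewrite (card_split _ (fun ab => ab.1 v == 1)).
rewrite (eq_card (B := [set ab : F2V * F2V | P ab && (ab.1 v == 1)])); last first.
  by move=> ab; rewrite !inE; case: (P _); case: (_ == 1); case: (_ == 0).
pose X := [set ab : F2V * F2V | ((ab.1 v == 1) || (ab.2 v == 0)) && P ab && ~~ (ab.1 v == 1)].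
pose Y := [set ab : F2V * F2V | P ab && (ab.1 v == 1)].
have h : (#|X| * 2 = #|Y|)%N.
  rewrite /X /Y.
  have e1 := @card_halfa P v (fun ab => solvable_flipa ab nv).
  rewrite e1 (card_split (fun ab => P ab && ~~ (ab.1 v == 1)) (fun ab => ab.2 v == 0)).
  rewrite -card_halfb ?addnn -?muln2; last first.
    by move=> ab; rewrite /P solvable_flipb.
  congr (_ * _)%N; apply: eq_card => ab; rewrite !inE.
  by case: (P _); case: (_ == 1); case: (_ == 0).
rewrite -/X -/Y; move: h; move: #|X| #|Y| => x y; clear; lia.
Qed.

Section LeafStep.

Variables (A : {set V}) (v u : V).
Hypothesis vA : v \in A.
Hypothesis uA : u \in A.
Hypothesis uv : u != v.
Hypothesis leafv : forall w, w \in A -> e v w = (w == u).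

(* If a_v = 1 then x_v = b_v + x_u can be substituted in equation u. *)
Definition shift1 (ab : F2V * F2V) :=
  (upd ab.1 u (ab.1 u + 1), upd ab.2 u (ab.2 u + ab.2 v)).

(* If a_v = 0 then x_u = b_v is forced and x_v solves equation u. *)
Definition shift2 (ab : F2V * F2V) : F2V * F2V :=
  (ab.1, [ffun w => if w == v then ab.2 v else ab.2 w + (e w u)%:R * ab.2 v]).

Lemma shift1K : involutive shift1.
Proof.
move=> [a b]; congr (_, _); apply/ffunP => w; rewrite !updE.
  by case: eqP => [->|//]; rewrite eqxx -addrA F2_addxx addr0.
case: eqP => [->|//]; rewrite eqxx eq_sym (negbTE uv).
by rewrite -addrA F2_addxx addr0.
Qed.

Lemma shift2K : involutive shift2.
Proof.
move=> [a b]; congr (_, _); apply/ffunP => w; rewrite !ffunE eqxx /=.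
by case: eqP => [->//|_]; rewrite -addrA F2_addxx addr0.
Qed.

Lemma nsum_v x : nsum A v x = x u.
Proof.
rewrite (nsumD1 _ _ uA) leafv // eqxx mul1r [nsum _ _ _]big1 ?addr0 //.
by move=> w; rewrite !inE => /andP[/negbTE h wA]; rewrite leafv // h mul0r.
Qed.

Lemma nsum_w x w : w \in A -> nsum A w x = (w == u)%:R * x v + nsum (A :\ v) w x.
Proof. by move=> wA; rewrite (nsumD1 _ _ vA) esym leafv. Qed.

Lemma solvable_leaf1 (ab : F2V * F2V) : ab.1 v = 1 ->
  solvable_on A ab = solvable_on (A :\ v) (shift1 ab).
Proof.
move=> a1; apply/solvable_onP/solvable_onP => -[x hx].
  exists x => w; rewrite !inE => /andP[wv wA] /=; rewrite !updE.
  have := hx w wA; rewrite nsum_w //; case: eqP => [->|_]; last by rewrite mul0r add0r.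
  rewrite mul1r => <-; have := hx v vA; rewrite nsum_v a1 mul1r => <-.
  (* [ring] does not use characteristic two, so the vanishing sum is inserted by hand. *)
  by rewrite -[LHS]addr0 -(F2_addxx (x v)); ring.
have nx w c : nsum (A :\ v) w (upd x v c) = nsum (A :\ v) w x.
  by apply: nsum_ext => z; rewrite !inE updE => /andP[/negbTE->].
exists (upd x v (ab.2 v + x u)) => w wA; have [->|wv] := eqVneq w v.
  by rewrite nsum_v upd_same updE (negbTE uv) a1 mul1r addrC -addrA F2_addxx addr0.
rewrite nsum_w // nx upd_same updE (negbTE wv).
have := hx w; rewrite !inE wv wA /= !updE => /(_ isT).
case: eqP => [->|_]; last by rewrite mul0r add0r.
rewrite mul1r mulrDl mul1r => h.
have -> : ab.2 u = ab.2 u + ab.2 v + ab.2 v by rewrite -addrA F2_addxx addr0.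
rewrite -h; ring.
Qed.

Lemma solvable_leaf0 (ab : F2V * F2V) : ab.1 v = 0 ->
  solvable_on A ab = solvable_on (A :\ v :\ u) (shift2 ab).
Proof.
have uAv : u \in A :\ v by rewrite !inE uv.
move=> a0; apply/solvable_onP/solvable_onP => -[x hx].
  have xu : x u = ab.2 v by have := hx v vA; rewrite nsum_v a0 mul0r addr0.
  exists x => w; rewrite !inE => /and3P[wu wv wA] /=; rewrite ffunE (negbTE wv).
  have := hx w wA; rewrite nsum_w // (negbTE wu) mul0r add0r (nsumD1 _ _ uAv) xu => <-.
  by rewrite -[LHS]addr0 -(F2_addxx ((e w u)%:R * ab.2 v)); ring.
(* Equation v forces the value at u, and equation u is then solved for the value at v. *)
pose y := upd (upd x u (ab.2 v)) v (ab.2 u + ab.1 u * ab.2 v + nsum (A :\ v :\ u) u x).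
have nx w : nsum (A :\ v :\ u) w y = nsum (A :\ v :\ u) w x.
  by apply: nsum_ext => z; rewrite !inE !updE => /and3P[/negbTE-> /negbTE->].
have yu : y u = ab.2 v by rewrite /y updE (negbTE uv) upd_same.
exists y => w wA; have [->|wv] := eqVneq w v.
  by rewrite nsum_v yu a0 mul0r addr0.
rewrite nsum_w // (nsumD1 _ _ uAv) nx yu.
have [->|wu] := eqVneq w u.
  rewrite eirr mul0r add0r mul1r yu /y upd_same.
  set s := nsum _ _ _; set t := ab.1 u * _.
  by rewrite -[RHS]addr0 -{1}(F2_addxx s) -[RHS]addr0 -{1}(F2_addxx t); ring.
have -> : y w = x w by rewrite /y !updE (negbTE wv) (negbTE wu).
rewrite mul0r add0r; have := hx w; rewrite !inE wu wv wA /= ffunE (negbTE wv) => /(_ isT) h.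
have -> : ab.2 w = ab.2 w + (e w u)%:R * ab.2 v + (e w u)%:R * ab.2 v.
  by rewrite -addrA F2_addxx addr0.
rewrite -h; ring.
Qed.

(** The pairs are split by a_v and moved by [shift1] or [shift2]. In the smaller systems a_v is
    free, so each case accounts for half of the corresponding count. *)
Lemma solv_leaf : (2 * solv_on A = solv_on (A :\ v) + solv_on (A :\ v :\ u))%N.
Proof.
have nv : v \notin A :\ v by rewrite !inE eqxx.
have nv2 : v \notin A :\ v :\ u by rewrite !inE eqxx andbF.
rewrite /solv_on (card_split (solvable_on A) (fun ab => ab.1 v == 1)) mulnDr.
have su ab : (shift1 ab).1 v = ab.1 v by rewrite /= updE eq_sym (negbTE uv).
congr (_ + _)%N.
  rewrite (card_invol shift1K (Q := fun ab => solvable_on (A :\ v) ab && (ab.1 v == 1))).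
    rewrite mul2n -addnn {2}card_halfa; last by move=> ab; exact: solvable_flipa.
    by rewrite -card_split.
  move=> ab; rewrite su; case: eqP => [h|_]; last by rewrite !andbF.
  by rewrite !andbT solvable_leaf1.
rewrite (card_invol shift2K (Q := fun ab => solvable_on (A :\ v :\ u) ab && ~~ (ab.1 v == 1))).
  rewrite mul2n -addnn -{1}card_halfa; last by move=> ab; exact: solvable_flipa.
  by rewrite -card_split.
move=> ab; rewrite /=; case: (F2_01 (ab.1 v)) => h; rewrite h /= ?andbF //.
by rewrite !andbT solvable_leaf0.
Qed.

End LeafStep.

Lemma solv_on0 : solv_on set0 = (4 ^ #|V|)%N.
Proof.
rewrite /solv_on (eq_card (B := predT)); last first.
  by move=> ab; rewrite !inE; apply/solvable_onP; exists 0 => w; rewrite inE.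
by rewrite card_prod !card_ffun card_ord -expnD addnn -mul2n expnM.
Qed.

Lemma solvabilityE : solvability e = solv_on setT.
Proof.
pose h (ab : F2V * F2V) : 'rV['F_2]_#|V| * 'cV['F_2]_#|V| :=
  (\row_i ab.1 (enum_val i), \col_i ab.2 (enum_val i)).
pose h' (ab : 'rV['F_2]_#|V| * 'cV['F_2]_#|V|) : F2V * F2V :=
  ([ffun v => ab.1 0 (enum_rank v)], [ffun v => ab.2 (enum_rank v) 0]).
have hK : cancel h h'.
  by move=> [a b]; congr (_, _); apply/ffunP => v; rewrite ffunE mxE enum_rankK.
have hK' : cancel h' h.
  move=> [a b]; congr (_, _); first by apply/rowP => i; rewrite mxE ffunE enum_valK.
  by apply/colP => i; rewrite mxE ffunE enum_valK.
rewrite /solvability -(on_card_preimset (f := h)); last by exists h' => x _; [exact: hK|exact: hK'].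
apply: eq_card => ab; rewrite !inE.
have key (x : 'cV['F_2]_#|V|) i : ((adjacency_mx e + diag_mx (h ab).1) *m x) i 0 =
    nsum setT (enum_val i) [ffun v => x (enum_rank v) 0] + ab.1 (enum_val i) * x i 0.
  rewrite mulmxDl mul_diag_mx !mxE; congr (_ + _).
  rewrite /nsum (reindex _ (onW_bij _ (@enum_val_bij V))) /=.
  by apply: eq_big => [j|j _]; [rewrite inE | rewrite mxE ffunE enum_valK].
apply/existsP/solvable_onP => [[x /eqP hx]|[x hx]].
  exists [ffun v => x (enum_rank v) 0] => w _.
  have := key x (enum_rank w); rewrite hx mxE enum_rankK ffunE => ->.
  by [].
exists (\col_i x (enum_val i)); apply/eqP/colP => i.
rewrite key !mxE -hx ?inE //; congr (_ + _).
by apply: nsum_ext => w _; rewrite ffunE mxE enum_rankK.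
Qed.

End Solv.

(** * Elimination of vertices along a parent list *)

Section Elim.

Variables (T : Type) (step : T -> T -> T).

Definition fupd (f : nat -> T) (u : nat) (c : T) : nat -> T :=
  fun v => if v == u then c else f v.

(* The vertices k, k+1, ... of a parent list are merged into their parents,
   the last one first. *)
Fixpoint elim (k : nat) (p : seq nat) (phi : nat -> T) : nat -> T :=
  if p is u :: p' then
    let f := elim k.+1 p' phi in fupd f u (step (f u) (f k))
  else phi.

Lemma elim_cat k p q phi : elim k (p ++ q) phi = elim k p (elim (k + size p) q phi).
Proof.
elim: p k => [|u p IH] k /=; first by rewrite addn0.
by rewrite IH addSnnS.
Qed.

Lemma elim_rcons k p u phi : elim k (rcons p u) phi =
  elim k p (fupd phi u (step (phi u) (phi (k + size p)%N))).
Proof. by rewrite -cats1 elim_cat. Qed.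

End Elim.

Definition wf (p : seq nat) : Prop := forall i, (i < size p)%N -> (nth 0%N p i <= i)%N.

Lemma wf_rcons p u : wf (rcons p u) -> wf p /\ (u <= size p)%N.
Proof.
move=> h; split.
  move=> i hi; have := h i; rewrite size_rcons nth_rcons hi; apply.
  exact: ltnW.
by have := h (size p); rewrite size_rcons nth_rcons ltnn eqxx; apply.
Qed.

Lemma elim_ext (T : Type) (step : T -> T -> T) p phi psi : wf p ->
  (forall v, (v <= size p)%N -> phi v = psi v) ->
  elim step 1 p phi 0%N = elim step 1 p psi 0%N.
Proof.
elim/last_ind: p phi psi => [|p u IH] phi psi /=; first by move=> _; apply.
move=> /wf_rcons[hp hu] h; rewrite !elim_rcons; apply: IH => // v hv.
rewrite /fupd; case: eqP => _; last by apply: h; rewrite size_rcons ltnW.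
by rewrite (h u) ?(h (1 + size p)%N) // size_rcons ?add1n // leqW.
Qed.

Definition vec : Type := (rat * rat)%type.
(* The components of a vector at v are the weights of v and its eliminated
   branches in the two states of v in the expansion
   s(G) = sum over S of 8^(n-|S|) (-5)^|S| (6/5)^(edges inside S). *)
Definition vstep (a b : vec) : vec := (a.1 * (b.1 + b.2), a.2 * (b.1 + 6 / 5 * b.2)).
Definition comb (c : rat) (x : vec) (d : rat) (y : vec) : vec :=
  (c * x.1 + d * y.1, c * x.2 + d * y.2).
Definition elim_value (p : seq nat) (phi : nat -> vec) : rat :=
  (elim vstep 1 p phi 0%N).1 + (elim vstep 1 p phi 0%N).2.

Lemma elim_value_rcons p u phi : elim_value (rcons p u) phi =
  elim_value p (fupd phi u (vstep (phi u) (phi (size p).+1))).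
Proof. by rewrite /elim_value elim_rcons add1n. Qed.

Lemma elim_value_ext p phi psi : wf p ->
  (forall v, (v <= size p)%N -> phi v = psi v) -> elim_value p phi = elim_value p psi.
Proof. by move=> hp h; rewrite /elim_value (elim_ext _ hp h). Qed.

(** Each vertex vector enters the value exactly once. Linearity lets the parent vector of an
    eliminated leaf be split into the two terms of the leaf recursion. *)
Lemma elim_value_lin p phi u c x d y : wf p -> (u <= size p)%N ->
  elim_value p (fupd phi u (comb c x d y)) =
  c * elim_value p (fupd phi u x) + d * elim_value p (fupd phi u y).
Proof.
elim/last_ind: p phi u x y => [|p w IH] phi u x y.
  rewrite leqn0 => _ /eqP ->; rewrite /elim_value /= /fupd eqxx /comb /=; ring.
move=> /wf_rcons[hp hw]; rewrite size_rcons leq_eqVlt => /orP[/eqP ->|].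
  rewrite !elim_value_rcons.
  have aux z : elim_value p (fupd (fupd phi (size p).+1 z) w
      (vstep (fupd phi (size p).+1 z w) (fupd phi (size p).+1 z (size p).+1))) =
      elim_value p (fupd phi w (vstep (phi w) z)).
    apply: elim_value_ext => // v hv; rewrite /fupd eqxx.
    have -> : (w == (size p).+1) = false by apply/ltn_eqF.
    by have -> : (v == (size p).+1) = false by apply/ltn_eqF.
  rewrite !aux; rewrite -IH //; apply: elim_value_ext => // v hv.
  rewrite /fupd; case: eqP => // _; rewrite /vstep /comb /=; congr (_, _); ring.
rewrite ltnS => hu; rewrite !elim_value_rcons.
have ku : ((size p).+1 == u) = false by rewrite eq_sym; apply/ltn_eqF.
have [->|ne] := eqVneq u w.
  have aux z : elim_value p (fupd (fupd phi w z) w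
      (vstep (fupd phi w z w) (fupd phi w z (size p).+1))) =
      elim_value p (fupd phi w (vstep z (phi (size p).+1))).
    apply: elim_value_ext => // v hv; rewrite /fupd eqxx.
    have -> : ((size p).+1 == w) = false by rewrite eq_sym; apply/ltn_eqF.
    by case: eqP.
  rewrite !aux -IH //; apply: elim_value_ext => // v hv.
  rewrite /fupd; case: eqP => // _; rewrite /vstep /comb /=; congr (_, _); ring.
have aux z : elim_value p (fupd (fupd phi u z) w
      (vstep (fupd phi u z w) (fupd phi u z (size p).+1))) =
      elim_value p (fupd (fupd phi w (vstep (phi w) (phi (size p).+1))) u z).
  apply: elim_value_ext => // v hv; have wu : (w == u) = false by rewrite eq_sym (negbTE ne).
  rewrite /fupd ku wu; by case: (v =P w) => [->|//]; rewrite eq_sym (negbTE ne).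
by rewrite !aux -IH.
Qed.

Definition valive : vec := (8, -5).
(** A deleted vertex multiplies its parent by 1 in both components, and passes on the total value of
    its own branches. *)
Definition vdead : vec := (1, 0).
Definition valive_but (K : pred nat) : nat -> vec := fun v => if K v then vdead else valive.

Section Coded.

Variables (V : finType) (e : rel V) (g : nat -> V).

(* g lists the vertices, each later vertex having exactly one earlier
   neighbour, its parent in p. *)
Record coded (p : seq nat) : Prop := Coded {
  cd_wf : wf p;
  cd_inj : forall i j, (i <= size p)%N -> (j <= size p)%N -> g i = g j -> i = j;
  cd_adj : forall i j, (j < i)%N -> (i <= size p)%N ->
    e (g i) (g j) = (nth 0%N p i.-1 == j)
}.

Lemma coded_rcons p u : coded (rcons p u) -> coded p.
Proof.
case=> h1 h2 h3; split; first by have [] := wf_rcons h1.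
  by move=> i j hi hj; apply: h2; rewrite size_rcons ltnW.
move=> i j ji ip; have hi : (i <= size (rcons p u))%N by rewrite size_rcons leqW.
rewrite (h3 i j ji hi) nth_rcons.
suff -> : (i.-1 < size p)%N by [].
by case: i ji ip {hi}.
Qed.

Hypothesis esym : symmetric e.
Hypothesis eirr : irreflexive e.

Definition alive (p : seq nat) (K : pred nat) : {set V} :=
  [set x | [exists j : 'I_(size p).+1, (g j == x) && ~~ K j]].

Lemma aliveP p K x : reflect (exists j, [/\ (j <= size p)%N, ~~ K j & g j = x]) (x \in alive p K).
Proof.
rewrite inE; apply: (iffP existsP) => [[j /andP[/eqP h1 h2]]|[j [h1 h2 h3]]].
  by exists j; split=> //; rewrite -ltnS.
by have hj : (j < (size p).+1)%N by []; exists (Ordinal hj); rewrite /= h3 eqxx.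
Qed.

(** The solvability of the subgraph induced on [A]: the free coordinates of [solv_on] are divided
    out. *)
Definition sweight (A : {set V}) : rat := (solv_on e A)%:R * 4 ^+ #|A| / 4 ^+ #|V|.

Lemma sweight_isolated (A : {set V}) v : v \in A -> (forall w, w \in A -> e v w = false) ->
  sweight A = 3 * sweight (A :\ v).
Proof.
move=> vA iso; rewrite /sweight (cardsD1 v A) vA exprS.
have := solv_isolated esym vA iso => /(congr1 (fun n => n%:R : rat)); rewrite !natrM => h.
have -> : (solv_on e A)%:R = 3 / 4 * (solv_on e (A :\ v))%:R :> rat.
  by apply: (@mulfI _ 4); rewrite // h; field.
by field; rewrite expf_neq0.
Qed.

Lemma sweight_leaf (A : {set V}) v u : v \in A -> u \in A -> u != v ->
  (forall w, w \in A -> e v w = (w == u)) ->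
  sweight A = 2 * sweight (A :\ v) + 8 * sweight (A :\ v :\ u).
Proof.
move=> vA uA uv leafv; rewrite /sweight.
have uAv : u \in A :\ v by rewrite !inE uv.
rewrite (cardsD1 v A) vA (cardsD1 u (A :\ v)) uAv !exprS.
have := solv_leaf esym eirr vA uA uv leafv => /(congr1 (fun n => n%:R : rat)).
rewrite natrM natrD => h.
have -> : (solv_on e A)%:R = ((solv_on e (A :\ v))%:R + (solv_on e (A :\ v :\ u))%:R) / 2 :> rat.
  by apply: (@mulfI _ 2); rewrite // h; field.
by field; rewrite expf_neq0.
Qed.

Lemma sweight0 : sweight set0 = 1.
Proof.
rewrite /sweight cards0 expr0 mulr1 solv_on0 natrX divff // expf_neq0 //.
Qed.

(** The last vertex of the code is a leaf or isolated once [K] is deleted. The statement carries the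
    deleted set because the leaf recursion also removes the parent, which sits inside the code. *)
Lemma solv_elim p K : coded p -> sweight (alive p K) = elim_value p (valive_but K).
Proof.
elim/last_ind: p K => [|p u IH] K hc.
  rewrite /elim_value /= /valive_but; case: ifP => K0.
    rewrite (_ : alive _ _ = set0) ?sweight0 /= ?addr0 //.
    apply/setP => x; rewrite in_set0; apply/aliveP => -[j []].
    by rewrite leqn0 => /eqP ->; rewrite K0.
  have e1 : alive [::] K = [set g 0%N].
    apply/setP => x; rewrite in_set1; apply/aliveP/eqP => [[j []]|->].
      by rewrite leqn0 => /eqP ->.
    by exists 0%N; rewrite K0.
  rewrite e1 (sweight_isolated (v := g 0%N)) ?set11 //; last by move=> w; rewrite in_set1 => /eqP ->.
  have -> : [set g 0%N] :\ g 0%N = set0 by apply/setP => x; rewrite !inE andNb.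
  by rewrite sweight0 /=; ring.
have hp := coded_rcons hc; have [wp hu] := wf_rcons (cd_wf hc).
set k := (size p).+1.
have uk : (u == k) = false by apply/ltn_eqF.
have ku : (k == u) = false by rewrite eq_sym.
rewrite elim_value_rcons -/k.
have [Kk|Kk] := boolP (K k).
  have -> : alive (rcons p u) K = alive p K.
    apply/setP => x; apply/aliveP/aliveP => -[j [h1 h2 h3]]; exists j; split=> //.
      move: h1; rewrite size_rcons leq_eqVlt => /orP[/eqP e1|//].
      by rewrite e1 Kk in h2.
    by rewrite size_rcons ltnW.
  rewrite IH //; apply: elim_value_ext => // v hv; rewrite /fupd; case: eqP => [->|//].
  rewrite /valive_but Kk; case: ifP => _; rewrite /vstep /vdead /valive /=; congr (_, _); ring.
have kA : g k \in alive (rcons p u) K by apply/aliveP; exists k; split=> //; rewrite size_rcons.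
have Ak : alive (rcons p u) K :\ g k = alive p K.
  apply/setP => x; rewrite in_setD1; apply/andP/aliveP.
    case=> ne /aliveP[j [h1 h2 h3]]; exists j; split=> //.
    move: h1; rewrite size_rcons leq_eqVlt => /orP[/eqP e1|//].
    by rewrite -h3 e1 eqxx in ne.
  case=> j [h1 h2 h3]; split; last by apply/aliveP; exists j; rewrite size_rcons ltnW.
  apply/eqP => e1; have := cd_inj hc (i := j) (j := k).
  rewrite size_rcons h3 e1 => /(_ (leqW h1) (leqnn _) erefl) e2.
  by rewrite e2 ltnn in h1.
have adj j : (j <= size p)%N -> e (g k) (g j) = (u == j).
  move=> hj; rewrite (cd_adj hc) ?size_rcons //.
  by rewrite nth_rcons ltnn eqxx.
have [Ku|Ku] := boolP (K u).
  rewrite (sweight_isolated kA).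
    rewrite Ak IH //.
    (* A live child of a deleted parent yields [vstep vdead valive] = 3 [vdead], matching the factor
       3 of an isolated vertex. *)
    rewrite [RHS](@elim_value_ext p _ (fupd (valive_but K) u (comb 3 vdead 0 vdead))) //; last first.
      move=> v hv; rewrite /fupd; case: eqP => // _; rewrite /valive_but Ku (negbTE Kk).
      by rewrite /vstep /comb /vdead /valive /=; congr (_, _); ring.
    rewrite elim_value_lin // mul0r addr0; congr (_ * _); apply: elim_value_ext => // v hv.
    by rewrite /fupd; case: eqP => // ->; rewrite /valive_but Ku.
  move=> w /aliveP[j [h1 h2 <-]].
  move: h1; rewrite size_rcons leq_eqVlt => /orP[/eqP ->|]; first exact: eirr.
  by rewrite ltnS => /adj ->; apply/eqP => e1; rewrite -e1 Ku in h2.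
have uA : g u \in alive (rcons p u) K.
  by apply/aliveP; exists u; split=> //; rewrite size_rcons ltnW.
have guk : g u != g k.
  apply/eqP => e1; have := cd_inj hc (i := u) (j := k); rewrite size_rcons e1.
  by move=> /(_ (leqW hu) (leqnn _) erefl) e2; rewrite e2 eqxx in uk.
rewrite (sweight_leaf kA uA guk).
  rewrite Ak IH //.
  have -> : alive p K :\ g u = alive p (fun v => K v || (v == u)).
    apply/setP => x; rewrite in_setD1; apply/andP/aliveP.
      case=> ne /aliveP[j [h1 h2 h3]]; exists j; split=> //.
      rewrite negb_or h2; apply: contraNneq ne => e1.
      by rewrite -h3 e1.
    case=> j [h1]; rewrite negb_or => /andP[h2 h3] h4; split; last by apply/aliveP; exists j.
    apply/eqP => e1; have := cd_inj hp (i := j) (j := u); rewrite h4 e1 => /(_ h1 hu erefl) e2.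
    by rewrite e2 eqxx in h3.
  rewrite IH //.
  (* Here [vstep valive valive] = (24, -10) = 2 (8, -5) + 8 (1, 0), the leaf recursion in vector
     form. *)
  rewrite [RHS](@elim_value_ext p _ (fupd (valive_but K) u (comb 2 valive 8 vdead))) //; last first.
    move=> v hv; rewrite /fupd; case: eqP => // _; rewrite /valive_but (negbTE Ku) (negbTE Kk).
    by rewrite /vstep /comb /vdead /valive /=; congr (_, _); field.
  rewrite elim_value_lin //; congr (_ * _ + _ * _); apply: elim_value_ext => // v hv.
    by rewrite /fupd; case: eqP => // ->; rewrite /valive_but (negbTE Ku).
  by rewrite /fupd /valive_but; case: eqP => [->|_]; rewrite ?orbT ?orbF.
move=> w /aliveP[j [h1 h2 <-]].
move: h1; rewrite size_rcons leq_eqVlt => /orP[/eqP ->|].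
  by rewrite eirr eq_sym (negbTE guk).
rewrite ltnS => hj; rewrite adj // eq_sym; apply/eqP/eqP => [->//|e1].
by apply: (cd_inj hp).
Qed.

Lemma solvability_coded p : coded p -> #|V| = (size p).+1 ->
  (solvability e)%:R = elim_value p (fun _ => valive).
Proof.
move=> hc hV; rewrite solvabilityE // -(@elim_value_ext p (valive_but pred0)) //; last exact: cd_wf hc.
rewrite -solv_elim //.
have -> : alive p pred0 = setT.
  apply/eqP; rewrite eqEcard subsetT cardsT hV.
  have -> : alive p pred0 = [set g (val j) | j : 'I_(size p).+1].
    apply/setP => x; apply/aliveP/imsetP => [[j [h1 _ <-]]|[j _ ->]].
      by have hj : (j < (size p).+1)%N by []; exists (Ordinal hj).
    by exists j; split=> //; rewrite -ltnS.
  rewrite card_in_imset ?card_ord ?ltnSn // => i j _ _ h; apply: val_inj.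
  by apply: (cd_inj hc) h; rewrite -ltnS; exact: ltn_ord.
by rewrite /sweight cardsT mulfK // expf_neq0.
Qed.

End Coded.

(** * From parent lists to weighted trees *)

Definition mk_branch (l : seq wtree) : wtree := if l is [::] then Leaf false (2 / 3) else Node l.
Definition tstep (a b : seq wtree) : seq wtree := mk_branch b :: a.
Definition tvec (l : seq wtree) : vec :=
  (8 * (3 ^+ size (lleaves l) * pwt l), - 5 * (3 ^+ size (lleaves l) * pwt l * prho l)).

(** [tvec] turns tree building into vector elimination, so both runs of [elim] stay parallel. A
    childless vertex is the separate case: it becomes a leaf of ratio 2/3, and its factor 3 goes to
    the power of 3. *)
Lemma tvec_step a b : pos1 (lleaves b) -> vstep (tvec a) (tvec b) = tvec (tstep a b).
Proof.
move=> hb; rewrite /tstep; case: b hb => [|t b] hb.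
  rewrite /tvec /vstep lleaves_cons size_cat [size (lleaves [:: mk_branch _])]/= pwt_cons prho_cons.
  rewrite [lleaves [::]]/= pwt_nil prho_nil rho_Leaf wt_Leaf expr0 addnC exprD expr1 /=.
  by congr (_, _); field.
rewrite [mk_branch _]/=; move: (t :: b) hb => {t}b hb.
have hn := den_neq0 hb.
rewrite /tvec /vstep lleaves_cons size_cat [lleaves [:: Node b]]cats0 -/(lleaves b).
rewrite pwt_cons prho_cons rho_Node wt_Node exprD /mobius /=.
by congr (_, _); field.
Qed.

Lemma mk_branch_pos1 b : pos1 (lleaves b) -> pos1 (lleaves [:: mk_branch b]).
Proof. by case: b => // t b; rewrite [lleaves [:: mk_branch _]]cats0. Qed.

Lemma elim_tvec k p phi psi :
  (forall v, phi v = tvec (psi v)) -> (forall v, pos1 (lleaves (psi v))) ->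
  forall v, elim vstep k p phi v = tvec (elim tstep k p psi v) /\
    pos1 (lleaves (elim tstep k p psi v)).
Proof.
move=> h1 h2; elim: p k => [|u p IH] k v //=; rewrite /fupd.
case: eqP => _ //; have [e1 q1] := IH k.+1 u; have [e2 q2] := IH k.+1 k.
rewrite e1 e2 tvec_step //; split=> //.
by rewrite /tstep lleaves_cons pos1_cat mk_branch_pos1.
Qed.

Definition rose (p : seq nat) : seq wtree := elim tstep 1 p (fun _ => [::]) 0%N.

Lemma elim_value_rose p : elim_value p (fun _ => valive) =
  3 ^+ size (lleaves (rose p)) * wt (Node (rose p)).
Proof.
have [|//|e _] := @elim_tvec 1 p (fun _ => valive) (fun _ => [::]) _ _ 0%N.
  move=> _; rewrite /tvec /valive /lleaves /= pwt_nil prho_nil expr0; congr (_, _); ring.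
rewrite /elim_value e wt_Node /tvec -/(rose p) /=; ring.
Qed.

Lemma rose_leaves p : all (pred1 (false, 2 / 3)) (lleaves (rose p)).
Proof.
suff h : forall k v, all (pred1 (false, 2 / 3)) (lleaves (elim tstep k p (fun _ => [::]) v)).
  exact: h.
elim: p => [|u p IH] k v //=; rewrite /fupd; case: eqP => _; last exact: IH.
rewrite /tstep lleaves_cons all_cat IH andbT.
have := IH k.+1 k; case: (elim _ _ _ _ _) => [|t b] //=.
by rewrite [lleaves [:: Node _]]cats0.
Qed.

Lemma count_ldegs_branch a l : count a (ldegs [:: mk_branch l]) =
  ((0 < size l) * a (size l).+1 + count a (ldegs l))%N.
Proof. by case: l => // t l; rewrite /ldegs /= cats0 mul1n. Qed.

Lemma wf_lt p x : wf p -> x \in p -> (x < size p)%N.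
Proof. by move=> hp /(nthP 0%N)[i hi <-]; exact: leq_ltn_trans (hp i hi) hi. Qed.

Lemma sum_pred1_nat (m n u X : nat) : (m <= u < n)%N ->
  (\sum_(m <= v < n) (v == u) * X = X)%N.
Proof.
move=> h; rewrite -big_distrl /= (bigD1_seq u) ?iota_uniq ?mem_index_iota //=.
by rewrite eqxx big1 ?addn0 ?mul1n // => i /negbTE ->.
Qed.

(** General initial lists are needed because removing the last vertex changes the list at its
    parent. The factor [0 < ...] discards the vertices that become leaves. *)
Lemma elim_rose p (psi : nat -> seq wtree) : wf p ->
  size (elim tstep 1 p psi 0%N) = (count_mem 0%N p + size (psi 0%N))%N /\
  forall a : pred nat, count a (ldegs (elim tstep 1 p psi 0%N)) =
    (\sum_(0 <= v < (size p).+1) count a (ldegs (psi v)) +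
     \sum_(1 <= v < (size p).+1)
       (0 < count_mem v p + size (psi v)) * a (count_mem v p + size (psi v)).+1)%N.
Proof.
elim/last_ind: p psi => [|p u IH] psi.
  by move=> _; split=> // a; rewrite big_nat1 big_geq // addn0.
move=> h; have [hp hu] := wf_rcons h; set k := (size p).+1.
rewrite elim_rcons add1n -/k.
have [IH1 IH2] := IH (fupd psi u (tstep (psi u) (psi k))) hp.
have uk : (u == k) = false by apply/ltn_eqF.
split=> [|a].
  rewrite IH1 -cats1 count_cat /= /fupd addn0 eq_sym.
  by case: eqP => [->|_] /=; rewrite ?addn0 // -addnA add1n.
rewrite IH2 size_rcons [in RHS]big_nat_recr //= [X in _ = (_ + X)%N]big_nat_recr //= -/k.
have ck : count_mem k p = 0%N.
  by apply/count_memPn; apply/negP => /(wf_lt hp); rewrite ltnNge leqnSn.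
have e1 : (\sum_(0 <= v < k) count a (ldegs (fupd psi u (tstep (psi u) (psi k)) v)) =
   \sum_(0 <= v < k) count a (ldegs (psi v)) + count a (ldegs [:: mk_branch (psi k)]))%N.
  rewrite -[X in _ = (_ + X)%N](@sum_pred1_nat 0 k u) ?ltnS // -big_split /=.
  apply: eq_big_nat => v _; rewrite /fupd; case: eqP => [->|_]; last by rewrite mul0n addn0.
  by rewrite /tstep ldegs_cons count_cat mul1n addnC.
have e2 v : (v < k)%N -> (count_mem v p + size (fupd psi u (tstep (psi u) (psi k)) v) =
    count_mem v (rcons p u) + size (psi v))%N.
  move=> hv; rewrite -cats1 count_cat /= addn0 /fupd eq_sym.
  by case: eqP => [->|_] /=; rewrite ?addn0 // -addnA add1n.
rewrite e1 count_ldegs_branch -cats1 count_cat ck /= uk !add0n.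
pose f v := (count_mem v p + size (fupd psi u (tstep (psi u) (psi k)) v))%N.
pose f' v := (count_mem v (rcons p u) + size (psi v))%N.
have -> : (\sum_(1 <= v < k) (0 < f v) * a (f v).+1 = \sum_(1 <= v < k) (0 < f' v) * a (f' v).+1)%N.
  by apply: eq_big_nat => v /andP[_ hv]; rewrite /f e2.
rewrite cats1; set S1 := (\sum_(_ <= _ < _) _)%N; set S2 := (\sum_(_ <= _ < _) _)%N.
move: S1 S2 => S1 S2; clear; lia.
Qed.

(** * Degrees of coded graphs *)

Definition degs (p : seq nat) : seq nat :=
  [seq (count_mem v p + (0 < v))%N | v <- iota 0 (size p).+1].

Lemma degsE p : degs p = count_mem 0%N p :: [seq (count_mem v p).+1 | v <- iota 1 (size p)].
Proof.
rewrite /degs /= addn0; congr (_ :: _); apply/eq_in_map => v.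
by rewrite mem_iota => /andP[-> _]; rewrite addn1.
Qed.

(** A class always lists the degree of the root, so the root must not be a leaf if the reduced
    degrees are to come out. *)
Lemma rose_in_class p : wf p -> (1 < count_mem 0%N p)%N ->
  in_class [seq d <- degs p | (2 <= d)%N]
    (typed (nseq (size (lleaves (rose p))) (2 / 3)) [::]) (rose p).
Proof.
move=> hp h0; have [h1 h2] := elim_rose (fun _ => [::]) hp.
apply/andP; split; last first.
  by rewrite /typed cats0 map_nseq; have /all_pred1P <- := rose_leaves p.
apply/permP => a; rewrite degsE /= h0 /= -/(rose p) h2 /rose h1 addn0; congr (_ + _)%N.
rewrite big1 ?add0n; last by [].
have -> : index_iota 1 (size p).+1 = iota 1 (size p) by rewrite /index_iota subSS subn0.
elim: (iota 1 (size p)) => [|v s IH]; first by rewrite big_nil.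
rewrite big_cons IH /= addn0 ltnS; case: (0 < count_mem v p)%N => /=; last by rewrite mul0n.
by rewrite mul1n.
Qed.

Lemma size_degs p : size (degs p) = (size p).+1.
Proof. by rewrite size_map size_iota. Qed.

Lemma rdegE p i : wf p -> (i <= size p)%N -> rdeg p i = (count_mem i p + (0 < i))%N.
Proof.
move=> hp hi; rewrite /rdeg /nbrs size_filter.
have e1 : count (fun j => (0 < i)%N && (nth 0%N p i.-1 == j)) (iota 0 (size p).+1) = (0 < i)%N.
  case: i hi => [|i] hi; first by rewrite (eq_count (a2 := pred0)) ?count_pred0.
  rewrite -[RHS](_ : nat_of_bool (nth 0%N p i \in iota 0 (size p).+1) = _).
    rewrite -(count_uniq_mem _ (iota_uniq _ _)); apply: eq_count => j.
    by rewrite /= eq_sym.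
  by rewrite mem_iota /= add0n ltnS (leq_trans (hp i hi)) // ltnW.
have e2 : count (fun j => (0 < j)%N && (nth 0%N p j.-1 == i)) (iota 0 (size p).+1) = count_mem i p.
  have hm : count_mem i p = count_mem i (mkseq (nth 0%N p) (size p)) by rewrite mkseq_nth.
  by rewrite hm /mkseq /= add0n (iotaDl 1 0) !count_map; apply: eq_count => j.
rewrite -e1 -{1}e2 addnC -count_predUI [X in (_ + X)%N](eq_in_count (a2 := pred0)) ?count_pred0 ?addn0.
  by apply: eq_count => j /=; rewrite /radj orbC.
move=> j; rewrite mem_iota add0n => /andP[_ hj] /=; apply/negP.
case/andP=> /andP[i0 /eqP p1] /andP[j0 /eqP p2].
have := hp i.-1; rewrite p1 prednK // => /(_ hi) q1.
have := hp j.-1; rewrite p2 prednK // => /(_ hj) q2.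
move: q1 q2 i0 j0; clear; lia.
Qed.

Section Degrees.

Variables (V : finType) (e : rel V) (g : nat -> V) (p : seq nat).
Hypothesis esym : symmetric e.
Hypothesis eirr : irreflexive e.
Hypothesis hc : coded e g p.

Lemma coded_radj i j : (i <= size p)%N -> (j <= size p)%N -> e (g i) (g j) = radj p i j.
Proof.
move=> hi hj; have hp := cd_wf hc; rewrite /radj.
have [ij|ji|->] := ltngtP i j.
- have j0 : (0 < j)%N by apply: leq_ltn_trans ij.
  rewrite esym (cd_adj hc) // j0 /= orb_idr // => /andP[i0 /eqP h].
  have := hp i.-1; rewrite prednK // h => /(_ hi); move: ij i0; clear; lia.
- have i0 : (0 < i)%N by apply: leq_ltn_trans ji.
  rewrite (cd_adj hc) // i0 /= orb_idl // => /andP[j0 /eqP h].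
  have := hp j.-1; rewrite prednK // h => /(_ hj); move: ji j0; clear; lia.
rewrite eirr orbb; symmetry; apply/negP => /andP[j0 /eqP h].
have := hp j.-1; rewrite prednK // h => /(_ hj); move: j0; clear; lia.
Qed.

Hypothesis hV : #|V| = (size p).+1.

Lemma coded_enum : perm_eq (enum V) (map g (iota 0 (size p).+1)).
Proof.
have hu : uniq (map g (iota 0 (size p).+1)).
  rewrite map_inj_in_uniq ?iota_uniq // => i j; rewrite !mem_iota !add0n => hi hj.
  exact: (cd_inj hc).
have sub : {subset map g (iota 0 (size p).+1) <= enum V} by move=> x _; rewrite mem_enum.
have [|_ h] := uniq_min_size hu sub.
  by rewrite -cardE hV size_map size_iota.
by rewrite perm_sym; apply: uniq_perm => //; exact: enum_uniq.
Qed.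

Lemma coded_degree i : (i <= size p)%N -> degree e (g i) = (count_mem i p + (0 < i))%N.
Proof.
move=> hi; rewrite -(rdegE (cd_wf hc) hi) /degree /rdeg /nbrs size_filter.
rewrite cardsE cardE /enum_mem size_filter -enumT.
have /permP -> := coded_enum; rewrite count_map; apply: eq_in_count => j.
rewrite mem_iota => /andP[_ hj]; rewrite /= -coded_radj //.
Qed.

Lemma coded_degs : perm_eq [seq degree e v | v : V] (degs p).
Proof.
apply: perm_trans (perm_map _ coded_enum) _; rewrite -map_comp.
apply/permP => a; rewrite !count_map; apply: eq_in_count => i.
by rewrite mem_iota => /andP[_ hi] /=; rewrite coded_degree.
Qed.

End Degrees.

Lemma coded_graph_of p : wf p ->
  coded (graph_of p) (fun i => inord i : 'I_(size p).+1) p.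
Proof.
move=> hp; split=> //.
  by move=> i j hi hj /(congr1 val); rewrite /= !inordK.
move=> i j ji hi; rewrite /graph_of !inordK //; last by rewrite ltnS (leq_trans (ltnW ji)).
have i0 : (0 < i)%N by apply: leq_ltn_trans ji.
rewrite /radj i0 /= orb_idl // => /andP[j0 /eqP h].
have := hp j.-1; rewrite prednK // h => /(_ (leq_trans (ltnW ji) hi)); move: ji j0; clear; lia.
Qed.

Lemma graph_of_sym p : symmetric (graph_of p).
Proof. by move=> i j; rewrite /graph_of /radj orbC. Qed.

Lemma graph_of_irr p : wf p -> irreflexive (graph_of p).
Proof.
move=> hp i; rewrite /graph_of /radj orbb; apply/negP => /andP[i0 /eqP h].
have := hp i.-1; rewrite prednK // h -ltnS => /(_ (ltn_ord i)); move: i0; clear; lia.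
Qed.

(** Following parents leads to 0. On a cycle, both neighbours of the largest vertex are smaller,
    hence both equal to its parent. *)
Lemma graph_of_tree p : wf p -> is_tree (graph_of p).
Proof.
move=> hp; split.
- by split; [exact: graph_of_sym | exact: graph_of_irr].
- by rewrite card_ord.
- have c0 (i : 'I_(size p).+1) : connect (graph_of p) i ord0.
    case: i => i; elim/ltn_ind: i => i IH hi.
    have [i0|i0] := posnP i; first by rewrite (_ : Ordinal hi = ord0) ?connect0 //; exact: val_inj.
    have h1 : (nth 0%N p i.-1 < i)%N.
      by have := hp i.-1; rewrite prednK // => /(_ hi); move: i0; clear; lia.
    have h2 := ltn_trans h1 hi.
    apply: connect_trans (IH _ h1 h2); apply: connect1.
    by rewrite /graph_of /radj /= i0 eqxx orbT.
  move=> i j; apply: connect_trans (c0 i) _.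
  by rewrite (sym_connect_sym (@graph_of_sym p)); exact: c0.
move=> c hc; apply/negP => /andP[cyc uc].
have [v vc vm] : exists2 v, v \in c & forall w, w \in c -> (w <= v)%N.
  move: hc; case: c {cyc uc} => // x c _.
  case: (@arg_maxnP _ x (fun i => i \in x :: c) val) => [|v vc h]; first exact: mem_head.
  by exists v => // w hw; exact: h.
have [i s hs] := rot_to vc.
have sz : (2 < size (v :: s))%N by rewrite -hs size_rot.
have us : uniq (v :: s) by rewrite -hs rot_uniq.
have cs : cycle (graph_of p) (v :: s) by rewrite -hs rot_cycle.
have par w : w \in s -> graph_of p v w -> val w = nth 0%N p v.-1.
  move=> ws; have wv : (w < v)%N.
    rewrite ltn_neqAle vm; last by rewrite -(mem_rot i) hs inE ws orbT.
    rewrite andbT; apply: contraTneq ws => /val_inj ->.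
    by case/andP: us.
  rewrite /graph_of /radj => /orP[/andP[w0 /eqP h]|/andP[_ /eqP ->]] //.
  have := hp w.-1; rewrite prednK // h -ltnS => /(_ (ltn_ord w)); move: wv w0; clear; lia.
case: s hs sz us cs par => [|x s] // hs; case/lastP: s hs => // s y hs _ us cs par.
have ex : val x = nth 0%N p v.-1.
  by apply: par; rewrite ?mem_head //; move: cs; rewrite /= => /andP[].
have ey : val y = nth 0%N p v.-1.
  apply: par; first by rewrite inE mem_rcons mem_head orbT.
  move: cs; rewrite /= rcons_path last_rcons => /andP[_ /andP[_ h]].
  by rewrite graph_of_sym.
have exy : x = y by apply: val_inj; rewrite ex ey.
by move: us; rewrite /= exy mem_rcons mem_head /= andbF.
Qed.

Local Close Scope ring_scope.

(** * Coding a tree by a parent list *)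

Section Ordering.

Variables (V : finType) (e : rel V).
Hypothesis tree : is_tree e.

Let esym : symmetric e. Proof. by case: tree => -[]. Qed.

Definition within (vs : seq V) : rel V := [rel x y | [&& x \in vs, y \in vs & e x y]].

Lemma path_within vs x s : path (within vs) x s -> path e x s /\ {subset s <= vs}.
Proof.
elim: s x => [|y s IH] x //= /andP[/and3P[_ yvs exy] /IH[h1 h2]].
by split=> [|z]; rewrite ?exy // inE => /predU1P[->|/h2].
Qed.

(* A second edge from w to the connected set vs would close a cycle. *)
Lemma unique_nbr vs u a w : {in vs &, forall x y, connect (within vs) x y} ->
  u \in vs -> a \in vs -> w \notin vs -> e w u -> e w a -> a = u.
Proof.
move=> hc uvs avs wvs ewu ewa; apply/eqP/negPn/negP => au.
have /connectP[s hs ea] := hc u a uvs avs.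
case/shortenP: hs ea => s' hs' us' _ ea.
have [pe sub] := path_within hs'.
have [_ _ _ /(_ (w :: u :: s'))] := tree.
case: s' hs' us' ea pe sub => [|y s'] hs' us' ea pe sub.
  by rewrite ea /= eqxx in au.
move=> /(_ isT)/negP; apply; apply/andP; split; last first.
  rewrite cons_uniq us' andbT; apply: contra wvs; rewrite inE => /predU1P[->//|]; exact: sub.
by move: ea pe => /= ea pe; case/andP: pe => euy pe; rewrite /= rcons_path ewu euy pe -ea esym.
Qed.

Lemma grow vs x0 : x0 \in vs -> uniq vs -> size vs < #|V| ->
  exists u w, [/\ u \in vs, w \notin vs & e u w].
Proof.
move=> x0vs uvs hs.
have [/existsP[u /existsP[w /and3P[h1 h2 h3]]]|hn] :=
  boolP [exists u, exists w, [&& u \in vs, w \notin vs & e u w]].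
  by exists u, w.
have cl : closed e (mem vs).
  have h u w : e u w -> u \in vs -> w \in vs.
    move=> euw uv; apply: contraNT hn => wv; apply/existsP; exists u.
    by apply/existsP; exists w; rewrite uv wv.
  by move=> u w euw; apply/idP/idP; apply: h; rewrite // esym.
have [z zvs] : exists z, z \notin vs.
  apply/existsP; rewrite -negb_forall; apply/negP => /forallP h.
  have : #|V| <= #|vs| by apply: subset_leq_card; apply/subsetP => z _; exact: h.
  by rewrite (card_uniqP uvs) leqNgt hs.
have [_ _ /(_ x0 z)/(closed_connect cl) h _] := tree.
by rewrite -h /= x0vs in zvs.
Qed.

(** The list grows by one adjacent vertex at a time. Connectivity inside the list is carried along,
    because [unique_nbr] needs a path that avoids the new vertex. *)
Lemma ordering x0 : exists g p, [/\ coded e g p, #|V| = (size p).+1 & g 0 = x0].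
Proof.
suff [vs [p [h1 h2 h3 h4 h5]]] : exists vs p, [/\ coded e (nth x0 vs) p,
    size vs = (size p).+1, nth x0 vs 0 = x0, uniq vs & size vs = #|V|].
  by exists (nth x0 vs), p; rewrite -h5.
suff : forall n, 0 < n -> n <= #|V| -> exists vs p,
    [/\ coded e (nth x0 vs) p, size vs = (size p).+1, nth x0 vs 0 = x0, uniq vs & size vs = n] /\
    {in vs &, forall x y, connect (within vs) x y}.
  have [_ h0 _ _] := tree; move=> /(_ _ h0 (leqnn _))[vs [p [h _]]].
  by exists vs, p.
elim=> // -[_ _ _|n IH _ hn].
  exists [:: x0], [::]; split; last first.
    by move=> x y; rewrite !inE => /eqP -> /eqP ->; exact: connect0.
  split=> //; split=> //; last by case.
  by move=> i j; rewrite !leqn0 => /eqP -> /eqP ->.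
have [vs [p [[hc sp x0E uvs svs] hcon]]] := IH isT (ltnW hn).
have x0vs : x0 \in vs by rewrite -x0E mem_nth // svs.
have [|u [w [h1 h2 h3]]] := grow x0vs uvs; first by rewrite svs.
exists (rcons vs w), (rcons p (index u vs)); split.
  split; [|by rewrite !size_rcons sp|by rewrite nth_rcons svs|by rewrite rcons_uniq h2|by rewrite size_rcons svs].
  split.
  - move=> i; rewrite size_rcons ltnS leq_eqVlt nth_rcons => /orP[/eqP ->|hi].
      by rewrite ltnn eqxx -ltnS -sp index_mem.
    by rewrite hi; exact: (cd_wf hc).
  - move=> i j; rewrite size_rcons -sp => hi hj h; apply/eqP.
    by rewrite -(nth_uniq x0 (s := rcons vs w)) ?size_rcons ?ltnS ?h // rcons_uniq h2.
  move=> i j ji; rewrite size_rcons -sp leq_eqVlt => /orP[/eqP ei|hi].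
    rewrite ei in ji *; rewrite !nth_rcons ltnn eqxx ji sp /= ltnn eqxx.
    apply/idP/eqP => [ewj|<-]; last by rewrite nth_index // esym.
    have -> : u = nth x0 vs j.
      by symmetry; apply: (unique_nbr hcon h1 _ h2) => //; [exact: mem_nth | rewrite esym].
    by rewrite index_uniq.
  rewrite !nth_rcons hi (ltn_trans ji hi) (cd_adj hc) //; last by rewrite -ltnS -sp.
  by have -> : i.-1 < size p by move: ji hi; rewrite sp; case: (i).
have sub : subrel (connect (within vs)) (connect (within (rcons vs w))).
  apply: connect_sub => x y /and3P[k1 k2 k3]; apply: connect1.
  by rewrite /within /= !mem_rcons !inE k1 k2 k3 !orbT.
have wsym : connect_sym (within (rcons vs w)).
  by apply: sym_connect_sym => x y; rewrite /within /= esym andbCA.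
have cw x : x \in vs -> connect (within (rcons vs w)) x w.
  move=> xvs; apply: connect_trans (sub _ _ (hcon x u xvs h1)) _; apply: connect1.
  by rewrite /within /= !mem_rcons !inE h1 eqxx orbT h3.
move=> x y; rewrite !mem_rcons !inE => /predU1P[->|xv] /predU1P[->|yv].
- exact: connect0.
- by rewrite wsym cw.
- exact: cw.
- by apply: sub; exact: hcon.
Qed.

End Ordering.

(** * The code of the M-tree *)

(* Numbers k, k+1, ... are cut into blocks; (c, e) is the star with e vertices
   c, ..., c+e-1 and centre c. *)
Fixpoint blocks (k : nat) (es : seq nat) : seq (nat * nat) :=
  if es is e :: es' then (k, e) :: blocks (k + e) es' else [::].

Definition in_block (b : nat * nat) w := b.1 <= w < b.1 + b.2.

Fixpoint stars_code (u k : nat) (es : seq nat) : seq nat :=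
  if es is e :: es' then u :: nseq e.-1 k ++ stars_code u (k + e) es' else [::].

Lemma joinE es : all (leq 1) es -> join [seq star e | e <- es] = stars_code 0 1 es.
Proof.
rewrite /join; have -> : stars_code 0 1 es = [::] ++ stars_code 0 (size (@nil nat)).+1 es by [].
elim: es [::] => [|e es IH] p /=; first by rewrite cats0.
case/andP=> e1 h; rewrite IH //.
have -> : graft (rcons p 0) (size p).+1 (star e) = p ++ 0 :: nseq e.-1 (size p).+1.
  by rewrite /graft /star map_nseq /= cat_rcons.
by rewrite size_cat /= size_nseq prednK // -catA addSn.
Qed.

Lemma stars_code_map u m k es : 0 < k ->
  [seq if w == 0 then u else m + w | w <- stars_code 0 k es] = stars_code u (m + k) es.
Proof.
elim: es k => //= e es IH k k0; rewrite map_cat map_nseq IH ?addn_gt0 ?k0 //.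
by rewrite gtn_eqF // addnA.
Qed.

Lemma size_stars_code u k es : all (leq 1) es -> size (stars_code u k es) = sumn es.
Proof.
elim: es k => //= e es IH k /andP[e1 h].
by rewrite size_cat size_nseq IH // -addSn prednK.
Qed.

Lemma blocks_bounds k es (b : nat * nat) : b \in blocks k es ->
  [/\ k <= b.1, b.1 + b.2 <= k + sumn es & b.2 \in es].
Proof.
elim: es k => //= e es IH k; rewrite inE => /predU1P[->|/IH[h1 h2 h3]] /=.
  by rewrite leqnn addnA leq_addr mem_head.
by rewrite (leq_trans (leq_addr _ _) h1) addnA h2 inE h3 orbT.
Qed.

Lemma blocks_cover k es w : k <= w < k + sumn es ->
  exists2 b : nat * nat, b \in blocks k es & in_block b w.
Proof.
elim: es k => /= [|e es IH] k; first by rewrite addn0 => h; exfalso; move: h; clear; lia.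
have [h|h] := ltnP w (k + e) => /andP[h1 h2].
  by exists (k, e); rewrite ?mem_head // /in_block h1.
have [|b bb hb] := IH (k + e); first by rewrite h -addnA.
by exists b => //; rewrite inE bb orbT.
Qed.

Lemma blocks_uniq k es (b b' : nat * nat) w : b \in blocks k es -> b' \in blocks k es ->
  in_block b w -> in_block b' w -> b = b'.
Proof.
have out k1 e es1 c : c \in blocks (k1 + e) es1 -> in_block (k1, e) w -> in_block c w -> False.
  case/blocks_bounds=> h1 _ _ /andP[_ h2] /andP[h3 _].
  by move: (leq_ltn_trans (leq_trans h1 h3) h2); rewrite ltnn.
elim: es k => //= e es IH k.
rewrite !inE => /predU1P[->|hb] /predU1P[->|hb'] // h h'.
- by case: (out _ _ _ _ hb' h h').
- by case: (out _ _ _ _ hb h' h).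
exact: (IH (k + e)).
Qed.

Lemma nth_stars_code u k es (b : nat * nat) w : all (leq 1) es -> b \in blocks k es -> in_block b w ->
  nth 0 (stars_code u k es) (w - k) = if w == b.1 then u else b.1.
Proof.
elim: es k => //= e es IH k /andP[e1 hes]; rewrite inE => /predU1P[->|hb] /andP[/= h1 h2].
  case: eqP => [->|/eqP ne]; first by rewrite subnn.
  have kw : k < w by rewrite ltn_neqAle eq_sym ne.
  rewrite -(prednK (_ : 0 < w - k)) ?subn_gt0 //= nth_cat size_nseq nth_nseq.
  have -> // : (w - k).-1 < e.-1 by move: kw h2 e1; clear; lia.
have [h3 _ _] := blocks_bounds hb.
have ke : k + e <= w by exact: leq_trans h1.
have -> : w - k = (e.-1 + (w - (k + e))).+1 by move: ke e1; clear; lia.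
rewrite /= nth_cat size_nseq ltnNge leq_addr /= addKn.
by apply: IH => //; apply/andP.
Qed.

Lemma count_stars_code v u k es : u < k -> v < k -> count_mem v (stars_code u k es) = (v == u) * size es.
Proof.
elim: es k => [|e es IH] k uk vk /=; first by rewrite muln0.
rewrite count_cat IH; try exact: ltn_addr.
rewrite (count_nseq (pred1 v)) /= (gtn_eqF vk) mul0n add0n mulnS eq_sym.
by case: (v == u); rewrite ?mul1n ?mul0n.
Qed.

Lemma mem_stars_code x u k es : x \in stars_code u k es -> x = u \/ exists2 b : nat * nat, b \in blocks k es & x = b.1.
Proof.
elim: es k => //= e es IH k; rewrite inE => /predU1P[->|]; first by left.
rewrite mem_cat => /orP[|/IH[->|[b hb ->]]]; [|by left|].
  by move=> /nseqP[-> _]; right; exists (k, e); rewrite ?mem_head.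
by right; exists b => //; rewrite inE hb orbT.
Qed.

Lemma map_snd_blocks k es : map snd (blocks k es) = es.
Proof. by elim: es k => //= e es IH k; rewrite IH. Qed.

Lemma sorted_fst_blocks k es : all (leq 1) es -> sorted ltn (map fst (blocks k es)).
Proof.
elim: es k => //= e es IH k /andP[e1 h].
rewrite (path_sortedE ltn_trans) IH // andbT.
apply/allP => x /mapP[b /blocks_bounds[h1 _ _] ->].
by move: h1 e1; rewrite /=; clear; lia.
Qed.

Lemma sorted_nbrs p v : sorted ltn (nbrs p v).
Proof. by apply: sorted_filter; [exact: ltn_trans | exact: iota_ltn_sorted]. Qed.

Lemma mem_nbrs p v w : (w \in nbrs p v) = (w <= size p) && radj p v w.
Proof. by rewrite mem_filter mem_iota add0n ltnS /= andbC. Qed.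

(** * Neighbours and degrees after attaching stars at a vertex *)

Section Attach.

Variables (p : seq nat) (u : nat) (es : seq nat).
Hypothesis hp : wf p.
Hypothesis hu : u <= size p.
Hypothesis hes : all (leq 1) es.
Let m := size p.
Let q := p ++ stars_code u m.+1 es.

Lemma size_attach : size q = m + sumn es.
Proof. by rewrite size_cat size_stars_code. Qed.

Lemma par_old w : 0 < w <= m -> nth 0 q w.-1 = nth 0 p w.-1.
Proof.
by move=> h; rewrite nth_cat; suff -> : w.-1 < size p by []; move: h; rewrite /m; clear; lia.
Qed.

Lemma par_new (b : nat * nat) w : b \in blocks m.+1 es -> in_block b w ->
  nth 0 q w.-1 = if w == b.1 then u else b.1.
Proof.
move=> hb hw; have [h1 _ _] := blocks_bounds hb; have /andP[h2 _] := hw.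
rewrite nth_cat -/m; have -> : (w.-1 < m) = false by apply/negbTE; rewrite -leqNgt; move: h1 h2; clear; lia.
have -> : w.-1 - m = w - m.+1 by clear; lia.
exact: nth_stars_code.
Qed.

Lemma new_block w : m < w -> w <= size q -> exists2 b : nat * nat, b \in blocks m.+1 es & in_block b w.
Proof. by rewrite size_attach => h1 h2; apply: blocks_cover; rewrite h1 addSn ltnS. Qed.

Lemma wf_attach : wf q.
Proof.
move=> i hi; have [him|him] := ltnP i m; first by rewrite nth_cat him; exact: hp.
have [|b hb hw] := @new_block i.+1 him; first by [].
have := par_new hb hw; rewrite /= => ->; have [h1 _ _] := blocks_bounds hb.
case: eqP => [_|ne]; first exact: leq_trans hu him.
by have /andP[h2 _] := hw; move: h2 ne; clear; lia.
Qed.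

Lemma radj_old v w : v <= m -> w <= m -> radj q v w = radj p v w.
Proof.
move=> hv hw; rewrite /radj; congr (_ || _).
  by case: (posnP w) => [->//|w0]; rewrite par_old // w0.
by case: (posnP v) => [->//|v0]; rewrite par_old // v0.
Qed.

Lemma par_le_old w : 0 < w <= m -> nth 0 q w.-1 < m.
Proof.
move=> h; rewrite par_old //; case/andP: h => w0 wm.
by apply: leq_ltn_trans (hp _) _; rewrite prednK.
Qed.

Lemma nbrs_old v : v <= m -> v != u -> nbrs q v = nbrs p v.
Proof.
move=> hv vu; apply: (irr_sorted_eq ltn_trans ltnn); try exact: sorted_nbrs.
move=> w; rewrite !mem_nbrs; have [wm|wm] := leqP w m.
  by rewrite radj_old // size_attach (leq_trans wm) ?leq_addr.
apply/negP => /andP[wq].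
have [b hb hw] := new_block wm wq; have [h1 _ _] := blocks_bounds hb.
case/orP=> /andP[w0].
  rewrite (par_new hb hw); case: (w =P b.1) => _; first by rewrite eq_sym (negbTE vu).
  by move=> /eqP e1; move: h1; rewrite e1 ltnNge hv.
by move=> /eqP e1; have := @par_le_old v; rewrite w0 hv e1 => /(_ isT); rewrite ltnNge ltnW.
Qed.

Lemma nbrs_start (b : nat * nat) : b \in blocks m.+1 es -> nbrs q b.1 = u :: iota b.1.+1 b.2.-1.
Proof.
move=> hb; have [h1 h2 h3] := blocks_bounds hb.
have b2 : 0 < b.2 by exact: (allP hes).
have bq : b.1 + b.2 <= (size q).+1 by rewrite size_attach -addSn.
have ub : u < b.1 by exact: leq_ltn_trans hu h1.
have inb : in_block b b.1 by rewrite /in_block leqnn -{1}[b.1]addn0 ltn_add2l.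
apply: (irr_sorted_eq ltn_trans ltnn); first exact: sorted_nbrs.
  rewrite /= (path_sortedE ltn_trans) iota_ltn_sorted andbT.
  by apply/allP => x; rewrite mem_iota => /andP[h _]; exact: ltn_trans ub h.
move=> w; rewrite mem_nbrs inE mem_iota.
have b0 : 0 < b.1 by exact: leq_ltn_trans ub.
rewrite {1}/radj b0 /= (par_new hb inb) eqxx.
have [->|wu] /= := eqVneq w u.
  by rewrite ?eqxx ?orbT ?andbT (leq_trans hu) // size_attach leq_addr.
rewrite orbF.
apply/andP/idP => [[wq /andP[w0 /eqP hw]]|hw].
  have wm : m < w.
    rewrite ltnNge; apply/negP => wm; have := @par_le_old w; rewrite w0 wm hw => /(_ isT).
    by rewrite ltnNge ltnW.
  have [c hc hcw] := new_block wm wq; have := par_new hc hcw; rewrite hw.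
  case: eqP => [_ e1|/eqP ne e1]; first by rewrite e1 ltnn in ub.
  have hc1 : in_block c c.1.
    have [_ _ c3] := blocks_bounds hc; rewrite /in_block leqnn -{1}[c.1]addn0 ltn_add2l.
    exact: (allP hes).
  have ebc : b = c by apply: (blocks_uniq hb hc inb); rewrite e1.
  move: hcw ne; rewrite -ebc /in_block; clear -b2; lia.
have inw : in_block b w by move: hw b2; rewrite /in_block; clear; lia.
split; first by move: inw bq; rewrite /in_block; clear; lia.
have w0 : 0 < w by move: hw; clear; lia.
have bw : b.1 < w by case/andP: hw.
by rewrite w0 (par_new hb inw) (gtn_eqF bw) eqxx.
Qed.

Lemma rdeg_start (b : nat * nat) : b \in blocks m.+1 es -> rdeg q b.1 = b.2.
Proof.
move=> hb; rewrite /rdeg nbrs_start //= size_iota prednK //.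
by have [_ _ h] := blocks_bounds hb; exact: (allP hes).
Qed.

Lemma rdeg_old v : v <= m -> rdeg q v = rdeg p v + (v == u) * size es.
Proof.
move=> hv; have vq : v <= size q by rewrite size_attach (leq_trans hv) ?leq_addr.
rewrite (rdegE wf_attach vq) (rdegE hp hv) /q count_cat count_stars_code ?ltnS //.
by rewrite addnAC.
Qed.

Lemma rdeg_inner (b : nat * nat) w : b \in blocks m.+1 es -> b.1 < w < b.1 + b.2 -> rdeg q w = 1.
Proof.
move=> hb hw; have [h1 h2 _] := blocks_bounds hb.
have wq : w <= size q by move: h2 hw; rewrite size_attach; clear; lia.
rewrite (rdegE wf_attach wq).
have -> : 0 < w by move: hw; clear; lia.
suff /count_memPn -> : w \notin q by [].
rewrite mem_cat; apply/norP; split; apply/negP.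
  by move=> /(wf_lt hp); rewrite -/m; move: h1 hw; clear; lia.
case/mem_stars_code=> [e1|[c hc e1]]; first by move: hu h1 hw; rewrite e1 -/m; clear; lia.
have [_ _ c3] := blocks_bounds hc; have c2 : 0 < c.2 by exact: (allP hes).
have e2 : b = c.
  apply: (@blocks_uniq m.+1 es b c w) => //; rewrite /in_block ?e1.
    by rewrite e1 in hw; move: hw; clear; lia.
  by move: c2; clear; lia.
by move: hw; rewrite e1 e2 ltnn.
Qed.

Lemma leaf_nbrs_start (b : nat * nat) : b \in blocks m.+1 es -> rdeg q u != 1 ->
  [seq w <- nbrs q b.1 | leaf q w] = iota b.1.+1 b.2.-1.
Proof.
move=> hb hl; rewrite nbrs_start //= {1}/leaf (negbTE hl); apply/all_filterP/allP => w.
rewrite mem_iota => hw; apply/eqP/(rdeg_inner hb).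
have [_ _ h3] := blocks_bounds hb; have : 0 < b.2 by exact: (allP hes).
by move: hw; clear; lia.
Qed.

Lemma leaf_old v : v <= m -> v != u -> leaf q v = leaf p v.
Proof. by move=> hv vu; rewrite /leaf rdeg_old // (negbTE vu) mul0n addn0. Qed.

Lemma degs_attach : perm_eq (degs q)
  ([seq rdeg p v + (v == u) * size es | v <- iota 0 m.+1] ++
   flatten [seq e :: nseq e.-1 1 | e <- es]).
Proof.
have -> : degs q = [seq rdeg q v | v <- iota 0 (size q).+1].
  apply/eq_in_map => v; rewrite mem_iota => /andP[_ hv].
  by rewrite (rdegE wf_attach).
rewrite size_attach -addSn iotaD map_cat add0n.
have -> : [seq rdeg q v | v <- iota 0 m.+1] =
    [seq rdeg p v + (v == u) * size es | v <- iota 0 m.+1].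
  by apply/eq_in_map => v; rewrite mem_iota => /andP[_ hv]; rewrite rdeg_old.
rewrite perm_cat2l.
have io k fs : all (leq 1) fs ->
    iota k (sumn fs) = flatten [seq b.1 :: iota b.1.+1 b.2.-1 | b <- blocks k fs].
  elim: fs k => //= e fs IH k /andP[e1 hf]; rewrite -IH // iotaD.
  by rewrite -{1}(prednK e1).
rewrite io // map_flatten -map_comp -[in X in perm_eq _ X](map_snd_blocks m.+1 es) -map_comp.
apply/permP => a; congr (count a (flatten _)); apply/eq_in_map => b hb /=.
rewrite rdeg_start //; congr (_ :: _).
have [_ _ h3] := blocks_bounds hb; have b2 : 0 < b.2 by exact: (allP hes).
apply: (@eq_from_nth _ 0); rewrite size_map size_iota ?size_nseq // => i hi.
rewrite (nth_map 0) ?size_iota // nth_iota // nth_nseq hi.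
by apply: (rdeg_inner hb); move: hi b2; clear; lia.
Qed.

End Attach.

(** * Value of a tree after attaching stars *)

Local Open Scope ring_scope.

(** The componentwise factor by which [vstep] multiplies the parent. *)
Definition message (b : vec) : vec := (b.1 + b.2, b.1 + 6 / 5 * b.2).

Definition vprod (I : Type) (s : seq I) (a : vec) (f : I -> vec) : vec :=
  (a.1 * \prod_(i <- s) (f i).1, a.2 * \prod_(i <- s) (f i).2).

Lemma vprod_nil I a (f : I -> vec) : vprod [::] a f = a.
Proof. by rewrite /vprod !big_nil !mulr1; case: a. Qed.

Lemma vprod_cons I i s a (f : I -> vec) :
  vprod (i :: s) a f = ((vprod s a f).1 * (f i).1, (vprod s a f).2 * (f i).2).
Proof. by rewrite /vprod !big_cons /=; congr (_, _); ring. Qed.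

Lemma elim_nseq k n c phi v : (c < k)%N -> elim vstep k (nseq n c) phi v =
  if v == c then vprod (iota k n) (phi c) (fun i => message (phi i)) else phi v.
Proof.
elim: n k v => [|n IH] k v ck /=; first by rewrite vprod_nil; case: eqP => [->|].
rewrite /fupd !IH ?leqW // eqxx (gtn_eqF ck).
case: eqP => // _; by rewrite vprod_cons.
Qed.

Definition starv (phi : nat -> vec) (b : nat * nat) : vec :=
  vprod (iota b.1.+1 b.2.-1) (phi b.1) (fun i => message (phi i)).

Lemma elim_stars_code u k es phi v : (u < k)%N -> all (leq 1) es -> (v < k)%N ->
  elim vstep k (stars_code u k es) phi v =
  if v == u then vprod (blocks k es) (phi u) (fun b => message (starv phi b)) else phi v.
Proof.
elim: es k v => [|e es IH] k v uk /=; first by rewrite vprod_nil; case: eqP => [->|].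
case/andP=> e1 hes vk.
have ke : (k.+1 + e.-1 = k + e)%N by rewrite addSnnS prednK.
rewrite elim_cat size_nseq ke.
have uke : (u < k + e)%N by exact: ltn_addr.
set g := elim vstep (k + e) _ phi.
have gE w : (w < k + e)%N -> w != u -> g w = phi w.
  by move=> hw wu; rewrite /g IH // (negbTE wu).
rewrite /fupd !elim_nseq // eqxx (ltn_eqF uk).
have -> : (v == k) = false by rewrite (ltn_eqF vk).
case: eqP => [_|/eqP vu]; last by rewrite gE // ltn_addr.
rewrite vprod_cons /g IH // eqxx -/g gE ?(gtn_eqF uk) //; last first.
  by rewrite -{1}[k]addn0 ltn_add2l.
rewrite /vstep /message /=; congr (_ * (_ + _), _ * (_ + _ * _));
  rewrite /starv /vprod /=; congr (_ * _); apply: eq_big_seq => i;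
  rewrite mem_iota ke => /andP[h1 h2]; rewrite gE // gtn_eqF //;
  exact: ltn_trans h1.
Qed.

(** The new vertices are eliminated before all old ones and only affect the vector of [u]; what
    remains is the elimination of [p]. *)
Lemma elim_value_attach p u es phi : wf p -> (u <= size p)%N -> all (leq 1) es ->
  elim_value (p ++ stars_code u (size p).+1 es) phi =
  elim_value p (fupd phi u (vprod (blocks (size p).+1 es) (phi u) (fun b => message (starv phi b)))).
Proof.
move=> hp hu hes; rewrite /elim_value elim_cat add1n.
rewrite (@elim_ext _ vstep p _ (fupd phi u (vprod (blocks (size p).+1 es) (phi u) (fun b => message (starv phi b))))) //.
by move=> v hv; rewrite elim_stars_code // /fupd.
Qed.

Lemma blocks_cat k a b : blocks k (a ++ b) = blocks k a ++ blocks (k + sumn a) b.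
Proof.
elim: a k => [|e a IH] k /=; first by rewrite addn0.
by rewrite IH addnA.
Qed.

Lemma blocks_shift m k es : [seq (m + w)%N | w <- map fst (blocks k es)] =
  map fst (blocks (m + k) es).
Proof. by elim: es k => //= e es IH k; rewrite IH addnA. Qed.

Lemma fst_blocks_nseq k n : map fst (blocks k (nseq n 1%N)) = iota k n.
Proof. by elim: n k => //= n IH k; rewrite IH addn1. Qed.

Lemma nbrs_stars_code es : all (leq 1) es -> nbrs (stars_code 0 1 es) 0 = map fst (blocks 1 es).
Proof.
move=> hes; apply: (irr_sorted_eq ltn_trans ltnn); first exact: sorted_nbrs.
  exact: sorted_fst_blocks.
have wn : wf [::] by [].
move=> w; rewrite mem_nbrs; apply/idP/mapP => [/andP[hw]|[b hb ->]].
  rewrite /radj /= orbF => /andP[w0 /eqP h].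
  have [b hb hbw] := @new_block [::] 0 es hes w w0 hw.
  have := @par_new [::] 0 es hes b w hb hbw; rewrite cat0s h.
  have [h1 _ _] := blocks_bounds hb.
  case: eqP => [->|_ e1]; first by exists b.
  by rewrite -e1 in h1.
have [h1 h2 h3] := blocks_bounds hb; have b2 : (0 < b.2)%N by exact: (allP hes).
have inb : in_block b b.1 by rewrite /in_block leqnn -{1}[b.1]addn0 ltn_add2l.
have := @par_new [::] 0 es hes b b.1 hb inb; rewrite cat0s eqxx => h.
rewrite size_stars_code // /radj h h1 eqxx /= andbT -ltnS.
by apply: leq_trans h2; rewrite -addn1 leq_add2l.
Qed.

(** The order among centres of equal degree is left open: only some rearrangement [bs] is asserted,
    whose degrees are nevertheless determined. *)
Lemma sorted_starts q k es : (forall b, b \in blocks k es -> rdeg q b.1 = b.2) ->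
  sorted geq es -> exists bs : seq (nat * nat), [/\ perm_eq bs (blocks k es),
    sort_by_degree q (map fst (blocks k es)) = map fst bs & map snd bs = rev es].
Proof.
move=> h sE.
exists (sort (relpre fst (fun u v => (rdeg q u <= rdeg q v)%N)) (blocks k es)); split.
- by rewrite perm_sort.
- by rewrite /sort_by_degree sort_map.
apply: (sorted_eq leq_trans anti_leq); last 1 first.
- rewrite perm_sym perm_rev -{1}(map_snd_blocks k es) perm_sym.
  by apply: perm_map; rewrite perm_sort.
- rewrite sorted_map; have := sort_sorted (leT := relpre fst (fun u v => (rdeg q u <= rdeg q v)%N)) _ (blocks k es).
  move=> /(_ (fun x y => leq_total _ _)).
  set s := sort _ _; have hs : {subset s <= blocks k es} by move=> b; rewrite mem_sort.
  move=> ss; apply: (sub_in_sorted (P := mem s) _ _ ss).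
    by move=> b c bs cs /=; rewrite !h //; exact: hs.
  exact/allP.
by rewrite rev_sorted.
Qed.

Definition inner (b : nat * nat) := iota b.1.+1 b.2.-1.

Lemma inner_uniq k es : all (leq 1) es -> uniq (flatten (map inner (blocks k es))) /\
  {in flatten (map inner (blocks k es)), forall x, (k < x < k + sumn es)%N}.
Proof.
elim: es k => //= e es IH k /andP[e1 hes]; have [u1 u2] := IH (k + e)%N hes.
split.
  rewrite cat_uniq iota_uniq u1 andbT; apply/hasPn => x /u2 hx.
  rewrite mem_iota; move: hx e1; rewrite /=; clear; lia.
move=> x; rewrite mem_cat => /orP[|/u2]; last by clear; lia.
rewrite mem_iota /=; move: e1; clear; lia.
Qed.

Lemma star_prods_flatten es (G : seq (seq rat)) W : map size G = map predn es ->
  star_prods es (flatten G ++ W) = map prodq G.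
Proof.
elim: es G => [|e es IH] [|g G] //= [h1 h2].
by rewrite /star_prods /= -h1 -catA take_size_cat // drop_size_cat // -[map prodq _]/(star_prods es _) IH.
Qed.

Lemma prodq_rev s : prodq (rev s) = prodq s.
Proof. by apply: prodq_perm; rewrite perm_rev. Qed.

Lemma rev_flatten (T : Type) (G : seq (seq T)) : rev (flatten G) = flatten (rev (map rev G)).
Proof.
elim: G => //= g G IH; rewrite rev_cat IH rev_cons -cats1 flatten_cat /= cats0 //.
Qed.

(** Labels increase with degree while [es] decreases, so reversing the list of slot ratios gives
    each star of [es] exactly its own leaves. *)
Lemma star_prods_inner es (bs : seq (nat * nat)) (wts : nat -> rat) W : map snd bs = rev es ->
  star_prods es (rev (map wts (flatten (map inner bs))) ++ W) =
  rev [seq prodq (map wts (inner b)) | b <- bs].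
Proof.
move=> h; rewrite map_flatten rev_flatten star_prods_flatten.
  rewrite map_rev -!map_comp; congr rev; apply: eq_map => b.
  by rewrite /= prodq_rev.
rewrite map_rev -!map_comp -[es]revK map_rev; congr rev.
rewrite -h -map_comp; apply: eq_map => b.
by rewrite /= size_rev size_map size_iota.
Qed.

Lemma star_leaves_inner es (bs : seq (nat * nat)) : map snd bs = rev es ->
  star_leaves es = size (flatten (map inner bs)).
Proof.
move=> h; rewrite size_flatten /shape -map_comp /star_leaves -(perm_sumn (permEl (perm_rev _))) -map_rev -h -map_comp.
by congr sumn; apply: eq_map => b /=; rewrite size_iota.
Qed.

(** The solution of [message] = (kap, kap wts): a vertex with this vector acts on its parent like a
    whole branch. Scale 3 and ratio 2/3 give back [valive]. *)
Definition slotv (kap wts : nat -> rat) v : vec :=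
  (kap v * (6 - 5 * wts v), kap v * (5 * wts v - 5)).

Definition fillv (s : seq nat) (kap wts : nat -> rat) v : vec :=
  if v \in s then slotv kap wts v else valive.

Lemma message_slotv kap wts v : message (slotv kap wts v) = (kap v, kap v * wts v).
Proof. by rewrite /message /slotv /=; congr (_, _); field. Qed.

Definition prodk (kap : nat -> rat) (s : seq nat) : rat := \prod_(v <- s) kap v.

Lemma prodk_cat kap s t : prodk kap (s ++ t) = prodk kap s * prodk kap t.
Proof. exact: big_cat. Qed.

Lemma message_starv phi (kap wts : nat -> rat) b : phi b.1 = valive ->
  (forall i, i \in inner b -> phi i = slotv kap wts i) ->
  let x := prodq (map wts (inner b)) in
  message (starv phi b) = (prodk kap (inner b) * (8 - 5 * x), prodk kap (inner b) * (8 - 6 * x)).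
Proof.
move=> h1 h2 x; rewrite /starv -/(inner b) h1 /vprod.
have -> : \prod_(i <- inner b) (message (phi i)).1 = prodk kap (inner b).
  by apply: eq_big_seq => i /h2 ->; rewrite message_slotv.
have -> : \prod_(i <- inner b) (message (phi i)).2 = prodk kap (inner b) * x.
  rewrite /x /prodq big_map /prodk -big_split.
  by apply: eq_big_seq => i /h2 ->; rewrite message_slotv.
by rewrite /message /valive /=; congr (_, _); field.
Qed.

Lemma star_prod es k (bs : seq (nat * nat)) phi kap wts W a :
  perm_eq bs (blocks k es) -> map snd bs = rev es ->
  (forall b, b \in bs -> phi b.1 = valive) ->
  (forall i, i \in flatten (map inner bs) -> phi i = slotv kap wts i) ->
  (forall i, i \in flatten (map inner bs) -> 0 < wts i <= 1) ->
  let xs := star_prods es (rev (map wts (flatten (map inner bs))) ++ W) in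
  let c := prodk kap (flatten (map inner bs)) * hprod xs in
  vprod (blocks k es) a (fun b => message (starv phi b)) =
  (a.1 * c, a.2 * (c * prodq (map mobius xs))).
Proof.
move=> hp hs h1 h2 h3 xs c.
have mem b i : b \in bs -> i \in inner b -> i \in flatten (map inner bs).
  by move=> hb hi; apply/flattenP; exists (inner b) => //; exact: map_f.
have e1 b : b \in bs -> message (starv phi b) =
    (prodk kap (inner b) * (8 - 5 * prodq (map wts (inner b))),
     prodk kap (inner b) * (8 - 6 * prodq (map wts (inner b)))).
  by move=> hb; apply: message_starv => [|i hi]; [exact: h1 | apply/h2/(mem b)].
have x1 b : b \in bs -> prodq (map wts (inner b)) <= 1.
  move=> hb; suff /andP[_ h] : 0 < prodq (map wts (inner b)) <= 1 by exact: h.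
  by apply: prodq01 => _ /mapP[i hi ->]; apply/h3/(mem b).
have xsE : xs = rev [seq prodq (map wts (inner b)) | b <- bs] by exact: star_prods_inner.
have eK : prodk kap (flatten (map inner bs)) = \prod_(b <- bs) prodk kap (inner b).
  rewrite /prodk; elim: (bs) => [|b s IH]; first by rewrite !big_nil.
  by rewrite /= big_cat big_cons IH.
have eH : hprod xs = \prod_(b <- bs) (8 - 5 * prodq (map wts (inner b))).
  by rewrite xsE /hprod (perm_big _ (permEl (perm_rev _))) /= big_map.
have eM : prodq (map mobius xs) = \prod_(b <- bs) mobius (prodq (map wts (inner b))).
  by rewrite xsE map_rev prodq_rev /prodq !big_map.
rewrite /vprod -!(perm_big _ hp); congr (_ * _, _ * _).
  by rewrite /c eK eH -big_split; apply: eq_big_seq => b /e1 ->.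
rewrite /c eK eH eM -!big_split; apply: eq_big_seq => b hb; rewrite e1 //=.
rewrite /mobius -mulrA; congr (_ * _).
rewrite mulrCA divff ?mulr1 // lt0r_neq0 // subr_gt0; have := x1 b hb; clear; lra.
Qed.

(** * The M-tree construction attains [mvalue] *)

Lemma map_fstP (s : seq (nat * nat)) (x : nat) :
  reflect (exists2 b : nat * nat, b \in s & x = b.1) (x \in map fst s).
Proof. exact: mapP. Qed.

(** Leaf positions ordered by the label they hang from, so that the first slot is where the next
    graft takes place. *)
Definition slots (p lab : seq nat) : seq nat :=
  flatten [seq [seq w <- nbrs p v | leaf p w] | v <- lab].

(* kap v is a scale factor and wts v the ratio of the branch put in the slot
   v. *)
Record minv (fuel : nat) (ds p lab : seq nat) : Prop := Minv {
  mi_wf : wf p;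
  mi_deg : perm_eq [seq d <- degs p | (2 <= d)%N] ds;
  mi_0 : 0%N \in lab;
  mi_lab : forall v, v \in lab -> (v <= size p)%N && ~~ leaf p v;
  mi_uniq : uniq (slots p lab);
  mi_size : (size (slots p lab) + 2 * size ds = sumn ds + 2)%N;
  mi_val : forall kap wts, (forall v, v \in slots p lab -> 0 < wts v <= 1) ->
    elim_value p (fillv (slots p lab) kap wts) =
    prodk kap (slots p lab) * mvalue fuel ds (rev (map wts (slots p lab)))
}.

Lemma star_leavesD (es : seq nat) : all (leq 2) es -> (star_leaves es + size es = sumn es)%N.
Proof.
by rewrite /star_leaves; elim: es => //= e es IH /andP[e2 /IH]; move: e2; clear; lia.
Qed.

Lemma all_leqW a b (es : seq nat) : (a <= b)%N -> all (leq b) es -> all (leq a) es.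
Proof. by move=> h; apply: sub_all => x; exact: leq_trans. Qed.

Lemma filter2_stars es : all (leq 2) es ->
  [seq d <- flatten [seq e :: nseq e.-1 1%N | e <- es] | (2 <= d)%N] = es.
Proof.
elim: es => //= e es IH /andP[e2 h]; rewrite e2 filter_cat IH //.
by rewrite (@eq_in_filter _ _ pred0) ?filter_pred0 // => x /nseqP[-> _].
Qed.

Lemma vprod_cat (I : Type) (s t : seq I) a (f : I -> vec) :
  vprod (s ++ t) a f = vprod t (vprod s a f) f.
Proof. by rewrite /vprod !big_cat /=; congr (_, _); rewrite mulrA. Qed.

(** The centre carries the first label, so its own leaves are the first slots. After reversal they
    come last, as the part that [mvalue] leaves over once the stars are filled. *)
Lemma mtree_base fuel ds d : (size ds <= d)%N -> sorted geq (rcons ds d) ->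
  all (leq 2) (rcons ds d) ->
  let p := join ([seq star e | e <- ds] ++ nseq (d - size ds) (star 1)) in
  let lab := 0%N :: sort_by_degree p [seq v <- iota 1 (size p) | ~~ leaf p v] in
  minv fuel.+1 (rcons ds d) p lab.
Proof.
(* Leaves of the centre are treated as one-vertex stars, so the whole tree is a single attachment to
   the one-vertex tree. *)
move=> hd sD ge2; set k := (d - size ds)%N; set es := ds ++ nseq k 1%N.
have [d2 ds2] : (2 <= d)%N /\ all (leq 2) ds by move: ge2; rewrite all_rcons => /andP[].
have ds1 : all (leq 1) ds by exact: all_leqW ds2.
have es1 : all (leq 1) es by rewrite all_cat ds1; apply/allP => x /nseqP[->].
have -> : join ([seq star e | e <- ds] ++ nseq k (star 1)) = stars_code 0 1 es.
  by rewrite -joinE // /es map_cat map_nseq.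
move=> p lab.
have wn : wf [::] by [].
have se : size es = d by rewrite size_cat size_nseq subnKC.
have hp : wf p := @wf_attach [::] 0 es wn isT es1.
have d0 : rdeg p 0 = d by have := @rdeg_old [::] 0 es wn isT es1 0 isT; rewrite cat0s mul1n se.
have n0 : rdeg p 0 != 1%N by rewrite d0; move: d2; clear; lia.
have rs (b : nat * nat) : b \in blocks 1 es -> rdeg p b.1 = b.2 := @rdeg_start [::] 0 es wn isT es1 b.
have ri (b : nat * nat) w : b \in blocks 1 es -> (b.1 < w < b.1 + b.2)%N -> rdeg p w = 1%N :=
  @rdeg_inner [::] 0 es wn isT es1 b w.
have sp : size p = sumn es by rewrite size_stars_code.
have bl : blocks 1 es = blocks 1 ds ++ blocks (1 + sumn ds) (nseq k 1%N) by exact: blocks_cat.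
have b2 (b : nat * nat) : b \in blocks 1 ds -> (2 <= b.2)%N.
  by case/blocks_bounds => _ _ /(allP ds2).
have nl : [seq v <- iota 1 (size p) | ~~ leaf p v] = map fst (blocks 1 ds).
  apply: (irr_sorted_eq ltn_trans ltnn).
  - by apply: sorted_filter; [exact: ltn_trans | exact: iota_ltn_sorted].
  - exact: sorted_fst_blocks.
  move=> w; rewrite mem_filter mem_iota sp; apply/andP/map_fstP => [[nlw hw]|[b hb ->]].
    have [b hb hbw] := blocks_cover hw.
    have eb : w = b.1.
      apply/eqP/negPn/negP => ne; case/negP: nlw; apply/eqP/(ri b) => //.
      by case/andP: hbw => h1 h2; rewrite h2 andbT ltn_neqAle eq_sym ne h1.
    move: hb; rewrite bl mem_cat => /orP[hb|hb]; first by exists b.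
    case/negP: nlw; rewrite /leaf eb rs ?bl ?mem_cat ?hb ?orbT //.
    by have [_ _ /nseqP[->]] := blocks_bounds hb.
  have hb' : b \in blocks 1 es by rewrite bl mem_cat hb.
  have [h1 h2 _] := blocks_bounds hb'; have h3 := b2 b hb; split.
    by rewrite /leaf rs //; move: h3; clear; lia.
  by move: h1 h2 h3; clear; lia.
have [||bs [p1 p2 p3]] := @sorted_starts p 1 ds.
- by move=> b hb; apply: rs; rewrite bl mem_cat hb.
- by move: sD; rewrite -cats1 => /cat_sorted2[].
have elab : lab = 0%N :: map fst bs by rewrite /lab nl p2.
pose A := iota (1 + sumn ds) k.
have bsb (b : nat * nat) : b \in bs -> b \in blocks 1 es by rewrite (perm_mem p1) bl mem_cat => ->.
have sl : slots p lab = A ++ flatten (map inner bs).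
  rewrite elab /slots /=; congr (_ ++ _).
    rewrite nbrs_stars_code // bl map_cat filter_cat fst_blocks_nseq.
    rewrite (@eq_in_filter _ _ pred0) ?filter_pred0 //=; last first.
      move=> w /map_fstP[b hb ->]; rewrite /leaf rs ?bl ?mem_cat ?hb //.
      by have := b2 b hb; clear; lia.
    apply/all_filterP/allP => w; rewrite -(fst_blocks_nseq _ k) => /map_fstP[b hb ->].
    rewrite /leaf rs ?bl ?mem_cat ?hb ?orbT //.
    by have [_ _ /nseqP[->]] := blocks_bounds hb.
  congr flatten; rewrite -map_comp; apply/eq_in_map => b hb /=.
  by have := @leaf_nbrs_start [::] 0 es wn isT es1 b (bsb b hb) n0.
have [iu ib] := @inner_uniq 1 ds ds1.
have pin : perm_eq (flatten (map inner bs)) (flatten (map inner (blocks 1 ds))).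
  by apply/perm_flatten/perm_map.
have vin_fst kap wts (b : nat * nat) : b \in bs -> fillv (slots p lab) kap wts b.1 = valive.
  move=> hb; rewrite /fillv ifN //; rewrite sl mem_cat negb_or.
  have hb' := bsb b hb; have h3 : (2 <= b.2)%N by apply: b2; rewrite -(perm_mem p1).
  apply/andP; split; apply/negP.
    have [_ h2 _] : [/\ (1 <= b.1)%N, (b.1 + b.2 <= 1 + sumn ds)%N & b.2 \in ds].
      by apply: blocks_bounds; rewrite -(perm_mem p1).
    by rewrite mem_iota; move: h2 h3; clear; lia.
  case/flattenP => _ /mapP[[c1 c2'] hc ->]; rewrite mem_iota => hi; set c : nat * nat := (c1, c2') in hc hi.
  have := ri c b.1 (bsb c hc); rewrite rs //.
  have c2 : (2 <= c.2)%N by apply: b2; rewrite -(perm_mem p1).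
  by move: hi c2 h3; clear; lia.
have sweight : size (slots p lab) = (k + star_leaves ds)%N.
  by rewrite sl size_cat size_iota (star_leaves_inner p3).
split.
- exact: hp.
- have := @degs_attach [::] 0 es wn isT es1; rewrite cat0s -/p => h.
  apply: perm_trans (perm_filter _ h) _.
  rewrite /= se add0n mul1n d2 /es map_cat flatten_cat filter_cat filter2_stars //.
  rewrite map_nseq (@eq_in_filter _ _ pred0) ?filter_pred0 ?cats0; last first.
    by move=> x /flattenP[s /nseqP[-> _]]; rewrite inE => /eqP ->.
  by rewrite perm_sym perm_rcons.
- by rewrite elab mem_head.
- move=> v; rewrite elab inE => /predU1P[->|/map_fstP[b hb ->]]; first by rewrite leq0n.
  have hb' := bsb b hb; have h3 : (2 <= b.2)%N by apply: b2; rewrite -(perm_mem p1).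
  have [h1 h2 _] := blocks_bounds hb'; rewrite /leaf rs // sp.
  by move: h1 h2 h3; clear; lia.
- rewrite sl cat_uniq iota_uniq (perm_uniq pin) iu andbT /=; apply/hasPn => x.
  by rewrite (perm_mem pin) => /ib hx; rewrite mem_iota; move: hx; clear; lia.
- rewrite sweight size_rcons sumn_rcons -(star_leavesD ds2) /k; move: hd d2; clear; lia.
move=> kap wts hw; set phi := fillv _ _ _.
have phi0 : phi 0%N = valive.
  rewrite /phi /fillv ifN // sl mem_cat mem_iota (perm_mem pin) negb_or /=.
  by apply/negP => /ib.
have -> : elim_value p phi = (vprod (blocks 1 es) valive (fun b => message (starv phi b))).1 +
   (vprod (blocks 1 es) valive (fun b => message (starv phi b))).2.
  by have := @elim_value_attach [::] 0 es phi wn isT es1; rewrite cat0s phi0.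
have inS i : i \in flatten (map inner bs) -> i \in slots p lab by rewrite sl mem_cat orbC => ->.
have inA i : i \in A -> i \in slots p lab by rewrite sl mem_cat => ->.
have eW : rev (map wts (slots p lab)) =
    rev (map wts (flatten (map inner bs))) ++ rev (map wts A).
  by rewrite sl map_cat rev_cat.
have SP := @star_prod ds 1 bs phi kap wts (rev (map wts A)) valive p1 p3
  (fun b hb => vin_fst kap wts b hb).
rewrite bl vprod_cat SP; last by move=> i /inS; exact: hw.
  have hA b : b \in blocks (1 + sumn ds) (nseq k 1%N) ->
      message (starv phi b) = (kap b.1, kap b.1 * wts b.1).
    move=> hb; have [_ _ /nseqP[b21 _]] := blocks_bounds hb.
    rewrite /starv b21 vprod_nil -message_slotv; congr message.
    by rewrite /phi /fillv inA // /A -(fst_blocks_nseq _ k); exact: map_f.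
  rewrite mvalueE hd eW drop_size_cat; last by rewrite size_rev size_map (star_leaves_inner p3).
  rewrite prodq_rev; set c := _ * hprod _; set X := prodq (map mobius _).
  rewrite /vprod /=.
  have -> : \prod_(b <- blocks (1 + sumn ds) (nseq k 1%N)) (message (starv phi b)).1 = prodk kap A.
    rewrite /prodk /A -(fst_blocks_nseq _ k) big_map.
    by apply: eq_big_seq => b hb; rewrite hA.
  have -> : \prod_(b <- blocks (1 + sumn ds) (nseq k 1%N)) (message (starv phi b)).2 =
      prodk kap A * prodq (map wts A).
    rewrite /prodk /prodq /A -(fst_blocks_nseq _ k) !big_map -big_split.
    by apply: eq_big_seq => b hb; rewrite hA.
  rewrite sl prodk_cat /c.
  rewrite -/X; clearbody X; ring.
by move=> i hi; rewrite /phi /fillv inS.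
Qed.

(** The first label with a leaf neighbour is the first one contributing to [slots]. *)
Lemma head_slots p lab : (0 < size (slots p lab))%N ->
  head 0%N [seq w <- nbrs p (head 0%N [seq v <- lab | has (leaf p) (nbrs p v)]) | leaf p w] =
  head 0%N (slots p lab).
Proof.
rewrite /slots; elim: lab => //= v lab IH.
rewrite has_filter; case E : [seq w <- nbrs p v | leaf p w] => [|w s] /=; first exact: IH.
by rewrite E.
Qed.

Lemma slots_cat p l1 l2 : slots p (l1 ++ l2) = slots p l1 ++ slots p l2.
Proof. by rewrite /slots map_cat flatten_cat. Qed.

Lemma mem_slots p lab w : w \in slots p lab -> (w <= size p)%N && leaf p w.
Proof.
case/flattenP => _ /mapP[v _ ->]; rewrite mem_filter mem_nbrs.
by move=> /and3P[-> ->].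
Qed.

(** The first slot is consumed, the others keep their order, and the new leaves are appended. In the
    reversed list the new leaves come first and the ratio of the consumed slot last, as in the
    recursive call of [mvalue]. *)
Lemma mtree_step fuel ds d p lab : (d < size ds)%N -> sorted geq (rcons ds d) ->
  all (leq 2) (rcons ds d) -> minv fuel (drop d.-1 ds) p lab ->
  let vs := head 0%N [seq v <- lab | has (leaf p) (nbrs p v)] in
  let u := head 0%N [seq w <- nbrs p vs | leaf p w] in
  let r := join [seq star e | e <- take d.-1 ds] in
  let p' := graft p u r in
  minv fuel.+1 (rcons ds d) p'
    (lab ++ sort_by_degree p' [seq (size p + w)%N | w <- nbrs r 0]).
Proof.
move=> hd sD ge2 mi vs.
set es := take d.-1 ds; set D' := drop d.-1 ds in mi.
have [d2 ds2] : (2 <= d)%N /\ all (leq 2) ds by move: ge2; rewrite all_rcons => /andP[].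
have eds : ds = es ++ D' by rewrite cat_take_drop.
have [es2 D2] : all (leq 2) es /\ all (leq 2) D' by move: ds2; rewrite eds all_cat => /andP[].
have es1 : all (leq 1) es by exact: all_leqW es2.
have ses : size es = d.-1 by rewrite size_takel //; move: hd; clear; lia.
have sD' : (0 < size D')%N by rewrite size_drop subn_gt0; move: hd; clear; lia.
have hp := mi_wf mi.
have ssl : (0 < size (slots p lab))%N.
  by have := mi_size mi; have := sumn_ge D2; move: (size (slots _ _)) (size _) (sumn _) => x y z; clear; lia.
rewrite /vs head_slots // joinE //; set u := head 0%N _.
have esl : slots p lab = u :: behead (slots p lab).
  by rewrite /u; case: (slots p lab) ssl.
set rest := behead (slots p lab) in esl.
have us : u \in slots p lab by rewrite esl mem_head.
have /andP[hu lu] := mem_slots us.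
have u0 : u != 0%N.
  by apply: contraTneq lu => ->; have /andP[_] := mi_lab mi (mi_0 mi).
have [ur urest] : u \notin rest /\ uniq rest.
  by apply/andP; have := mi_uniq mi; rewrite esl.
have ru : rdeg p u = 1%N by apply/eqP.
have -> : graft p u (stars_code 0 1 es) = p ++ stars_code u (size p).+1 es.
  by rewrite /graft stars_code_map // addn1.
set p' := p ++ _.
set m := size p.
have se : ((u == u) * size es)%N = d.-1 by rewrite eqxx mul1n.
have hp' : wf p' := wf_attach hp hu es1.
have ru' : rdeg p' u = d by rewrite rdeg_old // ru se; move: d2; clear; lia.
have nu : rdeg p' u != 1%N by rewrite ru'; move: d2; clear; lia.
have sp : size p' = (m + sumn es)%N := size_attach p u es1.
rewrite nbrs_stars_code // blocks_shift addn1.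
have rs (b : nat * nat) : b \in blocks m.+1 es -> rdeg p' b.1 = b.2 := rdeg_start hp hu es1 (b := b).
have [||bs [p1 p2 p3]] := @sorted_starts p' m.+1 es.
- exact: rs.
- by move: sD; rewrite -cats1 => /cat_sorted2[]; rewrite eds => /cat_sorted2[].
rewrite p2; set lab' := lab ++ _.
have bsb (b : nat * nat) : b \in bs -> b \in blocks m.+1 es by rewrite (perm_mem p1).
have b2 (b : nat * nat) : b \in bs -> (2 <= b.2)%N.
  by move=> /bsb/blocks_bounds[_ _ /(allP es2)].
have sl : slots p' lab' = rest ++ flatten (map inner bs).
  rewrite slots_cat; congr (_ ++ _).
    (* For the old labels, the only change is that [u] is no longer a leaf. *)
    have -> : slots p' lab = filter (predC1 u) (slots p lab).
      rewrite /slots filter_flatten -map_comp; congr flatten; apply/eq_in_map => v hv.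
      have /andP[vm nlv] := mi_lab mi hv.
      have vu : v != u by apply: contraNneq nlv => ->.
      rewrite /= (nbrs_old hp es1 vm vu) -filter_predI; apply: eq_in_filter => w.
      rewrite mem_nbrs => /andP[wm _] /=; have [->|wu] := eqVneq w u.
        by rewrite /leaf (negbTE nu).
      by rewrite (leaf_old hp hu es1 wm wu).
    by rewrite -rem_filter ?(mi_uniq mi) // esl /= eqxx.
  rewrite /slots; congr flatten; rewrite -map_comp; apply/eq_in_map => b hb.
  exact: (leaf_nbrs_start hp hu es1 (bsb b hb) nu).
have [iu ib] := @inner_uniq m.+1 es es1.
have pin : perm_eq (flatten (map inner bs)) (flatten (map inner (blocks m.+1 es))).
  by apply/perm_flatten/perm_map.
have restm w : w \in rest -> (w <= m)%N && leaf p w.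
  by move=> hw; apply: (@mem_slots p lab); rewrite esl inE hw orbT.
have inm w : w \in flatten (map inner bs) -> (m.+1 < w < m.+1 + sumn es)%N.
  by rewrite (perm_mem pin) => /ib.
split.
- exact: hp'.
- apply: perm_trans (perm_filter _ (degs_attach hp hu es1)) _.
  rewrite filter_cat filter2_stars // eds rcons_cat perm_catC perm_cat2l.
  have iu' : u \in iota 0 m.+1 by rewrite mem_iota add0n ltnS.
  have hR := mem_rem_uniq u (iota_uniq 0 m.+1); have hpR := perm_to_rem iu'.
  move: (rem u (iota 0 m.+1)) hR hpR => R hR hpR.
  apply: perm_trans (perm_filter _ (perm_map _ hpR)) _.
  rewrite /= ru se add1n prednK ?(ltnW d2) // d2 perm_sym perm_rcons perm_cons perm_sym.
  apply: perm_trans (mi_deg mi).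
  have -> : degs p = [seq rdeg p v | v <- iota 0 m.+1].
    by apply/eq_in_map => v; rewrite mem_iota => /andP[_ hv]; rewrite rdegE.
  rewrite perm_sym; apply: perm_trans (perm_filter _ (perm_map _ hpR)) _.
  rewrite /= ru /=; set s1 := filter _ _; set s2 := filter _ _; suff -> : s1 = s2 by [].
  congr filter; apply/eq_in_map => v.
  by rewrite hR inE => /andP[/negbTE -> _]; rewrite mul0n addn0.
- by rewrite mem_cat (mi_0 mi).
- move=> v; rewrite mem_cat => /orP[hv|/map_fstP[b hb ->]].
    have /andP[vm nlv] := mi_lab mi hv.
    have vu : v != u by apply: contraNneq nlv => ->.
    by rewrite (leaf_old hp hu es1 vm vu) nlv sp (leq_trans vm) ?leq_addr.
  have [h1 h2 _] := blocks_bounds (bsb b hb); have := b2 b hb.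
  rewrite /leaf rs ?bsb // sp; move: h1 h2; clear; lia.
- rewrite sl cat_uniq urest (perm_uniq pin) iu andbT /=; apply/hasPn => x /inm hx.
  by apply/negP => /restm/andP[h _]; move: hx h; clear; lia.
- rewrite sl size_cat -(star_leaves_inner p3) size_rcons sumn_rcons eds size_cat sumn_cat ses.
  have := mi_size mi; rewrite esl /= -/D' -(star_leavesD es2) ses; move: d2; clear; lia.
move=> kap wts hw; set phi := fillv _ _ _.
have phiu : phi u = valive.
  rewrite /phi /fillv ifN // sl mem_cat negb_or ur; apply/negP => /inm.
  by move: hu; rewrite -/m; clear; lia.
have phifst (b : nat * nat) : b \in bs -> phi b.1 = valive.
  move=> hb; rewrite /phi /fillv ifN // sl mem_cat negb_or.
  have [h1 _ _] := blocks_bounds (bsb b hb); apply/andP; split; apply/negP.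
    by move=> /restm/andP[h _]; move: h1 h; clear; lia.
  case/flattenP => _ /mapP[[c1 c2] hc ->]; rewrite mem_iota => hi.
  set c : nat * nat := (c1, c2) in hc hi.
  have := rdeg_inner hp hu es1 (bsb c hc) (w := b.1); rewrite -/p' rs ?bsb //.
  have := b2 b hb; have := b2 c hc; move: hi; rewrite /=; clear; lia.
have inS i : i \in flatten (map inner bs) -> i \in slots p' lab' by rewrite sl mem_cat orbC => ->.
pose W2 := rev (map wts rest).
have eW : rev (map wts (slots p' lab')) = rev (map wts (flatten (map inner bs))) ++ W2.
  by rewrite sl map_cat rev_cat.
have SP := @star_prod es m.+1 bs phi kap wts W2 valive p1 p3 phifst.
rewrite elim_value_attach // phiu SP; [|by move=> i hi; rewrite /phi /fillv inS|by move=> i /inS; exact: hw].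
rewrite mvalueE leqNgt hd /= -/es -/D' eW drop_size_cat; last first.
  by rewrite size_rev size_map (star_leaves_inner p3).
set xs := star_prods _ _; set c := prodk _ _ * _; set X := prodq (map mobius xs).
have xs01 x : x \in xs -> 0 < x <= 1.
  rewrite /xs star_prods_inner // mem_rev => /mapP[b hb ->]; apply: prodq01 => _ /mapP[i hi ->].
  by apply/hw/inS/flattenP; exists (inner b) => //; exact: map_f.
have X01 : 0 < X <= 1.
  by apply: prodq01 => _ /mapP[x /xs01 hx ->]; case/andP: (mobius_bounds hx) => -> /ltW ->.
(* After absorbing the grafted stars, [u] has vector (8 c, -5 c X). This is [slotv] with scale c (8
   - 5 X) and ratio [mobius X], so the invariant of the smaller tree applies. *)
pose kap' v := if v == u then c * (8 - 5 * X) else kap v.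
pose wts' v := if v == u then mobius X else wts v.
have mval' := @mi_val _ _ _ _ mi kap' wts'.
have e1 : elim_value p (fupd phi u (valive.1 * c, valive.2 * (c * X))) =
    elim_value p (fillv (slots p lab) kap' wts').
  apply: elim_value_ext => // v hv; rewrite /fupd /fillv esl inE.
  have [->|vu] /= := eqVneq v u.
    rewrite /slotv /kap' /wts' eqxx /mobius /=; congr (_, _).
      by field; apply: lt0r_neq0; case/andP: X01 => _; clear; lra.
    by field; apply: lt0r_neq0; case/andP: X01 => _; clear; lra.
  rewrite /phi /fillv sl mem_cat.
  have -> : (v \in flatten (map inner bs)) = false.
    by apply/negbTE/negP => /inm; move: hv; rewrite -/m; clear; lia.
  by rewrite orbF /slotv /kap' /wts' (negbTE vu).
rewrite e1 mval'; last first.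
  move=> v; rewrite esl inE /wts'; have [_ _|vu /= vr] := eqVneq v u.
    by case/andP: (mobius_bounds X01) => -> /ltW ->.
  by apply: hw; rewrite sl mem_cat vr.
have er (T : Type) (f : nat -> T) g : (forall v, v != u -> f v = g v) -> map f rest = map g rest.
  by move=> h; apply/eq_in_map => v vr; apply: h; apply: contraNneq ur => <-.
rewrite esl [map wts' _]/= rev_cons (er _ wts' wts); last by move=> v /negbTE h; rewrite /wts' h.
have -> : wts' u = mobius X by rewrite /wts' eqxx.
rewrite sl prodk_cat -/W2.
have -> : prodk kap' (u :: rest) = c * (8 - 5 * X) * prodk kap rest.
  rewrite /prodk big_cons {1}/kap' eqxx; congr (_ * _); apply: eq_big_seq => v vr.
  by rewrite /kap' ifN //; apply: contraNneq ur => <-.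
by rewrite /c; move: (prodk kap rest) (mvalue _ _ _) => a1 a2; ring.
Qed.

Local Close Scope ring_scope.

Lemma mtree_minv fuel ds : size ds <= fuel -> ds != [::] -> sorted geq ds ->
  all (leq 2) ds -> minv fuel ds (mtree_rec fuel ds).1 (mtree_rec fuel ds).2.
Proof.
elim: fuel ds => [|fuel IH] ds; first by case: ds.
case/lastP: ds => // ds d hf _ sD ge2.
have d2 : 2 <= d by move: ge2; rewrite all_rcons => /andP[].
have tk : take (size (rcons ds d)).-1 (rcons ds d) = ds.
  by rewrite size_rcons -cats1 take_size_cat.
have [hd|hd] := leqP (size ds) d.
  have -> : mtree_rec fuel.+1 (rcons ds d) =
    (let p := join ([seq star e | e <- ds] ++ nseq (d - size ds) (star 1)) in
     (p, 0 :: sort_by_degree p [seq v <- iota 1 (size p) | ~~ leaf p v])).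
    by rewrite /= last_rcons tk size_rcons ltnS hd.
  exact: mtree_base.
have tk2 : take d.-1 (rcons ds d) = take d.-1 ds.
  by rewrite -cats1 takel_cat //; move: hd; clear; lia.
have -> : mtree_rec fuel.+1 (rcons ds d) =
  let: (p, lab) := mtree_rec fuel (drop d.-1 ds) in
  let vs := head 0 [seq v <- lab | has (leaf p) (nbrs p v)] in
  let u := head 0 [seq w <- nbrs p vs | leaf p w] in
  let r := join [seq star e | e <- take d.-1 ds] in
  let p' := graft p u r in
  (p', lab ++ sort_by_degree p' [seq size p + w | w <- nbrs r 0]).
  by rewrite [LHS]/= last_rcons tk tk2 size_rcons ltnS leqNgt hd.
have : minv fuel (drop d.-1 ds) (mtree_rec fuel (drop d.-1 ds)).1
    (mtree_rec fuel (drop d.-1 ds)).2.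
  apply: IH.
  - by move: hf; rewrite size_drop size_rcons; clear; lia.
  - by rewrite -size_eq0 size_drop; move: hd d2; clear; lia.
  - by apply: drop_sorted; move: sD; rewrite -cats1 => /cat_sorted2[].
  - by apply/allP => x /mem_drop; apply/allP; move: ge2; rewrite all_rcons => /andP[].
case: (mtree_rec fuel _) => p lab mi; exact: mtree_step.
Qed.

(** * Degree sequences and the final comparison *)

Lemma sumn_degs p : wf p -> sumn (degs p) = 2 * size p.
Proof.
move=> hp; rewrite degsE /=.
have key n (s : seq nat) : {in s, forall x, x <= n} ->
    count_mem 0 s + sumn [seq (count_mem v s).+1 | v <- iota 1 n] = size s + n.
  elim: s => [|x s IH] hs.
    rewrite !add0n; have h1 : forall k m, sumn [seq 1 | v <- iota k m] = m.
      by move=> k m; elim: m k => //= m IH k; rewrite IH.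
    exact: h1.
  have xn : x <= n by apply: hs; exact: mem_head.
  have {}IH := IH (fun y hy => hs y (mem_behead (s := x :: s) hy)).
  have -> : sumn [seq (count_mem v (x :: s)).+1 | v <- iota 1 n] =
     sumn [seq (count_mem v s).+1 | v <- iota 1 n] + (0 < x).
    have : count_mem x (iota 1 n) = (0 < x).
      by rewrite count_uniq_mem ?iota_uniq // mem_iota add1n ltnS xn andbT.
    move=> <-; elim: (iota 1 n) => //= v t ->.
    by rewrite (eq_sym x v); move: (v == x); clear; lia.
  move: IH; rewrite /= (eq_sym x 0) lt0n; clear; lia.
rewrite key ?mul2n ?addnn // => x /(wf_lt hp); exact: ltnW.
Qed.

Lemma degs_pos p : wf p -> 0 < size p -> all (leq 1) (degs p).
Proof.
move=> hp s0; rewrite degsE /=; apply/andP; split; last by apply/allP => _ /mapP[v _ ->].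
rewrite -has_count has_pred1; case: p hp s0 => // a p hp _.
by have := hp 0 isT; rewrite /= leqn0 => /eqP ->; rewrite mem_head.
Qed.

(** The remaining degrees are all 1, and their number follows from the degree sum. *)
Lemma perm_degs p q : wf p -> wf q -> 0 < size p -> 0 < size q ->
  perm_eq [seq d <- degs p | 2 <= d] [seq d <- degs q | 2 <= d] ->
  perm_eq (degs p) (degs q).
Proof.
have ones r : wf r -> 0 < size r -> [seq d <- degs r | ~~ (2 <= d)] =
    nseq (size [seq d <- degs r | ~~ (2 <= d)]) 1.
  move=> hr s0; apply/all_pred1P/allP => x; rewrite mem_filter => /andP[h1 h2].
  by have := allP (degs_pos hr s0) x h2; move: h1; rewrite /=; clear; lia.
have cnt r : wf r -> 0 < size r ->
    size [seq d <- degs r | ~~ (2 <= d)] + 2 * size [seq d <- degs r | 2 <= d] =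
    sumn [seq d <- degs r | 2 <= d] + 2.
  move=> hr s0; have := sumn_degs hr; have := size_degs r.
  have hp := permEl (perm_filterC (leq 2) (degs r)).
  rewrite -(perm_size hp) -(perm_sumn hp) size_cat sumn_cat.
  have e1 : sumn [seq d <- degs r | ~~ (2 <= d)] = size [seq d <- degs r | ~~ (2 <= d)].
    by rewrite {1}(ones r hr s0) sumn_nseq mul1n.
  rewrite e1; move: (size _) (size [seq d <- _ | 2 <= d]) (sumn _) (size r) => a b c n.
  clear; lia.
move=> hp hq sp sq h.
have hpp := permEl (perm_filterC (leq 2) (degs p)).
have hqq := permEl (perm_filterC (leq 2) (degs q)).
rewrite -(permPl hpp) -(permPr hqq); apply: perm_cat => //.
have e : size [seq d <- degs p | ~~ (2 <= d)] = size [seq d <- degs q | ~~ (2 <= d)].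
  by have := cnt p hp sp; rewrite (perm_size h) (perm_sumn h) -(cnt q hq sq) => /addIn.
by rewrite (ones p) // (ones q) // e.
Qed.

Lemma sort_geq_perm (s t : seq nat) : perm_eq s t -> sort geq s = sort geq t.
Proof.
move=> h; apply: (sorted_eq (rev_trans leq_trans)).
- by move=> x y /andP[h1 h2]; apply: anti_leq; rewrite h1 h2.
- by apply: sort_sorted => x y; exact: leq_total.
- by apply: sort_sorted => x y; exact: leq_total.
- by rewrite perm_sort perm_sym perm_sort perm_sym.
Qed.

Lemma tree_coded (V : finType) (e : rel V) (x0 : V) : is_tree e ->
  exists p, [/\ wf p, degree_seq e = sort geq (degs p), count_mem 0 p = degree e x0 &
    (solvability e)%:R%R = elim_value p (fun _ => valive)].
Proof.
move=> te; have [[esym eirr] _ _ _] := te.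
have [g [p [hc hV g0]]] := ordering te x0; exists p; split.
- exact: cd_wf hc.
- by apply: sort_geq_perm; exact: coded_degs hc hV.
- by rewrite -g0 (coded_degree esym eirr hc hV) // addn0.
- exact: (solvability_coded esym eirr hc hV).
Qed.

Lemma graph_of_degree_seq p : wf p -> degree_seq (graph_of p) = sort geq (degs p).
Proof.
move=> hp; apply: sort_geq_perm.
have := coded_degs (@graph_of_sym p) (graph_of_irr hp) (coded_graph_of hp); apply.
by rewrite card_ord.
Qed.

Lemma graph_of_solvability p : wf p ->
  (solvability (graph_of p))%:R%R = elim_value p (fun _ => valive).
Proof.
move=> hp; apply: (solvability_coded (@graph_of_sym p) (graph_of_irr hp) (coded_graph_of hp)).
by rewrite card_ord.
Qed.

(** With three vertices, the parent of vertex 2 is 0 or 1, which then has degree at least 2. *)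
Lemma small_code p : wf p -> all (fun d => d <= 1) (degs p) -> p = star (size p).+1.
Proof.
move=> hp h; rewrite /star /=.
case: p hp h => [//|a [|b p]] hp h.
  by have := hp 0 isT; rewrite /= leqn0 => /eqP ->.
have a0 : a = 0 by have := hp 0 isT; rewrite /= leqn0 => /eqP.
have := hp 1 isT; rewrite /= => b1; exfalso; move: h; rewrite degsE /= a0.
by case: b b1 {hp} => [|[|b]] b1 /=; rewrite ?add0n ?add1n ?ltnS ?andbF //. 
Qed.

Local Open Scope ring_scope.

Lemma mobius_ge x : 0 < x <= 1 -> 2 / 3 <= mobius x.
Proof.
move=> /andP[x0 x1]; rewrite /mobius ler_pdivlMr; last by lra.
by rewrite mulrAC ler_pdivrMr; lra.
Qed.

Lemma sorted_nseq (x : rat) n : sorted <=%R (nseq n x).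
Proof. by elim: n => // -[|n] //= ->; rewrite lexx. Qed.

(** The initial ratio 2/3 is the value of [mobius] at 1, its least value on (0, 1]. *)
Lemma low_leaves_nseq ds n : low_leaves ds (nseq n (2 / 3)).
Proof.
move=> w /nseqP[-> _].
have p1 : 0 < prodq (take (head 0%N ds).-1 (nseq n (2 / 3))) <= 1.
  by apply: prodq01 => x /mem_take /nseqP[-> _].
have /andP[h0 h1] := mobius_bounds p1.
split; [by [] | exact: mobius_ge |].
by apply: mobius_ge; rewrite exprn_gt0 //=; apply: exprn_ile1; exact: ltW.
Qed.

Lemma minv_value fuel ds p lab : minv fuel ds p lab ->
  elim_value p (fun _ => valive) = 3 ^+ size (slots p lab) *
    mvalue fuel ds (nseq (size (slots p lab)) (2 / 3)).
Proof.
move=> mi; have := @mi_val _ _ _ _ mi (fun _ => 3) (fun _ => 2 / 3) (fun _ _ => isT).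
have -> : elim_value p (fillv (slots p lab) (fun _ => 3) (fun _ => 2 / 3)) = elim_value p (fun _ => valive).
  apply: elim_value_ext; first exact: mi_wf mi.
  by move=> v _; rewrite /fillv; case: ifP => // _; rewrite /slotv /valive; congr (_, _); field.
have -> : rev (map (fun=> 2 / 3) (slots p lab)) = nseq (size (slots p lab)) (2 / 3) :> seq rat.
  by elim: (slots p lab) => //= v s IH; rewrite rev_cons IH; elim: (size s) => //= k ->.
have -> : prodk (fun=> 3) (slots p lab) = 3 ^+ size (slots p lab).
  by elim: (slots p lab) => [|v s IH]; rewrite /prodk ?big_nil ?big_cons // -/(prodk _ _) IH exprS.
by [].
Qed.

Local Close Scope ring_scope.

Theorem theorem3p14 (D : seq nat)
  (hD : exists (V : finType) (e : rel V), is_tree e /\ degree_seq e = D) :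
  [/\ is_tree (mtree D),
      degree_seq (mtree D) = D
    & forall (V : finType) (e : rel V), is_tree e -> degree_seq e = D ->
        solvability (mtree D) <= solvability e].
Proof.
have coded_of (V : finType) (e : rel V) : is_tree e -> exists x0 : V, True.
  by case=> _ /card_gt0P[x0 _] _ _; exists x0.
have [V0 [e0 [t0 D0]]] := hD; have [x0 _] := coded_of _ _ t0.
have [p0 [w0 d0 _ _]] := tree_coded x0 t0; rewrite D0 in d0.
have pD : perm_eq D (degs p0) by rewrite d0 perm_sort.
have sD : sorted geq D by rewrite d0; apply: sort_sorted => a b; exact: leq_total.
have pred_ : perm_eq (reduced D) [seq d <- degs p0 | (2 <= d)%N] by exact: perm_filter.
(* Without a degree of at least 2 there are at most two vertices; the code is determined by [D], and
   the two solvabilities coincide. *)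
case E : (reduced D) => [|d ds].
  have code p : wf p -> perm_eq D (degs p) -> p = mtree_code D.
    move=> hp h; rewrite /mtree_code E (perm_size h) size_degs.
    apply: small_code => //; rewrite -(perm_all _ h); apply/allP => x xD.
    rewrite leqNgt; apply/negP => x2.
    have : x \in reduced D by rewrite mem_filter x2.
    by rewrite E.
  have ec := code p0 w0 pD.
  rewrite /mtree -ec; split.
  - exact: graph_of_tree.
  - by rewrite graph_of_degree_seq.
  move=> V e te dE; have [x1 _] := coded_of _ _ te.
  have [p [hp d1 _ s1]] := tree_coded x1 te; rewrite dE in d1.
  rewrite -(ler_nat rat) s1 graph_of_solvability // ec -(code p hp) //.
  by rewrite d1 perm_sort.
have dsne : reduced D != [::] by rewrite E.
have ds2 : all (leq 2) (reduced D) by apply: filter_all.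
have dss : sorted geq (reduced D) by apply: sorted_filter => // a b c h1 h2; exact: leq_trans h2 h1.
have mi := mtree_minv (leqnn _) dsne dss ds2.
have ec : mtree_code D = (mtree_rec (size (reduced D)) (reduced D)).1.
  by rewrite /mtree_code E.
rewrite -ec in mi; set lab := _.2 in mi.
have hp := mi_wf mi.
have sz p : perm_eq [seq d <- degs p | (2 <= d)%N] (reduced D) -> (0 < size p)%N.
  move=> h; rewrite lt0n; apply/negP => /eqP/size0nil ep.
  by move: (perm_size h); rewrite ep E.
have pdeg : perm_eq (degs (mtree_code D)) (degs p0).
  apply: perm_degs => //; [exact: sz (mi_deg mi) | by apply: sz; rewrite perm_sym|].
  exact: perm_trans (mi_deg mi) pred_.
rewrite /mtree; split.
- exact: graph_of_tree.
- by rewrite graph_of_degree_seq // (sort_geq_perm pdeg) -d0.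
move=> V e te dE.
(* A non-leaf root is needed to place the tree in the class of its reduced degrees. *)
have [x1 hx1] : exists x : V, (2 <= degree e x)%N.
  have : d \in reduced D by rewrite E mem_head.
  rewrite mem_filter -dE mem_sort => /andP[h /mapP[x _ ex]]; exists x; by rewrite -ex.
have [p [hp1 d1 c1 s1]] := tree_coded x1 te; rewrite dE in d1.
rewrite -(ler_nat rat) s1 graph_of_solvability // (minv_value mi) elim_value_rose.
have h2 : (1 < count_mem 0%N p)%N by rewrite c1.
have := rose_in_class hp1 h2.
have dp : perm_eq [seq d <- degs p | (2 <= d)%N] (reduced D).
  by apply: perm_filter; rewrite d1 perm_sym perm_sort.
rewrite (in_class_perm_deg _ _ dp) => hk.
(* Both trees have the same number of leaves, so the powers of 3 cancel and only weights are
   compared. *)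
have eL : size (lleaves (rose p)) = size (slots (mtree_code D) lab).
  have := handshake hk; rewrite size_cat !size_map size_nseq addn0 -(mi_size mi).
  by move/addIn.
rewrite eL in hk *; rewrite ler_pM2l ?exprn_gt0 //.
apply: (mvalue_le (leqnn _) dsne dss ds2 (sorted_nseq _ _) (@low_leaves_nseq _ _) hk).
Qed.
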